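(* Let $X$ be a compact metric space, $T\colon X\to X$ a continuous onto map, $\varphi\in C(X)$, and let $\nu$ be a weak Gibbs measure for $\varphi$. (i) If the entropy map $h(T,\cdot)\colon M_1(X,T)\to[0,\infty]$ is upper semi-continuous, then for every closed $F\subset M_1(X)$ $$\limsup_{m\to\infty}\frac{1}{m}\ln\nu\big(\{x\in X\colon \mathcal{E}_m(x)\in F\}\big)\leq \sup_{\rho\in F\cap M_1(X,T)}\Big(h(T,\rho)+\int\varphi\,d\rho\Big)\,.$$ (ii) If the ergodic measures are entropy dense, then for every open $G\subset M_1(X)$ $$\liminf_{m\to\infty}\frac{1}{m}\ln\nu\big(\{x\in X\colon \mathcal{E}_m(x)\in G\}\big)\geq \sup_{\rho\in G\cap M_1(X,T)}\Big(h(T,\rho)+\int\varphi\,d\rho\Big)\,.$$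
   Context: $(X,d)$ is a compact metric space and $T\colon X\to X$ is continuous and onto. $C(X)$ is the set of continuous real-valued functions on $X$. $M_1(X)$ is the set of Borel probability measures on $X$ with the weak convergence topology, and $M_1(X,T)\subset M_1(X)$ is the subset of $T$-invariant probability measures. For $\rho\in M_1(X,T)$, $h(T,\rho)$ is the metric (Kolmogorov–Sinai) entropy. The empirical measure is $\mathcal{E}_n(x):=\frac{1}{n}\sum_{k=0}^{n-1}\delta_{T^kx}$, and the dynamical ball is $B_m(x,\varepsilon):=\{y\in X\colon d(T^kx,T^ky)\leq\varepsilon,\ k=0,\ldots,m-1\}$. Definition. Let $\varphi\in C(X)$. A Borel probability measure $\nu$ on $X$ (not assumed $T$-invariant) is a weak Gibbs measure for $\varphi$ if for every $\delta>0$ there exists $\varepsilon_\delta>0$ such that for every $0<\varepsilon\leq\varepsilon_\delta$ there exists $N_{\delta,\varepsilon}<\infty$ such that for all $m\geq N_{\delta,\varepsilon}$ and all $x\in X$, $$-\delta\leq\frac{1}{m}\ln\nu(B_m(x,\varepsilon))-\int\varphi\,d\mathcal{E}_m(x)\leq\delta\,.$$ Definition. The ergodic measures are entropy dense if for any $\mu\in M_1(X,T)$, any neighbourhood $N$ of $\mu$ and any $h^*<h(T,\mu)$, there exists an ergodic ($T$-invariant) probability measure $\rho\in N$ such that $h(T,\rho)\geq h^*$. Standard conventions: $\ln 0=-\infty$ and $\sup\emptyset=-\infty$. *)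

(* Defs.v *)
From HB Require Import structures.
From mathcomp Require Import all_boot all_order all_algebra.
From mathcomp Require Import all_classical all_reals all_analysis.
Set Implicit Arguments.
Unset Strict Implicit.
Unset Printing Implicit Defensive.
Import Order.TTheory GRing.Theory Num.Theory.
Import numFieldNormedType.Exports.
Local Open Scope classical_set_scope.
Local Open Scope ring_scope.

(* The library requires the carrier of a measurableType to be pointed. For a
   metric space that carries a probability measure this only names a point. *)
#[short(type="pmetricType")]
HB.structure Definition PointedMetric (K : numDomainType) :=
  {M of Pointed M & Metric K M}.

Notation borel X := (g_sigma_algebraType (@open X)).

(* Two elements of [M1 R X] may be different terms and yet agree on all Borel
   sets, because a measure is a function on arbitrary sets. Such measures are
   topologically indistinguishable for the weak topology below, so open and
   closed subsets of [M1 R X] do not separate them. *)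
Definition M1 (R : realType) (X : pmetricType R) : Type :=
  probability (borel X) R.

HB.instance Definition _ (R : realType) (X : pmetricType R) :=
  Choice.on (M1 X).

Definition integral_pairing (R : realType) (X : pmetricType R) (mu : M1 X) :
  {ptws continuousType X R -> R} := fun f => \int[mu]_x f x.

(* The coarsest topology making mu |-> \int f dmu continuous for all f in C(X) *)
HB.instance Definition _ (R : realType) (X : pmetricType R) :=
  Topological.copy (M1 X) (initial_topology (@integral_pairing R X)).

Section dynamics.
Context {R : realType} {X : pmetricType R}.
Local Notation M1 := (@M1 R X).

Definition dynamical_ball (T : X -> X) (m : nat) (x : X) (eps : R) : set X :=
  [set y | forall k, (k < m)%N -> mdist (iter k T x) (iter k T y) <= eps].

(* The sum of n Dirac masses has total mass n, so for n > 0 normalizing divides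
   it by n (see [empiricalE]). For n = 0 this is \d_x, so that [empirical T n x]
   is a probability measure for all n. *)
Definition empirical (T : X -> X) (n : nat) (x : X) : M1 :=
  mnormalize (msum (fun k => \d_(iter k T x : borel X)) n) \d_(x : borel X).

Lemma empiricalE (T : X -> X) (n : nat) (x : X) (A : set X) : (0 < n)%N ->
  empirical T n x A = ((n%:R^-1)%:E * \sum_(k < n) \d_(iter k T x : borel X) A)%E.
Proof.
move=> n0.
have mnormalizeE d (Y : measurableType d) (mu : {measure set Y -> \bar R})
    (P : probability Y R) (r : R) (B : set Y) :
    mu setT = r%:E -> r != 0 -> mnormalize mu P B = (r^-1%:E * mu B)%E.
  by rewrite /mnormalize => -> r0; rewrite eqe (negbTE r0) /= muleC.
rewrite /empirical [LHS](mnormalizeE _ _ _ _ n%:R) ?pnatr_eq0 -?lt0n//.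
rewrite /= /msum (eq_bigr (fun=> 1%E)); last by move=> k _; exact: diracT.
by rewrite sumEFin sumr_const card_ord.
Qed.

Definition invariant_measures (T : X -> X) : set M1 :=
  [set mu | forall A : set (borel X),
    measurable A -> mu (T @^-1` A) = mu A].

Definition ergodic (T : X -> X) (mu : M1) : Prop :=
  invariant_measures T mu /\
  forall A : set (borel X),
    measurable A -> T @^-1` A = A -> mu A = 0%E \/ mu A = 1%E.

Definition measurable_partition (k : nat)
    (P : 'I_k -> set (borel X)) : Prop :=
  [/\ forall i, measurable (P i), trivIset setT P & \bigcup_i P i = setT].

(* The atoms of the join of T^{-i} P over i < n, indexed by words of length n;
   an empty atom contributes 0 to the entropy. *)
Definition join_atom (T : X -> X) (k : nat) (P : 'I_k -> set X) (n : nat)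
    (w : {ffun 'I_n -> 'I_k}) : set X :=
  \bigcap_(i in [set: 'I_n]) (iter i T @^-1` P (w i)).

(* [ln 0 = 0] in the library, whence 0 ln 0 = 0. *)
Definition join_entropy (T : X -> X) (mu : M1) (k : nat) (P : 'I_k -> set X)
    (n : nat) : R :=
  - \sum_(w : {ffun 'I_n -> 'I_k})
      fine (mu (join_atom T P w)) * ln (fine (mu (join_atom T P w))).

Definition partition_entropy (T : X -> X) (mu : M1) (k : nat)
    (P : 'I_k -> set X) : R :=
  limn (fun n => n%:R^-1 * join_entropy T mu P n).

Definition entropy (T : X -> X) (mu : M1) : \bar R :=
  ereal_sup [set h | exists (k : nat) (P : 'I_k -> set X),
    measurable_partition P /\ h = (partition_entropy T mu P)%:E].

Definition upper_semicontinuous_on {Y : topologicalType} (D : set Y)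
    (f : Y -> \bar R) : Prop :=
  forall y, D y -> forall a : R, (f y < a%:E)%E ->
    \forall z \near within D (nbhs y), (f z < a%:E)%E.

Definition entropy_dense (T : X -> X) : Prop :=
  forall mu : M1, invariant_measures T mu ->
  forall N : set M1, nbhs mu N ->
  forall hstar : R, (hstar%:E < entropy T mu)%E ->
  exists rho : M1, [/\ ergodic T rho, N rho & (hstar%:E <= entropy T rho)%E].

Definition weak_gibbs (T : X -> X) (phi : X -> R) (nu : M1) : Prop :=
  forall delta : R, 0 < delta ->
  exists2 eps_delta : R, 0 < eps_delta &
  forall eps : R, 0 < eps -> eps <= eps_delta ->
  exists N : nat, forall m : nat, (N <= m)%N -> forall x : X,
    (- delta%:E
      <= (m%:R^-1)%:E * lne (nu (dynamical_ball T m x eps))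
         - (\int[empirical T m x]_y phi y)%:E
      <= delta%:E)%E.

End dynamics.

(* Main.v *)
(* Upper bound. Given m, a maximal (m, e)-separated set of points x with E_m(x)
   in a closed convex U covers {E_m in U} by dynamical balls, so the weak Gibbs
   property bounds nu(E_m in U) by Z = sum_x exp(S_m phi(x)) up to exp(m d).
   Misiurewicz's argument turns (ln Z)/m into h(mu) + int phi dmu, where mu is a
   limit point of the averages of the E_m(x) with weights exp(S_m phi(x)) / Z:
   it lies in U by convexity and it is invariant. Upper semicontinuity makes
   these values close to the supremum when U is a small neighbourhood of a point
   of F, and F is covered by finitely many such U because M_1(X) is compact,
   which follows from the Riesz representation theorem (taking limits of
   integrals along an ultrafilter).

   Lower bound. By entropy density it is enough to consider an ergodic rho in G.
   By the ergodic theorem the set of points whose m-th empirical averages are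
   close to the rho-averages has rho-measure tending to 1. If N balls of order m
   and radius 2 e cover it, the index of a ball containing x determines the
   itinerary of x for a partition, up to errors which are rare at each time;
   hence H(P^m) <= ln (N + 1) + o(m), and so N >= exp(m (h(rho) - o(1))). For a
   maximal (m, 2 e)-separated set of such points the balls of radius e are
   disjoint, are contained in {E_m in G}, and each have nu-measure at least
   exp(m (int phi drho - o(1))). *)
From HB Require Import structures.
Require Import Defs.
From mathcomp Require Import all_boot all_order all_algebra.
From mathcomp Require Import all_classical all_reals all_analysis.
From mathcomp Require Import measurable_realfun.
From mathcomp Require Import ring lra.
Import Order.TTheory GRing.Theory Num.Theory.
Import numFieldNormedType.Exports.
Set Implicit Arguments.
Unset Strict Implicit.
Unset Printing Implicit Defensive.
Local Open Scope classical_set_scope.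
Local Open Scope ring_scope.

(** * Entropy of finite distributions *)

Section shannon.
Context {R : realType}.

(** In the upper bound entropy has to survive a weak limit although it is not weakly continuous in
    the measure. The scale [e] of the separated sets is fixed by the weak Gibbs property before the
    limit is taken; a partition finer than [e] with null boundaries is chosen afterwards, for the
    limit measure, and for each fixed word length only upper semicontinuity of a finite Shannon
    entropy is used. Neighbourhoods are cut out by finitely many weak inequalities between
    integrals, since such sets are closed and convex at once. In the lower bound neither a pointwise
    ergodic theorem nor the Shannon-McMillan-Breiman theorem is called for: the entropy of a word is
    at most the sum of the entropies of its letters, so coding errors need only be rare at each
    single time, and Birkhoff averages need only converge in probability for finitely many
    continuous functions. The weak Gibbs property holds at all small radii, so there the radius can
    be adapted to a compact set on which nearby points share an atom of the partition. *)

Definition shannon (I : finType) (p : I -> R) : R := - \sum_i p i * ln (p i).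

(** The tangent bound [ln x <= x - 1] at [x = q / p], multiplied by [p]. Since [ln 0 = 0], the case
    [q = 0 < p] has to be excluded by hypothesis. *)
Lemma mulr_ln_ge (p q : R) : 0 <= p -> 0 <= q -> (q = 0 -> p = 0) ->
  p * ln q - p * ln p <= q - p.
Proof.
move=> p0 q0 qp; have [->|pn0] := eqVneq p 0; first by rewrite !mul0r !subr0.
have {p0 pn0} p0 : 0 < p by rewrite lt_def pn0.
have {}q0 : 0 < q.
  by rewrite lt_def q0 andbT; apply: contraTneq p0 => /qp ->; rewrite ltxx.
rewrite -mulrBr -ln_div ?posrE// -[leRHS](@mulfVK _ p) ?gt_eqF// [leRHS]mulrC.
rewrite ler_pM2l// mulrBl divff ?gt_eqF//.
have := @le_ln1Dx R (q / p - 1); rewrite (addrC 1) subrK; apply.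
by rewrite ltrBDl subrr divr_gt0.
Qed.

(** Most entropy estimates below are this inequality for a well-chosen [q]: the uniform
    distribution, a product of marginals, a mixture, or a perturbed limit distribution. Allowing [q]
    a smaller total mass than [p] spares normalizing it. *)
Lemma shannon_gibbs (I : finType) (p q : I -> R) :
  (forall i, 0 <= p i) -> (forall i, 0 <= q i) ->
  (forall i, q i = 0 -> p i = 0) -> \sum_i q i <= \sum_i p i ->
  shannon p <= - \sum_i p i * ln (q i).
Proof.
move=> p0 q0 qp sqp; rewrite /shannon lerN2 -subr_le0 -sumrB.
apply: (@le_trans _ _ (\sum_i (q i - p i))); last by rewrite sumrB subr_le0.
by apply: ler_sum => i _; apply: mulr_ln_ge => //; exact: qp.
Qed.

Lemma shannon_ge0 (I : finType) (p : I -> R) :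
  (forall i, 0 <= p i) -> (forall i, p i <= 1) -> 0 <= shannon p.
Proof.
move=> p0 p1; rewrite /shannon oppr_ge0; apply: sumr_le0 => i _.
by rewrite mulr_ge0_le0 ?ln_le0.
Qed.

Lemma shannon_le_ln_card (I : finType) (p : I -> R) :
  (forall i, 0 <= p i) -> \sum_i p i = 1 -> shannon p <= ln #|I|%:R.
Proof.
move=> p0 p1.
have I0 : (0 < #|I|)%N.
  rewrite lt0n; apply/negP => /eqP I0; have := oner_neq0 R.
  by rewrite -p1 big1 ?eqxx// => i; have := fintype0 i I0.
apply: (le_trans (@shannon_gibbs _ p (fun=> #|I|%:R^-1) _ _ _ _)) => //.
- by move=> i /eqP; rewrite invr_eq0 pnatr_eq0 eqn0Ngt I0.
- by rewrite p1 sumr_const -[_ *+ _]mulr_natl divff// pnatr_eq0 -lt0n.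
- by rewrite -mulr_suml p1 mul1r lnV ?opprK// posrE ltr0n.
Qed.

(** The mass of a fibre dominates that of each of its points, and [ln] is increasing. *)
Lemma ler_shannon_coarse (I J : finType) (h : I -> J) (p : I -> R) :
  (forall i, 0 <= p i) ->
  shannon (fun j => \sum_(i | h i == j) p i) <= shannon p.
Proof.
move=> p0; rewrite /shannon lerN2 (partition_big h xpredT)//=.
apply: ler_sum => j _; rewrite mulr_suml; apply: ler_sum => i /eqP hij.
have [->|pi0] := eqVneq (p i) 0; first by rewrite !mul0r.
have pi_gt0 : 0 < p i by rewrite lt_def pi0 p0.
have le_p : p i <= \sum_(i | h i == j) p i.
  by rewrite (bigD1 i) ?hij//= lerDl sumr_ge0.
by rewrite ler_pM2l// ler_ln// posrE (lt_le_trans pi_gt0).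
Qed.

(** Merging back along a left inverse [g] of [h] recovers [p], so the coarsening inequality can be
    used in the reverse direction. The default value of [g] does no harm: points outside the image
    of [h] have mass 0. *)
Lemma ler_shannon_injective (I J : finType) (h : I -> J) (p : I -> R) :
  (forall i, 0 <= p i) -> injective h ->
  shannon p <= shannon (fun j => \sum_(i | h i == j) p i).
Proof.
move=> p0 hI; case: (pickP (@predT I)) => [i0 _|I0]; last first.
  rewrite /shannon big1 ?oppr0; last by move=> i; have := I0 i.
  rewrite big1 ?oppr0// => j _; rewrite big1 ?mul0r// => i.
  by have := I0 i.
pose g j := odflt i0 [pick i | h i == j].
have gh i : g (h i) = i.
  by rewrite /g; case: pickP => [k /eqP/hI//|/(_ i)]; rewrite eqxx.
have hp0 j : 0 <= \sum_(i | h i == j) p i by exact: sumr_ge0.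
apply: le_trans (ler_shannon_coarse g hp0).
rewrite le_eqVlt; apply/orP; left; apply/eqP; congr shannon; apply/funext => i.
rewrite (exchange_big_dep xpredT)//= (bigD1 i)//=.
rewrite [X in _ + X]big1 ?addr0 => [|k ki].
  rewrite (big_pred1 (h i))// => j /=; apply/andP/eqP => [[_ /eqP//]|->].
  by rewrite gh !eqxx.
rewrite big1// => j /andP[/eqP gji /eqP hkj].
by rewrite -hkj gh in gji; rewrite gji eqxx in ki.
Qed.

(** Gibbs' inequality against the product of the marginals, whose logarithm splits into the two
    marginal entropies. *)
Lemma shannon_subadditive (I J : finType) (p : I * J -> R) :
  (forall i, 0 <= p i) -> \sum_i p i = 1 ->
  shannon p <= shannon (fun i => \sum_j p (i, j)) +
               shannon (fun j => \sum_i p (i, j)).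
Proof.
move=> p0 p1; set pI := fun i => _; set pJ := fun j => _.
have pE F : \sum_x p x * F x = \sum_i \sum_j p (i, j) * F (i, j).
  by rewrite pair_big/=; apply: eq_bigr => -[].
have sI : \sum_i pI i = 1 by rewrite pair_big/= -p1; apply: eq_bigr => -[].
have sJ : \sum_i pJ i = 1 by rewrite exchange_big.
have pI0 i : 0 <= pI i by exact: sumr_ge0.
have pJ0 i : 0 <= pJ i by exact: sumr_ge0.
have pI0' i j : pI i = 0 -> p (i, j) = 0.
  by move/eqP; rewrite psumr_eq0// => /allP/(_ j)/(_ (mem_index_enum _))/eqP.
have pJ0' i j : pJ j = 0 -> p (i, j) = 0.
  by move/eqP; rewrite psumr_eq0// => /allP/(_ i)/(_ (mem_index_enum _))/eqP.
apply: (le_trans (@shannon_gibbs _ p (fun x => pI x.1 * pJ x.2) _ _ _ _)) => //.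
- by move=> x; rewrite mulr_ge0.
- by move=> [i j]/= /eqP; rewrite mulf_eq0 => /orP[] /eqP; [exact: pI0'|exact: pJ0'].
- rewrite p1 (eq_bigr (fun x => pI (x.1, x.2).1 * pJ (x.1, x.2).2))//.
  rewrite -(pair_big xpredT xpredT (fun i j => pI i * pJ j))/=.
  under eq_bigr do rewrite -mulr_sumr sJ mulr1.
  by rewrite sI.
rewrite /shannon -opprD lerN2 le_eqVlt; apply/orP; left; apply/eqP.
transitivity (\sum_x p x * (ln (pI x.1) + ln (pJ x.2))).
  rewrite pE; apply/esym.
  under eq_bigr do under eq_bigr do rewrite mulrDr.
  under eq_bigr do rewrite big_split/= -mulr_suml.
  rewrite big_split/=; congr +%R.
  by rewrite exchange_big/=; apply: eq_bigr => j _; rewrite -mulr_suml.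
apply: eq_bigr => -[i j] _ /=.
have [/pI0' ->|pIn0] := eqVneq (pI i) 0; first by rewrite !mul0r.
have [/pJ0' ->|pJn0] := eqVneq (pJ j) 0; first by rewrite !mul0r.
by rewrite lnM// posrE lt_def ?pIn0 ?pJn0/=.
Qed.

(** Gibbs' inequality for each [p j] against the mixture: the resulting bounds are linear in [p j],
    so their average is the entropy of the mixture. *)
Lemma shannon_concave (I J : finType) (w : J -> R) (p : J -> I -> R) :
  (forall j, 0 <= w j) -> \sum_j w j = 1 ->
  (forall j i, 0 <= p j i) -> (forall j, \sum_i p j i = 1) ->
  \sum_j w j * shannon (p j) <= shannon (fun i => \sum_j w j * p j i).
Proof.
move=> w0 w1 p0 p1; set q := (X in _ <= shannon X).
have q0 i : 0 <= q i by apply: sumr_ge0 => j _; rewrite mulr_ge0.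
have q1 : \sum_i q i = 1.
  rewrite exchange_big/= -w1; apply: eq_bigr => j _.
  by rewrite -mulr_sumr p1 mulr1.
rewrite /(shannon q) /=.
have -> : - \sum_i q i * ln (q i) = \sum_j w j * (- \sum_i p j i * ln (q i)).
  under [RHS]eq_bigr do rewrite mulrN mulr_sumr.
  rewrite sumrN; congr -%R; rewrite [RHS]exchange_big/=; apply: eq_bigr => i _.
  by rewrite mulr_suml; apply: eq_bigr => j _; rewrite mulrA.
apply: ler_sum => j _; have [->|wj] := eqVneq (w j) 0; first by rewrite !mul0r.
apply: ler_wpM2l => //; apply: shannon_gibbs => //; last by rewrite q1 p1.
move=> i /eqP; rewrite psumr_eq0; last by move=> k _; rewrite mulr_ge0.
move=> /allP/(_ j)/(_ (mem_index_enum _)).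
by rewrite mulf_eq0 (negbTE wj)/= => /eqP.
Qed.

(* Compares [p] with the distribution giving [1 - t] to [i0] and [t / k] to the
   other points. *)
Lemma shannon_fano (I : finType) (p : I -> R) (i0 : I) (k : nat) (s t : R) :
  (forall i, 0 <= p i) -> \sum_i p i = 1 -> 1 - p i0 <= s ->
  0 < t < 1 -> (0 < k)%N -> (#|I| <= k.+1)%N ->
  shannon p <= - ln (1 - t) + s * ln (k%:R / t).
Proof.
move=> p0 p1 ps /andP[t0 t1] k0 Ik.
have kt0 : 0 < t / k%:R by rewrite divr_gt0// ltr0n.
have t'0 : 0 < 1 - t by rewrite subr_gt0.
have pD : \sum_(i | i != i0) p i = 1 - p i0.
  by apply/eqP; rewrite -p1 eq_sym subr_eq addrC (bigD1 i0)//=.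
pose q i := if i == i0 then 1 - t else t / k%:R.
have q_gt0 i : 0 < q i by rewrite /q; case: ifP.
have qD : \sum_(i | i != i0) q i <= t.
  rewrite (eq_bigr (fun=> t / k%:R)); last by move=> i /negbTE; rewrite /q => ->.
  rewrite sumr_const -[(_ / _) *+ _]mulr_natl mulrA ler_pdivrMr ?ltr0n// mulrC ler_pM2l//.
  rewrite ler_nat -ltnS; apply: leq_trans Ik; rewrite [leqRHS](cardD1 i0) ltnS.
  by apply: subset_leq_card; apply/fintype.subsetP => x; rewrite !inE andbT.
apply: (le_trans (@shannon_gibbs _ p q p0 _ _ _)).
- by move=> i; exact: ltW.
- by move=> i qi; have := q_gt0 i; rewrite qi ltxx.
- by rewrite p1 (bigD1 i0)//= {1}/q eqxx; lra.
rewrite (bigD1 i0)//= {1}/q eqxx opprD.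
have -> : \sum_(i | i != i0) p i * ln (q i) = (1 - p i0) * ln (t / k%:R).
  rewrite -pD mulr_suml; apply: eq_bigr => i /negbTE ii0.
  by rewrite /q ii0.
have -> : k%:R / t = (t / k%:R)^-1 by rewrite invfM invrK mulrC.
rewrite [X in _ <= _ + _ * X]lnV ?posrE// mulrN.
(* Both logarithms are nonpositive, so bounding [p i0] by [1] and [1 - p i0] by [s] goes in the
   right direction. *)
have p01 : p i0 <= 1 by rewrite -p1 (bigD1 i0)//= lerDl sumr_ge0.
have l1 : ln (1 - t) <= 0 by apply: ln_le0; lra.
have l2 : ln (t / k%:R) <= 0.
  apply: ln_le0; rewrite ler_pdivrMr ?ltr0n// mul1r (le_trans (ltW t1))//.
  by rewrite ler1n.
apply: lerD; rewrite lerN2.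
  by rewrite -[leLHS]mul1r; exact: ler_wnM2r.
exact: ler_wnM2r.
Qed.

End shannon.

(** * Entropy of finite-valued measurable maps *)

Section finite_valued.
Context {R : realType} d {Y : measurableType d}.
Implicit Types (I J : finType).

Definition fin_measurable I (f : Y -> I) : Prop :=
  forall i, measurable (f @^-1` [set i]).

Lemma fin_measurable_preimage I (f : Y -> I) (A : set I) :
  fin_measurable f -> measurable (f @^-1` A).
Proof.
move=> mf; have -> : f @^-1` A = \bigcup_(i in A) f @^-1` [set i].
  apply/seteqP; split => [x Afx|x [i Ai /= fxi]]; first by exists (f x).
  by rewrite /preimage/= fxi.
by apply: fin_bigcup_measurable => // ; exact: finite_finset.
Qed.

Lemma fin_measurable_comp I J (h : I -> J) (f : Y -> I) :
  fin_measurable f -> fin_measurable (h \o f).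
Proof. by move=> mf j; exact: (fin_measurable_preimage (h @^-1` [set j]) mf). Qed.

Lemma fin_measurable_pair I J (f : Y -> I) (g : Y -> J) :
  fin_measurable f -> fin_measurable g ->
  fin_measurable (fun x => (f x, g x)).
Proof.
move=> mf mg [i j]; have -> : (fun x => (f x, g x)) @^-1` [set (i, j)] =
    f @^-1` [set i] `&` g @^-1` [set j].
  by apply/seteqP; split => x /= => [[-> ->]//|[-> ->]].
exact: measurableI.
Qed.

(** The letters are an arbitrary sequence of maps, so that the same lemmas serve itineraries, blocks
    of itineraries starting at a later time, and sequences of coding errors. *)
Definition word I (e : nat -> Y -> I) (n : nat) (x : Y) : {ffun 'I_n -> I} :=
  [ffun i : 'I_n => e i x].

Lemma fin_measurable_word I (e : nat -> Y -> I) n :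
  (forall i, fin_measurable (e i)) -> fin_measurable (word e n).
Proof.
move=> me w; have -> : word e n @^-1` [set w] =
    \bigcap_(i in [set: 'I_n]) e i @^-1` [set w i].
  apply/seteqP; split => [x /= <- i _ /=|x wx /=]; first by rewrite ffunE.
  by apply/ffunP => i; rewrite ffunE; exact: wx.
by apply: fin_bigcap_measurable => [|i _]; [exact: finite_finset|exact: me].
Qed.

Variable P : probability Y R.

Definition dist I (f : Y -> I) (i : I) : R := fine (P (f @^-1` [set i])).

Definition rv_entropy I (f : Y -> I) : R := shannon (dist f).

Lemma dist_ge0 I (f : Y -> I) i : 0 <= dist f i.
Proof. exact: fine_ge0. Qed.

Lemma fine_probability_preimage I (f : Y -> I) (a : pred I) :
  fin_measurable f ->
  fine (P (f @^-1` [set i | a i])) = \sum_(i | a i) dist f i.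
Proof.
move=> mf; have -> : f @^-1` [set i | a i] =
    \bigcup_(i in [set i | a i]) f @^-1` [set i].
  apply/seteqP; split => [x Afx|x [i Ai /= fxi]]; first by exists (f x).
  by rewrite /preimage/= fxi.
rewrite measure_fin_bigcup//=.
- rewrite (@fsbigE _ _ _ _ _ [seq i <- index_enum I | a i]).
  + rewrite big_filter_cond -sum_fine; last first.
      by move=> i _; rewrite fin_num_measure//; exact: mf.
    apply: eq_bigl => i; apply/andP/idP => [[]//|ai].
    by split=> //; rewrite inE.
  + by rewrite filter_uniq// index_enum_uniq.
  + by move=> i /=; rewrite mem_filter => /andP[].
  + by move=> i /= ai; rewrite mem_filter ai mem_index_enum.
- by move=> i j _ _ [x [/= <- <-]].
Qed.

Lemma sum_dist I (f : Y -> I) : fin_measurable f -> \sum_i dist f i = 1.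
Proof.
move=> mf; rewrite -fine_probability_preimage//.
by rewrite (_ : _ @^-1` _ = setT) ?probability_setT//; exact/seteqP.
Qed.

Lemma dist_le1 I (f : Y -> I) i : fin_measurable f -> dist f i <= 1.
Proof.
move=> mf; rewrite -(sum_dist mf) (bigD1 i)//= lerDl sumr_ge0// => j _.
exact: dist_ge0.
Qed.

Lemma dist_comp I J (h : I -> J) (f : Y -> I) j : fin_measurable f ->
  dist (h \o f) j = \sum_(i | h i == j) dist f i.
Proof.
move=> mf; rewrite -fine_probability_preimage// /dist; congr (fine (P _)).
by apply/seteqP; split => x /= /eqP.
Qed.

Lemma rv_entropy_ge0 I (f : Y -> I) : fin_measurable f -> 0 <= rv_entropy f.
Proof.
move=> mf; apply: shannon_ge0 => i; first exact: dist_ge0.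
exact: dist_le1.
Qed.

Lemma rv_entropy_le_ln_card I (f : Y -> I) : fin_measurable f ->
  rv_entropy f <= ln #|I|%:R.
Proof.
by move=> mf; apply: shannon_le_ln_card => [i|]; [exact: dist_ge0|exact: sum_dist].
Qed.

Lemma ler_rv_entropy_comp I J (h : I -> J) (f : Y -> I) : fin_measurable f ->
  rv_entropy (h \o f) <= rv_entropy f.
Proof.
move=> mf; rewrite /rv_entropy.
have -> : dist (h \o f) = fun j => \sum_(i | h i == j) dist f i.
  by apply/funext => j; exact: dist_comp.
by apply: ler_shannon_coarse => i; exact: dist_ge0.
Qed.

Lemma rv_entropy_pair I J (f : Y -> I) (g : Y -> J) :
  fin_measurable f -> fin_measurable g ->
  rv_entropy (fun x => (f x, g x)) <= rv_entropy f + rv_entropy g.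
Proof.
move=> mf mg; have mfg := fin_measurable_pair mf mg.
rewrite /rv_entropy.
have -> : dist f = fun i => \sum_j dist (fun x => (f x, g x)) (i, j).
  apply/funext => i; rewrite (_ : f = fst \o fun x => (f x, g x))// dist_comp//.
  rewrite (reindex_onto (pair i) snd)/=; last by move=> [? ?] /= /eqP <-.
  by apply: eq_bigl => j; rewrite !eqxx.
have -> : dist g = fun j => \sum_i dist (fun x => (f x, g x)) (i, j).
  apply/funext => j; rewrite (_ : g = snd \o fun x => (f x, g x))// dist_comp//.
  rewrite (reindex_onto (pair^~ j) fst)/=; last by move=> [? ?] /= /eqP <-.
  by apply: eq_bigl => i; rewrite !eqxx.
by apply: shannon_subadditive => [i|]; [exact: dist_ge0|exact: sum_dist].
Qed.

Lemma rv_entropy_word_split I (e : nat -> Y -> I) l l' :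
  (forall i, fin_measurable (e i)) ->
  rv_entropy (word e (l + l')) <=
  rv_entropy (word e l) + rv_entropy (word (fun i => e (l + i)%N) l').
Proof.
move=> me.
pose h (uv : {ffun 'I_l -> I} * {ffun 'I_l' -> I}) : {ffun 'I_(l + l') -> I} :=
  [ffun i : 'I_(l + l') => match fintype.split i with inl a => uv.1 a | inr b => uv.2 b end].
have -> : word e (l + l') =
    h \o fun x => (word e l x, word (fun i => e (l + i)%N) l' x).
  apply/funext => x; apply/ffunP => i; rewrite !ffunE/=.
  by case: fintype.splitP => j ->; rewrite ffunE.
apply: (le_trans (ler_rv_entropy_comp _ _)).
  by apply: fin_measurable_pair; exact: fin_measurable_word.
by apply: rv_entropy_pair; exact: fin_measurable_word.
Qed.

Lemma rv_entropy_word I (e : nat -> Y -> I) n :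
  (forall i, fin_measurable (e i)) ->
  rv_entropy (word e n) <= \sum_(i < n) rv_entropy (e i).
Proof.
move=> me; elim: n => [|n ih].
  rewrite big_ord0 (le_trans (rv_entropy_le_ln_card _))//.
    exact: fin_measurable_word.
  by rewrite card_ffun card_ord expn0 ln1.
rewrite big_ord_recr/= -addn1 (le_trans (rv_entropy_word_split _ _ _))//.
apply: lerD => //.
have -> : word (fun i => e (n + i)%N) 1 = (fun a => [ffun=> a]) \o e n.
  by apply/funext => x; apply/ffunP => i; rewrite !ffunE/= ord1 addn0.
exact: ler_rv_entropy_comp.
Qed.

Lemma rv_entropy_word_le I (e : nat -> Y -> I) n :
  (forall i, fin_measurable (e i)) ->
  rv_entropy (word e n) <= n%:R * ln #|I|%:R.
Proof.
move=> me; apply: (le_trans (rv_entropy_word _ me)).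
rewrite mulr_natl -[X in _ *+ X](card_ord n) -sumr_const.
by apply: ler_sum => i _; exact: rv_entropy_le_ln_card.
Qed.

End finite_valued.

(** * Borel probability measures on a compact metric space *)

Lemma open_superlevel (R : realType) (Y : topologicalType) (f : Y -> R) r :
  continuous f -> open [set y | r < f y].
Proof. by move=> /continuousP cf; exact: (cf _ (@open_gt _ r)). Qed.

Lemma closed_superlevel (R : realType) (Y : topologicalType) (f : Y -> R) r :
  continuous f -> closed [set y | r <= f y].
Proof. by move=> /continuous_closedP cf; exact: (cf _ (@closed_ge _ r)). Qed.

Lemma closed_sublevel (R : realType) (Y : topologicalType) (f : Y -> R) r :
  continuous f -> closed [set y | f y <= r].
Proof. by move=> /continuous_closedP cf; exact: (cf _ (@closed_le _ r)). Qed.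

Section borel_measurability.
Context {R : realType} {X : pmetricType R}.

Lemma open_borel (U : set X) : open U -> measurable (U : set (borel X)).
Proof. exact: sub_sigma_algebra. Qed.

Lemma closed_borel (F : set X) : closed F -> measurable (F : set (borel X)).
Proof.
move=> cF; rewrite -[F]setCK; apply: measurableC; apply: open_borel.
exact: closed_openC.
Qed.

Lemma continuous_borel_fun (f : X -> R) :
  continuous f -> measurable_fun setT (f : borel X -> R).
Proof.
move=> /continuousP cf; apply: (measurability _ (RGenOpens.measurableE R)).
move=> _ [_ [a [b ->] <-]]; rewrite setTI; apply: open_borel.
exact/cf/interval_open.
Qed.

Lemma continuous_borel_map (f : X -> X) :
  continuous f -> measurable_fun setT (f : borel X -> borel X).
Proof.
move=> /continuousP cf; apply: (@measurability _ _ (borel X) (borel X) setT f (@open X)) => //.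
by move=> _ [A oA <-]; rewrite setTI; apply: open_borel; exact: cf.
Qed.

Lemma measurable_preimage_continuous (f : X -> X) (A : set X) : continuous f ->
  measurable (A : set (borel X)) -> measurable (f @^-1` A : set (borel X)).
Proof.
move=> cf mA; rewrite -[_ @^-1` _]setTI.
exact: (continuous_borel_map cf).
Qed.

End borel_measurability.

Lemma iter_continuous (Y : topologicalType) (T : Y -> Y) n :
  continuous T -> continuous (iter n T).
Proof.
move=> cT; elim: n => [x|n ih x]; first exact: cvg_id.
exact: (continuous_comp (ih x) (cT _)).
Qed.

Section continuous_integral.
Context {R : realType} {X : pmetricType R}.
Hypothesis X_compact : compact [set: X].
Local Notation M1 := (@M1 R X).
Implicit Types (mu : M1) (f g : X -> R).

Lemma compact_continuous_bounded f : continuous f ->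
  exists2 M, 0 < M & forall x, `|f x| <= M.
Proof.
move=> cf.
have /compact_bounded[M [_ Mf]] : compact (f @` setT).
  by apply: continuous_compact => //; exact: continuous_subspaceT.
exists (`|M| + 1); first by rewrite ltr_wpDl.
move=> x; apply: Mf; last by exists x.
by rewrite (le_lt_trans (ler_norm _))// ltrDl.
Qed.

Lemma continuous_integrable mu f : continuous f ->
  mu.-integrable [set: borel X] (EFin \o f).
Proof.
move=> cf; apply: measurable_bounded_integrable => //.
- by move: (@probability_setT _ _ _ mu) => /= ->; rewrite ltry.
- exact: continuous_borel_fun.
have [M M0 fM] := compact_continuous_bounded cf.
by exists M; split; rewrite ?num_real // => ? ? ? ?; exact: le_trans (fM _) (ltW _).
Qed.

Lemma cintD mu f g : continuous f -> continuous g ->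
  \int[mu]_x (f x + g x) = \int[mu]_x f x + \int[mu]_x g x.
Proof. by move=> cf cg; rewrite RintegralD//; exact: continuous_integrable. Qed.

Lemma cintB mu f g : continuous f -> continuous g ->
  \int[mu]_x (f x - g x) = \int[mu]_x f x - \int[mu]_x g x.
Proof. by move=> cf cg; rewrite RintegralB//; exact: continuous_integrable. Qed.

Lemma cintZ mu f r : continuous f ->
  \int[mu]_x (r * f x) = r * \int[mu]_x f x.
Proof. by move=> cf; rewrite RintegralZl//; exact: continuous_integrable. Qed.

Lemma cint_cst mu r : \int[mu]_x r = r :> R.
Proof.
rewrite (Rintegral_cst mu measurableT).
by move: (@probability_setT _ _ _ mu) => /= ->; rewrite mulr1.
Qed.

Lemma ler_cint mu f g : continuous f -> continuous g ->
  (forall x, f x <= g x) -> \int[mu]_x f x <= \int[mu]_x g x.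
Proof.
by move=> cf cg fg; apply: le_Rintegral => //; exact: continuous_integrable.
Qed.

Lemma cint_norm_le mu f M : continuous f -> (forall x, `|f x| <= M) ->
  `|\int[mu]_x f x| <= M.
Proof.
move=> cf fM; have cM (r : R) : continuous (fun _ : X => r) by move=> x; exact: cvg_cst.
rewrite ler_norml -{1}(cint_cst mu (- M)) -{2}(cint_cst mu M).
by apply/andP; split; apply: ler_cint => // x; have := fM x; rewrite ler_norml => /andP[].
Qed.

(** Integration against a finite sum of measures is additive for nonnegative functions, so [f] is
    first shifted by a bound [M]. The shift cancels because the weights sum to 1, as the nonnegative
    case for the constant 1 shows. *)
Lemma integral_convex_comb n (w : nat -> R) (nu : nat -> M1) (mu : M1) f :
  (forall i, 0 <= w i) ->
  (forall A : set (borel X), measurable A ->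
    mu A = (\sum_(i < n) (w i)%:E * nu i A)%E) ->
  continuous f -> \int[mu]_x f x = \sum_(i < n) w i * \int[nu i]_x f x.
Proof.
move=> w0 muE.
pose k i := NngNum (w0 i).
have ge0_case g : continuous g -> (forall x, 0 <= g x) ->
    \int[mu]_x g x = \sum_(i < n) w i * \int[nu i]_x g x.
  move=> cg g0; have mg := continuous_borel_fun cg.
  apply: EFin_inj; rewrite /Rintegral fineK; last first.
    exact/integrable_fin_num/continuous_integrable.
  rewrite (eq_measure_integral (msum (fun i => mscale (k i) (nu i)) n)).
    have mg' : measurable_fun [set: borel X] (EFin \o g) by exact/measurable_EFinP.
    have g0' (x : borel X) : [set: borel X] x -> (0 <= (EFin \o g) x)%E.
      by rewrite lee_fin.
    rewrite ge0_integral_measure_sum// -sumEFin; apply: eq_bigr => i _.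
    rewrite ge0_integral_mscale//= EFinM fineK//.
    exact/integrable_fin_num/continuous_integrable.
  by move=> A mA _; exact: (muE A mA).
move=> cf; have [M M0 fM] := compact_continuous_bounded cf.
have cM : continuous (fun _ : X => M) by move=> x; exact: cvg_cst.
have := ge0_case (fun x => f x + M).
have cfM : continuous (fun x => f x + M) by move=> x; apply: cvgD; [exact: cf|exact: cM].
move=> /(_ cfM)/[!cintD]//.
have w1 : \sum_(i < n) w i = 1.
  have := ge0_case (fun=> 1) (fun x => cvg_cst _) (fun=> ler01).
  by rewrite cint_cst => ->; apply: eq_bigr => i _; rewrite cint_cst mulr1.
rewrite cint_cst => H; apply: (addIr M); rewrite H; last first.
  by move=> x; rewrite -lerBlDr sub0r; have := fM x; rewrite ler_norml => /andP[].
under eq_bigr do rewrite cintD// cint_cst mulrDr.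
by rewrite big_split/= -mulr_suml w1 mul1r.
Qed.

(** [mnormalize] packages the finite sum as a probability; its total mass is already 1, so nothing
    is rescaled and [nu 0] is a mere default. *)
Lemma exists_convex_comb n (w : nat -> R) (nu : nat -> M1) :
  (forall i, 0 <= w i) -> \sum_(i < n) w i = 1 ->
  exists mu : M1, forall A : set (borel X),
    mu A = (\sum_(i < n) (w i)%:E * nu i A)%E.
Proof.
move=> w0 w1; pose k i := NngNum (w0 i).
exists (mnormalize (msum (fun i => mscale (k i) (nu i)) n) (nu 0)) => A.
have E B : msum (fun i => mscale (k i) (nu i)) n B =
    (\sum_(i < n) (w i)%:E * nu i B)%E by [].
rewrite /= /mnormalize/= !E.
have -> : (\sum_(i < n) (w i)%:E * nu i [set: borel X] = 1)%E.
  under eq_bigr do rewrite probability_setT mule1.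
  by rewrite sumEFin w1.
by rewrite eqe oner_eq0/= invr1 mule1.
Qed.

Lemma integral_empirical (T : X -> X) n x f : continuous f -> (0 < n)%N ->
  \int[empirical T n x]_y f y = n%:R^-1 * \sum_(k < n) f (iter k T x).
Proof.
move=> cf n0.
rewrite (@integral_convex_comb n (fun=> n%:R^-1)
  (fun k => \d_(iter k T x : borel X) : probability _ _) (empirical T n x) f)//.
- rewrite mulr_sumr; apply: eq_bigr => k _; congr *%R.
  rewrite /Rintegral integral_dirac//=; first by rewrite indicT mul1r.
  by apply/measurable_EFinP; exact: continuous_borel_fun.
- move=> A mA; rewrite empiricalE// ge0_sume_distrr//.
Qed.

End continuous_integral.

(** * The weak topology tested on continuous functions *)

Section M1_topology.
Context {R : realType} {X : pmetricType R}.
Local Notation M1 := (@M1 R X).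

Lemma M1_cvg (F : set_system M1) (mu : M1) : Filter F ->
  (forall f : X -> R, continuous f ->
    (fun m : M1 => \int[m]_x f x) @ F --> \int[mu]_x f x) ->
  F --> mu.
Proof.
move=> FF Fmu A; rewrite nbhsE => -[_ [[B oB <-] Bmu] BA].
apply: (filterS BA).
suff : @integral_pairing R X @ F --> (integral_pairing mu : {ptws continuousType X R -> R}).
  by move=> /(_ B); apply; exact: open_nbhs_nbhs.
(* Pointwise convergence is tested coordinatewise. [cvg_image] asks each evaluation to be onto,
   which the constant functions provide. *)
apply/cvg_sup => f; rewrite cvg_image; last first.
  by rewrite eqEsubset; split=> v // _; exists (cst v).
move=> W /(Fmu f (@cts_fun _ _ f)) FW; rewrite /= nbhs_simpl.
exists ((fun g => g f) @^-1` W) => //.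
by rewrite eqEsubset; split => [j [? + <-//]|j Wj]; exists (fun _ => j).
Qed.

Lemma M1_integral_continuous (f : X -> R) : continuous f ->
  continuous (fun m : M1 => \int[m]_x f x).
Proof.
move=> cf; pose f' : continuousType X R := HB.pack f (isContinuous.Build _ _ f cf).
have : continuous (@integral_pairing R X : M1 -> {ptws continuousType X R -> R}).
  exact: initial_continuous.
move=> ci mu.
have pc := @proj_continuous (continuousType X R) (fun=> R) f' (integral_pairing mu).
exact: (@continuous_comp M1 {ptws continuousType X R -> R} R
  (@integral_pairing R X) (@proj _ (fun=> R) f') mu (ci mu) pc).
Qed.

Definition M1_basic (mu : M1) (s : seq (X -> R)) (r : R) : set M1 :=
  [set m : M1 | forall f : X -> R, f \in s -> `|\int[m]_x f x - \int[mu]_x f x| < r].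

(** The basic sets generate a filter along which all integrals of continuous functions converge. By
    [M1_cvg] this filter converges to [mu], which puts a basic set inside every neighbourhood. *)
Lemma nbhs_M1_basic (mu : M1) (N : set M1) : nbhs mu N ->
  exists s r, [/\ 0 < r, forall f, f \in s -> continuous f &
    M1_basic mu s r `<=` N].
Proof.
pose D := [set sr : seq (X -> R) * R | 0 < sr.2 /\
  forall f, f \in sr.1 -> continuous f].
pose F := filter_from D (fun sr => M1_basic mu sr.1 sr.2).
have FF : Filter F.
  apply: filter_from_filter; first by exists ([::], 1); split.
  move=> [s1 r1] [s2 r2] [/= r10 c1] [/= r20 c2].
  exists (s1 ++ s2, Num.min r1 r2); first split => /=.
  - by rewrite lt_min r10.
  - by move=> f; rewrite mem_cat => /orP[/c1|/c2].
  - move=> m /= H; split=> f fs /=.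
      have := H f; rewrite mem_cat fs => /(_ isT) /lt_le_trans; apply.
      by rewrite ge_min lexx.
    have := H f; rewrite mem_cat fs orbT => /(_ isT) /lt_le_trans; apply.
    by rewrite ge_min lexx orbT.
have : F --> mu.
  apply: M1_cvg => f cf; apply/cvgrPdist_lt => e e0.
  exists ([:: f], e); first by split => // g; rewrite inE => /eqP ->.
  by move=> m /(_ f (mem_head _ _)); rewrite distrC.
move=> /[apply] -[[s r] [/= r0 cs] sN]; by exists s, r.
Qed.

End M1_topology.

(** * Distance to a set *)

Section distance_to_set.
Context {R : realType} {X : pmetricType R}.
Implicit Types (A U : set X) (x y : X).

Definition dist_to A x : R := inf [set mdist x a | a in A].

Lemma dist_to_le A x a : A a -> dist_to A x <= mdist x a.
Proof.
move=> Aa; apply: ge_inf; last by exists a.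
by exists 0 => _ [b _ <-]; exact: mdist_ge0.
Qed.

Lemma le_dist_to A x r : A !=set0 -> (forall a, A a -> r <= mdist x a) ->
  r <= dist_to A x.
Proof.
move=> [a Aa] rA; apply: lb_le_inf; first by exists (mdist x a), a.
by move=> _ [b Ab <-]; exact: rA.
Qed.

Lemma dist_to_lipschitz A x y : A !=set0 ->
  `|dist_to A x - dist_to A y| <= mdist x y.
Proof.
move=> A0; have H z w : dist_to A z <= mdist z w + dist_to A w.
  rewrite -lerBlDl; apply: le_dist_to => // a Aa; rewrite lerBlDl.
  by rewrite (le_trans (dist_to_le _ Aa))// metric_triangle.
by rewrite ler_norml; have := H x y; have := H y x; rewrite metric_sym; lra.
Qed.

Lemma dist_to_continuous A : A !=set0 -> continuous (dist_to A).
Proof.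
move=> A0 x; apply/cvgrPdist_lt => e e0; near=> y.
rewrite (le_lt_trans (dist_to_lipschitz _ _ A0))//.
near: y; apply/nbhs_ballP; exists e => //= y.
by rewrite ballEmdist.
Unshelve. all: by end_near. Qed.

(** The distance to the complement is positive exactly on [U]; when the complement is empty the
    constant 1 serves. Through [u], open sets are approximated from inside by continuous
    functions. *)
Lemma open_positive_part U : open U ->
  exists u : X -> R, [/\ continuous u, forall x, 0 <= u x &
    U = [set x | 0 < u x]].
Proof.
move=> oU; have [U0|/set0P U0] := eqVneq (~` U) set0.
  exists (fun=> 1); split => //; first by move=> x; exact: cvg_cst.
  apply/seteqP; split => x //= _; apply: contrapT => nUx.
  by have : set0 x by rewrite -U0.
exists (dist_to (~` U)); split.
- exact: dist_to_continuous.
- by move=> x; apply: le_dist_to => // a _; exact: mdist_ge0.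
apply/seteqP; split => x /=.
  move=> Ux; have /nbhs_ballP[e e0 eU] : nbhs x U by exact: open_nbhs_nbhs.
  apply: (lt_le_trans e0); apply: le_dist_to => // a nUa.
  rewrite leNgt; apply/negP => xae; apply: nUa; apply: eU.
  by rewrite ballEmdist.
move=> d0; apply: contrapT => nUx; move: d0; apply/negP; rewrite -leNgt.
by rewrite (le_trans (dist_to_le _ nUx))// mdistxx.
Qed.

Lemma mdist_continuous x : continuous (fun y => mdist y x).
Proof.
have -> : (fun y => mdist y x) = dist_to [set x].
  apply/funext => y; apply/eqP; rewrite eq_le dist_to_le// andbT.
  by apply: le_dist_to; [exists x|move=> a ->].
by apply: dist_to_continuous; exists x.
Qed.

End distance_to_set.

Section integral_vs_measure.
Context {R : realType} {X : pmetricType R}.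
Hypothesis X_compact : compact [set: X].
Implicit Types (mu : M1 X) (f : X -> R).

Lemma M1_setT mu : mu setT = 1%E.
Proof. exact: (@probability_setT _ _ _ mu). Qed.

Lemma M1_fin mu (A : set (borel X)) : measurable A -> mu A \is a fin_num.
Proof. by move=> mA; exact: (@fin_num_measure _ _ _ mu). Qed.

Lemma le_M1 mu (A B : set (borel X)) : measurable A -> measurable B ->
  A `<=` B -> fine (mu A) <= fine (mu B).
Proof.
move=> mA mB AB; apply: fine_le; [exact: M1_fin|exact: M1_fin|].
by apply: (@le_measure _ _ _ mu) => //; rewrite inE.
Qed.

Lemma M1_le1 mu (A : set (borel X)) : measurable A -> fine (mu A) <= 1.
Proof. by move=> mA; have := le_M1 mu mA measurableT (@subsetT _ _); rewrite M1_setT. Qed.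

Lemma cint_le_measure mu f (A : set (borel X)) (c : R) :
  continuous f -> measurable A -> (forall x, f x <= c * \1_A x) ->
  \int[mu]_x f x <= c * fine (mu A).
Proof.
move=> cf mA fA.
have iA : mu.-integrable [set: borel X] (EFin \o (\1_A : borel X -> R)).
  exact: integrable_indic.
have icA : mu.-integrable [set: borel X] (EFin \o (fun x : borel X => c * \1_A x)).
  rewrite (_ : _ \o _ = (fun x : borel X => c%:E * (\1_A x)%:E)%E)//.
  exact: integrableZl.
have -> : c * fine (mu A) = \int[mu]_x (c * \1_A x).
  rewrite RintegralZl// /Rintegral; congr (c * fine _).
  by rewrite integral_indic// setIT.
by apply: le_Rintegral => //; exact: continuous_integrable.
Qed.

Lemma measure_le_cint mu f (A : set (borel X)) (c : R) :
  continuous f -> measurable A -> (forall x, c * \1_A x <= f x) ->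
  c * fine (mu A) <= \int[mu]_x f x.
Proof.
move=> cf mA fA; have cNf : continuous (- f) by move=> x; apply: cvgN; exact: cf.
have := @cint_le_measure mu (- f) A (- c) cNf mA.
rewrite mulNr lerNr => H; rewrite (le_trans (H _))//.
  by move=> x; rewrite mulNr lerN2.
rewrite lerNl -mulN1r -cintZ//; first by under eq_Rintegral do rewrite mulN1r.
Qed.

End integral_vs_measure.

(** * Riesz representation and compactness of the space of measures *)

Lemma compact_increasing_cover (Y : ptopologicalType) (U : nat -> set Y) :
  compact [set: Y] -> (forall n, open (U n)) ->
  (forall m n, (m <= n)%N -> U m `<=` U n) ->
  (forall y, exists n, U n y) -> exists n, forall y, U n y.
Proof.
rewrite compact_cover => cY oU Um Uc.
have [|D _ Dcov] := cY nat setT U (fun i _ => oU i).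
  by move=> y _; have [n Uny] := Uc y; exists n.
exists (\max_(i <- finmap.enum_fset D) i)%N => y; have [i /= iD Uiy] := Dcov y I.
by apply: Um Uiy; exact: leq_bigmax_seq.
Qed.

Section riesz.
Context {R : realType} {X : pmetricType R}.
Hypothesis X_compact : compact [set: X].
Variable L : (X -> R) -> R.
Hypothesis L1 : L (fun=> 1) = 1.
Hypothesis LD : forall f g : X -> R, continuous f -> continuous g ->
  L (fun x => f x + g x) = L f + L g.
Hypothesis LZ : forall r (f : X -> R), continuous f -> L (fun x => r * f x) = r * L f.
Hypothesis L_ge0 : forall f : X -> R, continuous f -> (forall x, 0 <= f x) -> 0 <= L f.

Let ctsc (r : R) : continuous (fun _ : X => r).
Proof. by move=> x; exact: cvg_cst. Qed.

Let ctsD (f g : X -> R) : continuous f -> continuous g ->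
  continuous (fun x => f x + g x).
Proof. by move=> cf cg x; apply: cvgD; [exact: cf|exact: cg]. Qed.

Let ctsM (f g : X -> R) : continuous f -> continuous g ->
  continuous (fun x => f x * g x).
Proof. by move=> cf cg x; apply: cvgM; [exact: cf|exact: cg]. Qed.

Let ctsB (f g : X -> R) : continuous f -> continuous g ->
  continuous (fun x => f x - g x).
Proof. by move=> cf cg x; apply: cvgB; [exact: cf|exact: cg]. Qed.

Let ctsmin (f g : X -> R) : continuous f -> continuous g ->
  continuous (fun x => Num.min (f x) (g x)).
Proof. by move=> cf cg x; apply: continuous_min; [exact: cf|exact: cg]. Qed.

Let LB (f g : X -> R) : continuous f -> continuous g ->
  L (fun x => f x - g x) = L f - L g.
Proof.
move=> cf cg; rewrite -[L g]mul1r -mulNr -LZ// -LD//; last by apply: ctsM.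
by congr L; apply/funext => x; rewrite mulN1r.
Qed.

Let L_le (f g : X -> R) : continuous f -> continuous g -> (forall x, f x <= g x) ->
  L f <= L g.
Proof.
move=> cf cg fg; rewrite -subr_ge0 -LB//; apply: L_ge0; first exact: ctsB.
by move=> x; rewrite subr_ge0.
Qed.

Let L0 : L (fun=> 0) = 0.
Proof.
rewrite -[RHS](mul0r (L (fun=> 1))) -LZ; last exact: ctsc.
by congr L; apply/funext => x; rewrite mul0r.
Qed.

(* Increasing sequences, rather than Daniell's countable sums, so that countable
   subadditivity needs no double series. *)
Definition covers (A : set X) (g : nat -> X -> R) (c : R) : Prop :=
  [/\ forall n, continuous (g n), forall n x, 0 <= g n x,
      forall m n x, (m <= n)%N -> g m x <= g n x,
      forall n, L (g n) <= c &
      forall x, A x -> forall r, r < 1 -> exists n, r < g n x].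

Definition riesz_outer (A : set X) : \bar R :=
  ereal_inf [set c%:E | c in [set c | exists g, covers A g c]].

Let riesz_outer_le A g c : covers A g c -> (riesz_outer A <= c%:E)%E.
Proof. by move=> gc; apply: ereal_inf_lbound; exists c => //; exists g. Qed.

Let riesz_outer_ge A y :
  (forall c g, covers A g c -> (y <= c%:E)%E) -> (y <= riesz_outer A)%E.
Proof. by move=> H; apply: le_ereal_inf_tmp => _ [c [g gc] <-]; exact: H gc. Qed.

Let riesz_outer_lt A y : (riesz_outer A < y)%E ->
  exists c g, covers A g c /\ (c%:E < y)%E.
Proof. by move=> /ereal_inf_lt[_ [c [g gc] <-] cy]; exists c, g. Qed.

Let covers_ge0 A g c : covers A g c -> 0 <= c.
Proof.
by move=> [cg g0 _ gc _]; apply: le_trans (gc 0%N); exact: L_ge0.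
Qed.

Let riesz_outer_ge0 A : (0 <= riesz_outer A)%E.
Proof. by apply: riesz_outer_ge => c g /covers_ge0; rewrite lee_fin. Qed.

Let riesz_outer0 : riesz_outer set0 = 0%E.
Proof.
apply/eqP; rewrite eq_le riesz_outer_ge0 andbT.
apply: (@riesz_outer_le _ (fun _ _ => 0)); split => //.
by move=> n; rewrite L0.
Qed.

Let riesz_outer_homo : {homo riesz_outer : A B / A `<=` B >-> (A <= B)%E}.
Proof.
move=> A B AB; apply: riesz_outer_ge => c g [? ? ? ? gB].
by apply: (@riesz_outer_le _ g); split => // x /AB; exact: gB.
Qed.

Let riesz_outer_le1 A : (riesz_outer A <= 1%:E)%E.
Proof.
apply: (@riesz_outer_le _ (fun _ _ => 1)); split => //.
- by move=> n; rewrite L1.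
- by move=> x _ r r1; exists 0%N.
Qed.

Let riesz_outer_fin A : riesz_outer A \is a fin_num.
Proof.
by rewrite ge0_fin_numE// (le_lt_trans (riesz_outer_le1 A))// ltry.
Qed.

Let L_sum n (F : nat -> X -> R) : (forall i, continuous (F i)) ->
  continuous (fun x => \sum_(i < n) F i x) /\
  L (fun x => \sum_(i < n) F i x) = \sum_(i < n) L (F i).
Proof.
move=> cF; elim: n => [|n [ih1 ih2]].
  under eq_fun do rewrite big_ord0.
  rewrite big_ord0; split; first exact: ctsc.
  exact: L0.
under eq_fun do rewrite big_ord_recr/=.
by split; [exact: ctsD|rewrite LD// ih2 big_ord_recr].
Qed.

Let riesz_outer_sigma_subadditive : sigma_subadditive riesz_outer.
Proof.
move=> A; apply/lee_addgt0Pr => e e0.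
apply: (@le_trans _ _ (\sum_(i <oo) (riesz_outer (A i) + (e / (2 ^ i.+1)%:R)%:E))%E);
  last by apply: epsilon_trick => //; exact: ltW.
have /choice[cg H] : forall i, exists cg : R * (nat -> X -> R),
    covers (A i) cg.2 cg.1 /\
    (cg.1%:E < riesz_outer (A i) + (e / (2 ^ i.+1)%:R)%:E)%E.
  move=> i; have [|c [g ?]] := @riesz_outer_lt (A i)
      (riesz_outer (A i) + (e / (2 ^ i.+1)%:R)%:E)%E; last by exists (c, g).
  by rewrite lteDl ?riesz_outer_fin// lte_fin divr_gt0// ltr0n expn_gt0.
pose c i := (cg i).1; pose g i := (cg i).2.
have cH i : covers (A i) (g i) (c i) by exact: (H i).1.
apply: (@le_trans _ _ (\sum_(i <oo) (c i)%:E)%E); last first.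
  apply: lee_nneseries; first by move=> i _ _; rewrite lee_fin (covers_ge0 (cH i)).
  by move=> i _; apply: ltW; exact: (H i).2.
have c0 i : (0 <= (c i)%:E)%E by rewrite lee_fin (covers_ge0 (cH i)).
have [->|] := eqVneq (\sum_(i <oo) (c i)%:E)%E +oo%E; first by rewrite leey.
move=> sfin.
have sE : (\sum_(i <oo) (c i)%:E)%E = (fine (\sum_(i <oo) (c i)%:E))%:E.
  by rewrite fineK// ge0_fin_numE ?ltey// nneseries_ge0.
(* Diagonal partial sums: they increase with [n] because both the number of terms and each term do,
   their cost is a partial sum of the [c i], and at a point of [A i] the term of index [i] alone is
   large enough. *)
rewrite sE; apply: (@riesz_outer_le _ (fun n x => \sum_(i < n) g i n x)).
split.
- by move=> n; apply: (@L_sum n (fun i => g i n) _).1 => i; case: (cH i).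
- by move=> n x; apply: sumr_ge0 => i _; case: (cH i).
- move=> m n x mn; rewrite -!(big_mkord xpredT (fun i => g i _ x)).
  rewrite [leRHS](@big_cat_nat _ _ _ m)//=; rewrite -[leLHS]addr0; apply: lerD.
    by apply: ler_sum => i _; case: (cH i) => _ _ + _ _; apply.
  by apply: sumr_ge0 => i _; case: (cH i).
- move=> n; rewrite -lee_fin -sE (@L_sum n (fun i => g i n) _).2; last first.
    by move=> i; case: (cH i).
  apply: (@le_trans _ _ (\sum_(0 <= i < n) (c i)%:E)%E).
    rewrite sumEFin lee_fin big_mkord; apply: ler_sum => i _.
    by case: (cH i) => _ _ _ + _; apply.
  exact: nneseries_lim_ge.
- move=> x [i _ Aix] r r1; have [cg0 g0 gm _ /(_ x Aix r r1)[n rn]] := cH i.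
  exists (maxn i.+1 n); have im : (i < maxn i.+1 n)%N by rewrite leq_max leqnn.
  rewrite (bigD1 (Ordinal im))//=; apply: (lt_le_trans rn).
  rewrite (le_trans (gm _ (maxn i.+1 n) _ _))// ?leq_maxr// lerDl.
  by apply: sumr_ge0 => j _; case: (cH j).
Qed.

(* If [g] covers [A] then [g n * v n] covers [A `&` U], where [v n] increases to
   the indicator of [U], and [g n * (1 - v N)] covers the rest of [A]; for [N]
   large the two costs add up to almost the cost of [g]. *)
Let riesz_outer_open (U : set X) : open U ->
  forall A, (riesz_outer (A `&` U) + riesz_outer (A `&` ~` U) <= riesz_outer A)%E.
Proof.
move=> /open_positive_part[u [cu u0 UE]] A.
apply: riesz_outer_ge => c g [cg g0 gm gc gA].
pose v n x := Num.min 1 (n%:R * u x).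
have cv n : continuous (v n) by apply: ctsmin; [exact: ctsc|exact: ctsM].
have v0 n x : 0 <= v n x by rewrite le_min ler01/= mulr_ge0.
have v1 n x : v n x <= 1 by rewrite ge_min lexx.
have vm m n x : (m <= n)%N -> v m x <= v n x.
  move=> mn; rewrite le_min v1/= ge_min; apply/orP; right.
  by rewrite ler_wpM2r// ler_nat.
pose h n x := g n x * v n x.
have ch n : continuous (h n) by exact: ctsM.
have hm m n x : (m <= n)%N -> h m x <= h n x.
  by move=> mn; apply: ler_pM => //; [exact: gm|exact: vm].
have hg n x : h n x <= g n x by rewrite -[leRHS]mulr1; apply: ler_wpM2l.
pose S := [set L (h n) | n in setT].
have Sc : has_sup S.
  split; first by exists (L (h 0)), 0%N.
  exists c => _ [n _ <-]; rewrite (le_trans _ (gc n))//; exact: L_le.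
have le1 : (riesz_outer (A `&` U) <= (sup S)%:E)%E.
  apply: (@riesz_outer_le _ h); split => //.
  - by move=> n x; rewrite mulr_ge0.
  - by move=> n; apply: sup_upper_bound => //; exists n.
  - move=> x [Ax]; rewrite UE/= => ux r r1.
    have [n1 rn1] := gA x Ax r r1.
    have [n2 n2u] : exists n, 1 <= n%:R * u x.
      exists (Num.bound (u x)^-1); rewrite -ler_pdivrMr// mul1r ltW//.
      by rewrite archi_boundP// invr_ge0 ltW.
    exists (maxn n1 n2); have -> : h (maxn n1 n2) x = g (maxn n1 n2) x.
      rewrite /h (_ : v _ _ = 1) ?mulr1//; apply/eqP; rewrite eq_le v1/=.
      by rewrite (le_trans _ (vm n2 _ _ (leq_maxr _ _)))// /v le_min lexx.
    by rewrite (lt_le_trans rn1)// gm// leq_maxl.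
apply/lee_addgt0Pr => e e0.
have [_ [N _ <-] HN] := sup_adherent e0 Sc.
have le2 : (riesz_outer (A `&` ~` U) <= (c - sup S + e)%:E)%E.
  have cgv n : continuous (fun x => g n x * (1 - v N x)) by apply: ctsM => //; exact: ctsB.
  have gvm m n x : (m <= n)%N -> g m x * (1 - v N x) <= g n x * (1 - v N x).
    by move=> mn; apply: ler_wpM2r; [rewrite subr_ge0|exact: gm].
  apply: (@riesz_outer_le _ (fun n x => g n x * (1 - v N x))); split => //.
  - by move=> n x; rewrite mulr_ge0// subr_ge0.
  - have H n : (N <= n)%N -> L (fun x => g n x * (1 - v N x)) <= c - sup S + e.
      move=> Nn; have -> : (fun x => g n x * (1 - v N x)) =
          (fun x => g n x - g n x * v N x).
        by apply/funext => x; rewrite mulrBr mulr1.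
      rewrite LB//; last exact: ctsM.
      have : L (h N) <= L (fun x => g n x * v N x).
        apply: L_le => //; first exact: ctsM.
        by move=> x; apply: ler_wpM2r => //; exact: gm.
      by have := gc n; lra.
    move=> n; have [nN|Nn] := leqP N n; first exact: H.
    apply: (le_trans _ (H N (leqnn _))); apply: L_le => // x.
    by apply: gvm; exact: ltnW.
  - move=> x [Ax]; rewrite UE/= => /negP; rewrite -leNgt => ux r r1.
    have ux0 : u x = 0 by apply/eqP; rewrite eq_le ux u0.
    have [n rn] := gA x Ax r r1; exists n.
    by rewrite /v ux0 mulr0 min_r// subr0 mulr1.
rewrite (le_trans (leeD le1 le2))// -EFinD -EFinD lee_fin; lra.
Qed.

(** Dini's argument: increasing functions that eventually exceed [1 - e] at every point exceed it
    everywhere at some single [n], by compactness, so no covering of the whole space costs less than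
    [1 - e]. *)
Let riesz_outerT : riesz_outer setT = 1%E.
Proof.
apply/eqP; rewrite eq_le riesz_outer_le1/=.
apply: riesz_outer_ge => c g [cg g0 gm gc gA].
rewrite lee_fin; apply/ler_addgt0Pr => e e0.
have [||x|n gn] := @compact_increasing_cover X (fun n => [set x | 1 - e < g n x]) X_compact.
- by move=> n; exact: open_superlevel.
- by move=> m n mn x /= /lt_le_trans; apply; exact: gm.
- by have [|n] := gA x I (1 - e); [lra|exists n].
rewrite -lerBlDr (le_trans _ (gc n))//.
rewrite (_ : 1 - e = L (fun=> 1 - e)); last first.
  transitivity (L (fun=> (1 - e) * 1)); first by rewrite LZ// L1 mulr1.
  by congr L; apply/funext => x; rewrite mulr1.
by apply: L_le => // x; exact: ltW (gn x).
Qed.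

(** Open sets are Caratheodory measurable, so the outer measure restricts to a Borel probability
    measure. For values in [[0, 1]], slicing the graph horizontally gives [\int f <= L f], and
    [1 - f] gives the reverse; an affine change of [f] reduces the general case to this one. *)
Lemma riesz_representation :
  exists mu : M1 X, forall f, continuous f -> \int[mu]_x f x = L f.
Proof.
pose O : {outer_measure set X -> \bar R} := HB.pack riesz_outer
  (isOuterMeasure.Build _ _ riesz_outer riesz_outer0 riesz_outer_ge0
     riesz_outer_homo riesz_outer_sigma_subadditive).
have caraO (A : set (borel X)) : measurable A -> O.-caratheodory A.
  have H : sigma_algebra setT O.-caratheodory.
    split; first exact: caratheodory_measurable_set0.
      by move=> B; rewrite setTD; exact: caratheodory_measurable_setC.
    exact: caratheodory_measurable_bigcup.
  move: A; apply: smallest_sub => // U oU; apply: le_caratheodory_measurable.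
  exact: riesz_outer_open.
pose m : set (borel X) -> \bar R := riesz_outer.
have m_sigma : semi_sigma_additive m.
  move=> F mF tF mUF.
  apply: (@caratheodory_measure_sigma_additive _ _ O) => //; last exact: caraO.
  by move=> i; exact: caraO.
pose mM : {measure set (borel X) -> \bar R} := HB.pack m
  (isMeasure.Build _ _ _ m riesz_outer0 riesz_outer_ge0 m_sigma).
pose mu : M1 X := HB.pack m mM
  (Measure_isProbability.Build _ _ _ (mM : set _ -> _) riesz_outerT).
have muE A : mu A = riesz_outer A by [].
have le_case (f : X -> R) : continuous f -> (forall x, 0 <= f x <= 1) ->
    \int[mu]_x f x <= L f.
  move=> cf f01; apply/ler_addgt0Pr => e e0.
  pose n := (Num.bound e^-1).+1.
  have n0 : 0 < n%:R :> R by rewrite ltr0n.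
  have ne : n%:R^-1 <= e.
    rewrite invf_ple ?posrE// /n -natr1 (le_trans (ltW (archi_boundP _)))//.
      by rewrite invr_ge0 ltW.
    by rewrite lerDl.
  (* Truncation of [f] at height [j / n]. The increment [t j.+1 - t j] lies between [1 / n] times
     the indicators of [C j.+1] and of [C j]; the lower bound says that [n] times the increment
     covers [C j.+1], the upper one bounds its integral. *)
  pose t j : X -> R := fun x => Num.min (f x) (j%:R / n%:R).
  have ct j : continuous (t j) by apply: ctsmin => //; exact: ctsc.
  have tm i j x : (i <= j)%N -> t i x <= t j x.
    move=> ij; rewrite le_min ge_min lexx/= ge_min; apply/orP; right.
    by rewrite ler_pM2r ?invr_gt0// ler_nat.
  pose C j := [set x | j%:R / n%:R <= f x].
  have mC j : measurable (C j : set (borel X)).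
    by apply: closed_borel; exact: closed_superlevel.
  have C_le j : n%:R^-1 * fine (mu (C j.+1)) <= L (t j.+1) - L (t j).
    rewrite mulrC ler_pdivrMr// mulrC.
    have : (mu (C j.+1) <= (n%:R * (L (t j.+1) - L (t j)))%:E)%E.
      rewrite muE; apply: (@riesz_outer_le _ (fun _ x => n%:R * (t j.+1 x - t j x))).
      have ctt : continuous (fun x => t j.+1 x - t j x) by exact: ctsB.
      split => //.
      - by move=> _; apply: ctsM => //; exact: ctsc.
      - by move=> _ x; rewrite mulr_ge0 ?ler0n// subr_ge0 tm.
      - by move=> _; rewrite LZ// LB.
      - move=> x Cx r r1; exists 0%N.
        have -> : t j.+1 x = j.+1%:R / n%:R by rewrite /t min_r.
        have -> : t j x = j%:R / n%:R.
          rewrite /t min_r// (le_trans _ Cx)// ler_pM2r ?invr_gt0//.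
          by rewrite ler_nat.
        by rewrite -mulrBl mulrCA divff ?gt_eqF// mulr1 -natrB ?subSnn.
    by rewrite -lee_fin fineK// M1_fin.
  have t_le j : \int[mu]_x t j.+1 x - \int[mu]_x t j x <=
      n%:R^-1 * fine (mu (C j)).
    rewrite -cintB//; apply: cint_le_measure => //; first exact: ctsB.
    move=> x; rewrite indicE; have [Cx|nCx] := pselect (C j x).
      rewrite mem_set// mulr1 [t j x]min_r// lerBlDr.
      by rewrite ge_min -natr1 mulrDl mul1r addrC lexx orbT.
    rewrite memNset// mulr0 subr_le0 [t j x]min_l; first by rewrite ge_min lexx.
    by rewrite leNgt; apply/negP => /ltW.
  have t0 : t 0 = fun=> 0.
    by apply/funext => x; rewrite /t mul0r min_r//; case/andP: (f01 x).
  have tn : t n = f.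
    by apply/funext => x; rewrite /t divff ?gt_eqF// min_l//; case/andP: (f01 x).
  (* [t_le] and [C_le] compare the increments of both sides along the layers of
     height [n%:R^-1], with a shift of one layer. *)
  have key j : \int[mu]_x t j.+1 x <= L (t j) + n%:R^-1.
    elim: j => [|j ih].
      have := t_le 0%N; rewrite t0 cint_cst L0 subr0 add0r => /le_trans; apply.
      apply: ler_piMr; first by rewrite invr_ge0 ltW.
      exact: M1_le1.
    by have := t_le j.+1; have := C_le j; lra.
  have := key n.-1; rewrite /n/= -/n tn => /le_trans; apply.
  apply: lerD => //; rewrite -[X in _ <= L X]tn; apply: L_le => // x.
  by apply: tm; rewrite /n.
exists mu => f cf.
have [M M0 fM] := compact_continuous_bounded X_compact cf.
pose h x := (2 * M)^-1 * (f x + M).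
have cfM : continuous (fun x => f x + M) by apply: ctsD => //; exact: ctsc.
have ch : continuous h by apply: ctsM => //; exact: ctsc.
have h01 x : 0 <= h x <= 1.
  have := fM x; rewrite ler_norml /h => /andP[f1 f2].
  rewrite mulr_ge0 ?invr_ge0; [|lra..].
  by rewrite mulrC ler_pdivrMr ?mulr_gt0// mul1r; lra.
have hE : \int[mu]_x h x = L h.
  apply/eqP; rewrite eq_le le_case//=.
  have c1h : continuous (fun x => 1 - h x) by apply: ctsB => //; exact: ctsc.
  have := le_case _ c1h.
  rewrite (cintB X_compact mu (@ctsc 1) ch) (LB (@ctsc 1) ch) cint_cst L1 lerD2l lerN2; apply => x.
  by have := h01 x; lra.
have cM : continuous (fun _ : X => M) by exact: ctsc.
move: hE; rewrite cintZ// cintD// cint_cst LZ// LD//.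
have -> : L (fun=> M) = M.
  transitivity (L (fun=> M * 1)); first by congr L; apply/funext => x; rewrite mulr1.
  by rewrite LZ ?L1 ?mulr1//; exact: ctsc.
by move=> /mulfI; rewrite invr_eq0 gt_eqF ?mulr_gt0// => /(_ isT) /addIr.
Qed.

End riesz.

(** * Compactness, uniqueness, and sets with null boundary *)

Section weak_limits.
Context {R : realType} {X : pmetricType R}.
Hypothesis X_compact : compact [set: X].
Implicit Types (mu nu : M1 X) (U A : set X).

(** The integrals of [f] stay in a compact segment, and there the image of an ultrafilter converges
    to its cluster point. *)
Let ultra_cvg (F : set_system (M1 X)) (f : X -> R) : UltraFilter F ->
  continuous f -> cvg ((fun m : M1 X => \int[m]_x f x) @ F).
Proof.
move=> FU cf; have [M M0 fM] := compact_continuous_bounded X_compact cf.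
pose J (m : M1 X) : R := \int[m]_x f x.
have FJ : F (J @^-1` `[- M, M]).
  apply: filterE => m; rewrite /= in_itv/=.
  by have := cint_norm_le X_compact m cf fM; rewrite ler_norml.
have [l [_ Fl]] := @segment_compact R (- M) M (J @ F) _ FJ.
apply/cvg_ex; exists l => V Vl.
have [//|FnV] := in_ultra_setVsetC (J @^-1` V) FU.
by have [y [Vy nVy]] := Fl (~` V) V FnV Vl.
Qed.

Lemma M1_compact : compact [set: M1 X].
Proof.
rewrite compact_ultra => F FU _.
pose L (f : X -> R) : R := lim ((fun m : M1 X => \int[m]_x f x) @ F).
have LE (f : X -> R) : continuous f ->
    (fun m : M1 X => \int[m]_x f x) @ F --> L f by move=> cf; exact: ultra_cvg.
have cM (g : M1 X -> R) r : (forall m, g m = r) -> lim (g @ F) = r.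
  move=> gr; have -> : g = cst r by exact/funext.
  by apply: cvg_lim => //; exact: cvg_cst.
have [||||mu muL] := @riesz_representation R X X_compact L.
- by apply: cM => m; exact: cint_cst.
- move=> f g cf cg; apply: cvg_lim => //.
  have -> : (fun m : M1 X => \int[m]_x (f x + g x)) =
      (fun m : M1 X => \int[m]_x f x + \int[m]_x g x).
    by apply/funext => m; exact: cintD.
  by apply: cvgD; exact: LE.
- move=> r f cf; apply: cvg_lim => //.
  have -> : (fun m : M1 X => \int[m]_x (r * f x)) =
      (fun m : M1 X => r * \int[m]_x f x).
    by apply/funext => m; exact: cintZ.
  by apply: cvgM; [exact: cvg_cst|exact: LE].
- move=> f cf f0; apply: limr_ge; first exact: ultra_cvg.
  by apply: nearW => m; exact: Rintegral_ge0.
exists mu; split => //; apply: M1_cvg => f cf.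
by rewrite muL//; exact: LE.
Qed.

(** Write [U] as the set where [u] is positive. The sets [u >= 1 / (n + 1)] increase to [U], and
    [min(1, (N + 1) u)] equals 1 on the [N]-th of them and 0 outside [U]. *)
Lemma open_approx mu U (e : R) : open U -> 0 < e ->
  exists g : X -> R, [/\ continuous g, forall x, 0 <= g x <= \1_U x &
    fine (mu U) - e < \int[mu]_x g x].
Proof.
move=> oU e0; have [u [cu u0 UE]] := open_positive_part oU.
pose C n := [set x | n.+1%:R^-1 <= u x] : set (borel X).
have mC n : measurable (C n) by apply: closed_borel; exact: closed_superlevel.
have CU : \bigcup_n C n = U.
  rewrite UE; apply/seteqP; split=> [x [n _] /=|x /= ux].
    by apply: lt_le_trans; rewrite invr_gt0 ltr0n.
  exists (Num.bound (u x)^-1) => //; rewrite /C/=.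
  rewrite invf_ple ?posrE// -natr1 (le_trans (ltW (archi_boundP _)))//.
    by rewrite invr_ge0 ltW.
  by rewrite lerDl.
have mU : measurable (U : set (borel X)) by exact: open_borel.
have Cm : nondecreasing_seq C.
  move=> m n mn; apply/subsetPset => x /=; apply: le_trans.
  by rewrite lef_pV2 ?posrE ?ltr0n// ler_nat ltnS.
have : fine \o (mu \o C) @ \oo --> fine (mu U).
  apply: fine_cvg; rewrite fineK ?M1_fin// -CU.
  by apply: (@nondecreasing_cvg_mu _ _ _ mu) => //; rewrite CU.
move=> /cvgrPdist_lt/(_ e e0)[N _ /(_ N (leqnn N)) HN].
exists (fun x => Num.min 1 (N.+1%:R * u x)).
have cg : continuous (fun x => Num.min 1 (N.+1%:R * u x)).
  move=> x; apply: (@continuous_min _ _ (fun=> 1) (fun x => N.+1%:R * u x)).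
    exact: cvg_cst.
  by apply: cvgM; [exact: cvg_cst|exact: cu].
split=> //.
- move=> x; rewrite le_min ler01/= mulr_ge0//= indicE.
  have [Ux|nUx] := pselect (U x); first by rewrite mem_set// ge_min lexx.
  rewrite memNset// ge_min; apply/orP; right.
  move: nUx; rewrite UE/= => /negP; rewrite -leNgt => ux.
  by rewrite mulr_ge0_le0.
apply: (@lt_le_trans _ _ (fine (mu (C N)))).
  by move: HN => /=; rewrite ltr_norml => /andP[_]; lra.
rewrite -[leLHS]mul1r; apply: measure_le_cint => // x.
rewrite mul1r indicE; have [Cx|nCx] := pselect (C N x).
  rewrite mem_set// le_min lexx/=.
  by rewrite -ler_pdivrMl// mulr1.
by rewrite memNset// le_min ler01/= mulr_ge0.
Qed.

(** Open sets are stable under intersection and generate the Borel sets, so agreement on them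
    suffices. There [open_approx] yields one inequality, and the other follows by symmetry. *)
Lemma M1_eq mu nu : (forall f : X -> R, continuous f ->
    \int[mu]_x f x = \int[nu]_x f x) ->
  forall A : set (borel X), measurable A -> mu A = nu A.
Proof.
move=> munu; apply: (@measure_unique _ R (borel X) (@open X) (fun=> setT) _ _ _ _ mu nu) => //.
- exact: openI.
- by move=> _; exact: openT.
- by apply/seteqP; split => // x _; exists 0%N.
- have le (m1 m2 : M1 X) U : open U ->
      (forall f : X -> R, continuous f -> \int[m1]_x f x = \int[m2]_x f x) ->
      fine (m1 U) <= fine (m2 U).
    move=> oU H; apply/ler_addgt0Pr => e e0.
    have [g [cg g01 gU]] := open_approx m1 oU e0.
    rewrite -lerBlDr (le_trans (ltW gU))// H// -[leRHS]mul1r.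
    apply: cint_le_measure => //; first exact: open_borel.
    by move=> x; rewrite mul1r; case/andP: (g01 x).
  move=> U oU; have mU := open_borel oU.
  have munuU : fine (mu U) = fine (nu U).
    by apply/eqP; rewrite eq_le !le// => f cf; rewrite munu.
  have E : mu U = nu U by rewrite -[LHS]fineK ?M1_fin// munuU fineK ?M1_fin.
  exact: E.
- by move=> _; have := M1_setT mu => /= ->; rewrite ltry.
Qed.

(** The image of [mu] under [T] has the same integrals of continuous functions as [mu], hence agrees
    with it on Borel sets. *)
Lemma invariant_of_integrals (T : X -> X) mu : continuous T ->
  (forall f : X -> R, continuous f -> \int[mu]_x f (T x) = \int[mu]_x f x) ->
  invariant_measures T mu.
Proof.
move=> cT H A mA.
pose T' : {mfun borel X >-> borel X} := HB.pack (T : borel X -> borel X)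
  (isMeasurableFun.Build _ _ _ _ _ (continuous_borel_map cT)).
pose nu : M1 X := distribution mu T'.
suff : nu A = mu A by [].
apply: M1_eq mA => f cf.
have cfT : continuous (f \o T).
  by move=> x; apply: continuous_comp; [exact: cT|exact: cf].
rewrite -H//; congr fine; apply: (@integral_distribution _ _ _ _ _ mu T').
  by apply/measurable_EFinP; exact: continuous_borel_fun.
exact: (continuous_integrable X_compact mu cfT).
Qed.

(** These are the Borel sets with null topological boundary. Asking for some open and closed sets
    around the boundary, rather than for the interior and the closure, makes stability under
    complements, intersections and preimages immediate. *)
Definition continuity_set mu (A : set X) : Prop :=
  measurable (A : set (borel X)) /\
  exists U F, [/\ open U, closed F, U `<=` A, A `<=` F & mu (F `\` U) = 0%E].

Lemma continuity_setC mu A : continuity_set mu A -> continuity_set mu (~` A).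
Proof.
move=> [mA [U [F [oU cF UA AF FU]]]]; split; first exact: measurableC.
exists (~` F), (~` U); split; [exact: closed_openC|exact: open_closedC| | |].
- exact: subsetC.
- exact: subsetC.
- by rewrite setDE setCK setIC -setDE.
Qed.

Lemma continuity_setI mu A B : continuity_set mu A -> continuity_set mu B ->
  continuity_set mu (A `&` B).
Proof.
move=> [mA [U [F [oU cF UA AF FU]]]] [mB [V [G [oV cG VB BG GV]]]].
split; first exact: measurableI.
exists (U `&` V), (F `&` G); split; [exact: openI|exact: closedI| | |].
- exact: setISS.
- exact: setISS.
have mFU : measurable (F `\` U : set (borel X)).
  by apply: measurableD; [exact: closed_borel|exact: open_borel].
have mGV : measurable (G `\` V : set (borel X)).
  by apply: measurableD; [exact: closed_borel|exact: open_borel].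
apply/eqP; rewrite eq_le measure_ge0 andbT.
apply: (@le_trans _ _ (mu ((F `\` U) `|` (G `\` V)))).
  apply: (@le_measure _ _ _ mu); rewrite ?inE.
  - apply: measurableD; apply: measurableI; by [exact: closed_borel|exact: open_borel].
  - exact: measurableU.
  - move=> x [[Fx Gx] nUV]; have [Ux|nUx] := pselect (U x); last by left.
    by right; split=> // Vx; apply: nUV.
rewrite (le_trans (@measureU2 _ _ _ mu _ _ _ _))//.
by move: FU GV => /= -> ->; rewrite adde0.
Qed.

Lemma continuity_setT mu : continuity_set mu setT.
Proof.
split=> //; exists setT, setT; split; [exact: openT|exact: closedT|by []|by []|].
by rewrite setDv; exact: (@measure0 _ _ _ mu).
Qed.

Lemma continuity_set_preimage mu (T : X -> X) A : continuous T ->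
  invariant_measures T mu -> continuity_set mu A ->
  continuity_set mu (T @^-1` A).
Proof.
move=> cT iT [mA [U [F [oU cF UA AF FU]]]].
split; first exact: measurable_preimage_continuous.
exists (T @^-1` U), (T @^-1` F); split.
- by move/continuousP: cT; apply.
- by move/continuous_closedP: cT; apply.
- by move=> x; exact: UA.
- by move=> x; exact: AF.
rewrite -FU; apply: iT; apply: measurableD; [exact: closed_borel|exact: open_borel].
Qed.

(** The open part carries all the mass of [A], and the mass of an open set is lower semicontinuous,
    being approximated from below by integrals of continuous functions. The complement of [A] gives
    the other half. *)
Lemma near_continuity_set mu A (e : R) : continuity_set mu A -> 0 < e ->
  \forall m \near mu, `|fine ((m : M1 X) A) - fine (mu A)| < e.
Proof.
have half (m : M1 X) B : continuity_set m B -> forall d, 0 < d ->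
    \forall m' \near m, fine (m B) - d < fine ((m' : M1 X) B).
  move=> [mB [U [F [oU cF UB BF FU]]]] d d0.
  have mU := open_borel oU; have mF := closed_borel cF.
  have mUB : fine (m B) <= fine (m U).
    apply: (le_trans (le_M1 m mB mF BF)).
    rewrite -lee_fin !fineK ?M1_fin//.
    have -> : F = U `|` (F `\` U).
      apply/seteqP; split=> x; last by move=> [/UB/BF|[]].
      by move=> Fx; have [Ux|nUx] := pselect (U x); [left|right].
    rewrite (le_trans (@measureU2 _ _ _ m _ _ _ _))//; first exact: measurableD.
    by move: FU => /= ->; rewrite adde0.
  have [g [cg g01 gU]] := open_approx m oU d0.
  have d'0 : 0 < \int[m]_x g x - (fine (m U) - d) by rewrite subr_gt0.
  have := @M1_integral_continuous R X g cg m.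
  move=> /cvgrPdist_lt/(_ _ d'0); apply: filterS => m' /=.
  rewrite ltr_norml => /andP[_ h].
  have : \int[m']_x g x <= fine (m' B).
    apply: (@le_trans _ _ (fine (m' U))); last exact: le_M1.
    rewrite -[leRHS]mul1r; apply: cint_le_measure => // x.
    by rewrite mul1r; case/andP: (g01 x).
  by move: h mUB; lra.
move=> cA e0; have [mA _] := cA.
have fC (m : M1 X) : fine (m (~` A)) = 1 - fine (m A).
  have -> : m (~` A) = (1 - m A)%E by exact: (@probability_setC _ _ _ m).
  by rewrite fineB// M1_fin.
have := half _ _ cA e e0; have := half _ _ (continuity_setC cA) e e0.
apply: filterS2 => m; rewrite !fC ltr_norml => h1 h2; lra.
Qed.

End weak_limits.

(** * Metric entropy *)

Lemma fekete (R : realType) (a : nat -> R) : (forall n, 0 <= a n) ->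
  (forall m n, a (m + n)%N <= a m + a n) ->
  cvgn (fun n => n%:R^-1 * a n) /\
  forall n, (0 < n)%N -> limn (fun n => n%:R^-1 * a n) <= n%:R^-1 * a n.
Proof.
move=> a0 aD; pose b n := n%:R^-1 * a n.
pose S := [set b n | n in [set n | (0 < n)%N]].
have b0 n : 0 <= b n by rewrite mulr_ge0// invr_ge0.
have Sinf : has_inf S.
  by split; [exists (b 1%N), 1%N|exists 0 => _ [n _ <-]].
have Sle n : (0 < n)%N -> inf S <= b n.
  by move=> n0; apply: ge_inf; [exact: Sinf.2|exists n].
have aqr q n r : a (q * n + r)%N <= q%:R * a n + a r.
  elim: q => [|q ih]; first by rewrite mul0n add0n mul0r add0r.
  have := aD n (q * n + r)%N; rewrite mulSn -addnA -natr1 mulrDl mul1r; lra.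
suff bS : b @ \oo --> inf S.
  by split; [apply/cvg_ex; exists (inf S)|rewrite (cvg_lim _ bS)].
apply/cvgrPdist_lt => e e0.
have e20 : 0 < e / 2 by rewrite divr_gt0.
have [_ [n /= n0 <-] bn] := inf_adherent e20 Sinf.
have n0' : 0 < n%:R :> R by rewrite ltr0n.
(* A bound for all remainders at once in the division of [m] by [n]; divided by [m] it becomes
   negligible. *)
pose C := \sum_(r < n) a r.
have [N CN] : exists N : nat, C < N%:R * (e / 2).
  exists (Num.bound (C / (e / 2))); rewrite -ltr_pdivrMr//.
  by rewrite archi_boundP// divr_ge0 ?sumr_ge0// ltW.
exists N.+1 => // m /= Nm.
have m0 : (0 < m)%N by exact: leq_trans Nm.
have m0' : 0 < m%:R :> R by rewrite ltr0n.
rewrite distrC ger0_norm; last by rewrite subr_ge0 Sle.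
rewrite ltrBlDl; apply: (@le_lt_trans _ _ (b n + m%:R^-1 * C)).
  have am : a m <= (m %/ n)%:R * a n + a (m %% n)%N.
    by rewrite {1}(divn_eq m n); exact: aqr.
  rewrite /b ler_pdivrMl// mulrDr mulVKf ?gt_eqF//.
  apply: (le_trans am); apply: lerD; last first.
    have rn : (m %% n < n)%N by rewrite ltn_mod.
    by rewrite /C (bigD1 (Ordinal rn))//= lerDl sumr_ge0.
  rewrite mulrA; apply: ler_wpM2r => //.
  by rewrite ler_pdivlMr// -natrM ler_nat leq_trunc_div.
have : m%:R^-1 * C < e / 2.
  rewrite ltr_pdivrMl// (lt_le_trans CN)// ler_pM2r//.
  by rewrite ler_nat (leq_trans _ Nm).
by move: bn; rewrite /b; lra.
Qed.

(** * Partitions as codings and their entropy rates *)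

Section coding.
Context {R : realType} {X : pmetricType R}.
Hypothesis X_compact : compact [set: X].
Variable T : X -> X.
Hypothesis T_continuous : continuous T.
Implicit Types (mu : M1 X).

(** A partition is handled as the map [p] sending a point to the index of its atom; the atoms of the
    joins are then the fibres of the itinerary. *)
Definition itinerary k (p : X -> 'I_k) n : borel X -> {ffun 'I_n -> 'I_k} :=
  word (fun i => p \o iter i T : borel X -> 'I_k) n.

Lemma fin_measurable_iter (I : finType) (p : borel X -> I) n :
  fin_measurable p -> fin_measurable (p \o iter n T : borel X -> I).
Proof.
move=> mp i; apply: (@measurable_preimage_continuous _ _ (iter n T) (p @^-1` [set i])) => //.
exact: iter_continuous.
Qed.

Lemma fin_measurable_itinerary k (p : borel X -> 'I_k) n :
  fin_measurable p -> fin_measurable (itinerary p n).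
Proof.
by move=> mp; apply: fin_measurable_word => i; exact: fin_measurable_iter.
Qed.

Lemma invariant_iter mu n (A : set (borel X)) : invariant_measures T mu ->
  measurable A -> mu (iter n T @^-1` A) = mu A.
Proof.
move=> iT mA; elim: n => // n ih.
rewrite -[in RHS]ih -[RHS]iT; last first.
  by apply: measurable_preimage_continuous => //; exact: iter_continuous.
by congr (mu _); apply/seteqP; split=> x; rewrite /preimage/= -iterSr.
Qed.

Lemma dist_shift (I : finType) mu (f : borel X -> I) n :
  invariant_measures T mu -> fin_measurable f ->
  dist mu (f \o iter n T) = dist mu f.
Proof.
move=> iT mf; apply/funext => i; congr fine.
exact: (invariant_iter n iT (mf i)).
Qed.

Lemma join_entropyE mu k (P : 'I_k -> set X) (p : X -> 'I_k) n :
  (forall i, P i = p @^-1` [set i]) ->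
  join_entropy T mu P n = rv_entropy mu (itinerary p n).
Proof.
move=> Pp; rewrite /join_entropy /rv_entropy /shannon.
have E w : join_atom T P w = itinerary p n @^-1` [set w].
  apply/seteqP; split => [x wx|x /= <- i _].
    by apply/ffunP => i; rewrite ffunE; have := wx i I; rewrite /preimage/= Pp.
  by rewrite /preimage/= Pp ffunE.
by congr (- _); apply: eq_bigr => w _; rewrite E.
Qed.

(** By invariance the last [n] letters have the same distribution as the first [n]. *)
Lemma rv_entropy_itinerary_subadditive mu k (p : borel X -> 'I_k) m n :
  invariant_measures T mu -> fin_measurable p ->
  rv_entropy mu (itinerary p (m + n)) <=
  rv_entropy mu (itinerary p m) + rv_entropy mu (itinerary p n).
Proof.
move=> iT mp; rewrite (le_trans (rv_entropy_word_split _ _ _ _))//.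
  by move=> i; exact: fin_measurable_iter.
rewrite lerD2l le_eqVlt; apply/orP; left; apply/eqP.
rewrite /rv_entropy -(dist_shift m iT (@fin_measurable_itinerary k p n mp)).
congr (shannon (dist _ _)); apply/funext => x; apply/ffunP => i.
by rewrite !ffunE/= addnC iterD.
Qed.

Lemma partition_of_map k (p : borel X -> 'I_k) : fin_measurable p ->
  measurable_partition (fun i => p @^-1` [set i]).
Proof.
move=> mp; split => //; first by move=> i j _ _ [x [/= <- <-]].
by apply/seteqP; split => // x _; exists (p x).
Qed.

Lemma map_of_partition k (P : 'I_k -> set (borel X)) :
  measurable_partition P -> exists p : borel X -> 'I_k,
    fin_measurable p /\ forall i, P i = p @^-1` [set i].
Proof.
move=> [mP tP cP]; have /choice[p pP] : forall x : borel X, exists i, P i x.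
  by move=> x; have : setT x by []; rewrite -cP => -[i _ Pix]; exists i.
have Pp i : P i = p @^-1` [set i].
  apply/seteqP; split => x /= => [Pix|<-]; last exact: pP.
  by apply: (tP (p x) i) => //; exists x; split => //; exact: pP.
by exists p; split=> // i; rewrite -Pp.
Qed.

Let fekete_itinerary mu k (p : borel X -> 'I_k) : invariant_measures T mu ->
  fin_measurable p ->
  let a n := rv_entropy mu (itinerary p n) in
  cvgn (fun n => n%:R^-1 * a n) /\
  forall n, (0 < n)%N -> limn (fun n => n%:R^-1 * a n) <= n%:R^-1 * a n.
Proof.
move=> iT mp; apply: fekete => [n|m n]; last exact: rv_entropy_itinerary_subadditive.
by apply: rv_entropy_ge0; exact: fin_measurable_itinerary.
Qed.

Lemma ge_entropy mu k (p : borel X -> 'I_k) (c : R) :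
  invariant_measures T mu -> fin_measurable p ->
  (forall n, (0 < n)%N -> c <= n%:R^-1 * rv_entropy mu (itinerary p n)) ->
  (c%:E <= entropy T mu)%E.
Proof.
move=> iT mp cH; have [ca _] := fekete_itinerary iT mp.
apply: (@le_trans _ _ (partition_entropy T mu (fun i => p @^-1` [set i]))%:E).
  rewrite lee_fin /partition_entropy.
  have -> : (fun n => n%:R^-1 * join_entropy T mu (fun i => p @^-1` [set i]) n) =
      (fun n => n%:R^-1 * rv_entropy mu (itinerary p n)).
    by apply/funext => n; rewrite (@join_entropyE _ _ _ p).
  by apply: limr_ge => //; exists 1%N => // n /= n1; exact: cH.
by apply: ereal_sup_ubound; exists k, (fun i => p @^-1` [set i]); split=> //;
  exact: partition_of_map.
Qed.

(** By Fekete's lemma the entropy rate is the infimum over [n], so a strict lower bound on the rate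
    holds at every word length. *)
Lemma lt_entropy mu (h : R) : invariant_measures T mu ->
  (h%:E < entropy T mu)%E ->
  exists k (p : borel X -> 'I_k), fin_measurable p /\
    forall n, (0 < n)%N -> h < n%:R^-1 * rv_entropy mu (itinerary p n).
Proof.
move=> iT /ereal_sup_gt[_ [k [P [mP ->]]]]; rewrite lte_fin => hP.
have [p [mp Pp]] := map_of_partition mP; exists k, p; split => // n n0.
have [_ /(_ n n0)] := fekete_itinerary iT mp.
apply: lt_le_trans; move: hP; rewrite /partition_entropy.
by congr (h < limn _); apply/funext => i; rewrite (join_entropyE _ _ Pp).
Qed.

(* Gibbs' inequality against a strictly positive [q] close to the limit
   distribution spares the continuity of [x * ln x] at [0]. *)
Lemma near_rv_entropy (I : finType) mu (f : borel X -> I) (e : R) :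
  (forall i, continuity_set mu (f @^-1` [set i])) -> 0 < e ->
  \forall m \near mu, rv_entropy (m : M1 X) f < rv_entropy mu f + e.
Proof.
move=> cf e0; have mf : fin_measurable f by move=> i; exact: (cf i).1.
(* With this [s] one has [q >= s * p], so replacing [p] by [q] inside the logarithm costs at most
   [e / 2]; the rest of the mass is spread evenly to make [q] positive. *)
pose s := expR (- (e / 2)).
have s0 : 0 < s by exact: expR_gt0.
have s1 : s < 1 by rewrite -expR0 ltr_expR oppr_lt0 divr_gt0.
pose p := dist mu f.
have I0 : (0 < #|I|)%N by apply/card_gt0P; exists (f point).
pose q i := s * p i + (1 - s) / #|I|%:R.
have p0 i : 0 <= p i by exact: dist_ge0.
have sp : \sum_i p i = 1 by exact: sum_dist.
have q_gt0 i : 0 < q i.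
  apply: ltr_wpDl; first by rewrite mulr_ge0// ltW.
  by rewrite divr_gt0 ?subr_gt0// ltr0n.
have sq : \sum_i q i = 1.
  rewrite big_split/= -mulr_sumr sp mulr1 sumr_const -[_ *+ _]mulr_natr.
  by rewrite mulfVK ?pnatr_eq0 -?lt0n//; lra.
have Hq : - \sum_i p i * ln (q i) <= rv_entropy mu f + e / 2.
  rewrite /rv_entropy /shannon -/p.
  have term i : p i * ln (p i) - p i * (e / 2) <= p i * ln (q i).
    have [->|pi0] := eqVneq (p i) 0; first by rewrite !mul0r subr0.
    have pi_gt0 : 0 < p i by rewrite lt_def pi0 p0.
    rewrite -mulrBr ler_pM2l// addrC -[- (e / 2)]expRK -lnM ?posrE//.
    rewrite ler_ln ?posrE// ?mulr_gt0// lerDl divr_ge0 ?ler0n//.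
    by rewrite subr_ge0 ltW.
  have : \sum_i (p i * ln (p i) - p i * (e / 2)) <= \sum_i p i * ln (q i).
    by apply: ler_sum => i _; exact: term.
  by rewrite sumrB -mulr_suml sp mul1r; lra.
have key (m : M1 X) : rv_entropy m f <= - \sum_i dist m f i * ln (q i).
  apply: shannon_gibbs => [i|i|i qi|]; first exact: dist_ge0.
  - exact: ltW.
  - by have := q_gt0 i; rewrite qi ltxx.
  - by rewrite sq sum_dist.
(* The bound [- \sum_i dist m f i * ln (q i)] is linear in the distribution; a change of less than
   [e / 2 / D] in each coordinate moves it by less than [e / 2]. *)
pose D := 1 + \sum_i `|ln (q i)|.
have D0 : 0 < D by rewrite ltr_wpDr// sumr_ge0.
have d0 : 0 < e / 2 / D by rewrite !divr_gt0.
have FF : Filter (nbhs mu) by exact: nbhs_filter.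
have := @filter_forall (M1 X) I (fun i => [set m : M1 X | `|dist m f i - p i| < e / 2 / D])
  (nbhs mu) FF (fun i => near_continuity_set X_compact (cf i) d0).
apply: filterS => m mp; apply: (le_lt_trans (key m)).
have : \sum_i p i * ln (q i) - \sum_i dist m f i * ln (q i) < e / 2.
  rewrite -sumrB; apply: (@le_lt_trans _ _ (\sum_i e / 2 / D * `|ln (q i)|)).
    apply: ler_sum => i _; rewrite -mulrBl (le_trans (ler_norm _))// normrM.
    by apply: ler_wpM2r => //; rewrite distrC; exact: ltW (mp i).
  rewrite -mulr_sumr mulrAC ltr_pdivrMr// ltr_pM2l ?divr_gt0// /D.
  by rewrite ltrDr.
lra.
Qed.

End coding.

(** The fibres of the first index at which a test succeeds are finite Boolean combinations of the
    tested sets. The class [S] is kept abstract because it is used both for Borel sets and for sets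
    with null boundary. *)
Lemma find_preimage_ind (I : Type) (Y : Type) (S : set (set Y))
    (a : I -> Y -> bool) (s : seq I) n :
  S setT -> (forall A, S A -> S (~` A)) ->
  (forall A B, S A -> S B -> S (A `&` B)) -> (forall i, S [set y | a i y]) ->
  S [set y | find (fun i => a i y) s = n].
Proof.
move=> ST SC SI Sa; elim: s n => [|i s ih] n /=.
  case: n => [|n].
    by rewrite (_ : [set _ | _] = setT)//; exact/seteqP.
  by rewrite (_ : [set _ | _] = ~` setT); [exact: SC|rewrite setCT; apply/seteqP; split].
case: n => [|n].
  rewrite (_ : [set _ | _] = [set y | a i y])//.
  by apply/seteqP; split=> y /=; case: ifP.
rewrite (_ : [set _ | _] = ~` [set y | a i y] `&`
    [set y | find (fun i => a i y) s = n]); first by apply: SI; [exact: SC|exact: ih].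
apply/seteqP; split => y /=; case: ifP => // aiy; first by case.
  by move=> [].
by move=> [_ ->].
Qed.

(** * Partitions of small diameter with null boundaries *)

Section small_partition.
Context {R : realType} {X : pmetricType R}.
Hypothesis X_compact : compact [set: X].
Implicit Types (mu : M1 X).

(** Spheres of different radii are disjoint, so only countably many have positive mass, whereas an
    interval of radii has positive Lebesgue measure. *)
Lemma exists_null_sphere mu (x : X) (e : R) : 0 < e ->
  exists r, 0 < r < e /\ mu [set y | mdist y x = r] = 0%E.
Proof.
move=> e0.
pose f : {mfun borel X >-> R} := HB.pack ((fun y => mdist y x) : borel X -> R)
  (isMeasurableFun.Build _ _ _ _ _ (continuous_borel_fun (@mdist_continuous R X x))).
have cf := @pmf_gt0_countable _ _ _ mu f.
have [r [r0e nr]] : exists r, `]0, e[%classic r /\ ~ [set r | 0 < @pmf _ _ _ mu f r] r.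
  apply: contrapT => H.
  have : lebesgue_measure `]0, e[%classic = 0%E :> \bar R.
    apply: countable_lebesgue_measure0; apply: sub_countable cf.
    apply: subset_card_le => r r0e; apply: contrapT => nr; apply: H.
    by exists r.
  rewrite lebesgue_measure_itv/= lte_fin e0 oppr0 adde0 => -[] e00.
  by move: e0; rewrite e00 ltxx.
exists r; split; first by move: r0e; rewrite /= in_itv.
have mr : measurable ([set y | mdist y x = r] : set (borel X)).
  by have := measurable_funPTI f (measurable_set1 r).
rewrite -[LHS]fineK ?M1_fin//; congr EFin; apply/eqP; rewrite eq_le fine_ge0// andbT.
by rewrite leNgt; apply/negP.
Qed.

Lemma exists_small_partition mu (e : R) : 0 < e ->
  exists k (p : borel X -> 'I_k),
    (forall i, continuity_set mu (p @^-1` [set i])) /\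
    forall x y, p x = p y -> mdist x y <= e.
Proof.
move=> e0; have e20 : 0 < e / 2 by rewrite divr_gt0.
have /choice[r rP] := fun x => exists_null_sphere mu x e20.
pose U x := [set y : X | mdist y x < r x].
have oU x : open (U x).
  rewrite (_ : U x = [set y | - r x < - mdist y x]).
    by apply: open_superlevel => y; apply: cvgN; exact: mdist_continuous.
  by apply/seteqP; split => y /=; rewrite ltrN2.
have cX := X_compact; rewrite compact_cover in cX.
have [|D _ Dcov] := cX X setT U (fun x _ => oU x).
  by move=> x _; exists x => //; rewrite /U/= mdistxx; case: (rP x) => /andP[].
pose s := finmap.enum_fset D.
pose a (x y : X) := mdist y x < r x.
(* Each point is sent to the index of the first ball containing it. [find] ranges up to [size s]
   included, hence the successor. *)
exists (size s).+1, (fun y => inord (find (a^~ y) s)); split.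
  move=> i; rewrite (_ : _ @^-1` _ = [set y | find (a^~ y) s = i]).
    apply: find_preimage_ind.
    - exact: continuity_setT.
    - by move=> A; exact: continuity_setC.
    - by move=> A B; exact: continuity_setI.
    move=> x; split; first by apply: open_borel; exact: oU.
    exists (U x), [set y | mdist y x <= r x]; split => //.
    - by apply: closed_sublevel; exact: mdist_continuous.
    - by move=> y /=; exact: ltW.
    rewrite (_ : _ `\` _ = [set y | mdist y x = r x]); first by case: (rP x).
    apply/seteqP; split => y /=.
      move=> [yr /negP]; rewrite /U/= -leNgt => ry.
      by apply/eqP; rewrite eq_le yr.
    by rewrite /U/= => ->; rewrite lexx ltxx; split.
  apply/seteqP; split => y /=.
    by move=> <-; rewrite inordK// ltnS find_size.
  by move=> yi; apply/val_inj; rewrite /= inordK ?yi// ltnS -ltnS; exact: ltn_ord.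
move=> x y /= /(congr1 val) /=; rewrite !inordK ?ltnS ?find_size// => xy.
have hs z : has (a^~ z) s.
  have [w /= wD Uwz] := Dcov z I; apply/hasP; exists w => //.
have := nth_find point (hs x); have := nth_find point (hs y).
rewrite -xy; set w := nth _ _ _; rewrite /a => yw xw.
rewrite (le_trans (metric_triangle _ w _))// (metric_sym w).
by case: (rP w) => /andP[_ +] _; move: yw xw; lra.
Qed.

End small_partition.

(** * Separated sets for the dynamical metrics *)

Section separated_sets.
Context {R : realType} {X : pmetricType R}.
Hypothesis X_compact : compact [set: X].
Variable T : X -> X.
Hypothesis T_continuous : continuous T.

(** Since dynamical balls are closed, distinct points are at distance strictly larger than [e] at
    some time; this is what makes a maximal set cover by balls of the same radius. *)
Definition separated (m : nat) (e : R) (s : seq X) : Prop :=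
  uniq s /\ forall x y, x \in s -> y \in s -> x != y ->
    ~ dynamical_ball T m x e y.

Lemma dynamical_ballxx m (x : X) (e : R) : 0 <= e -> dynamical_ball T m x e x.
Proof. by move=> e0 k _; rewrite mdistxx. Qed.

Lemma dynamical_ball_sym m (x y : X) (e : R) :
  dynamical_ball T m x e y -> dynamical_ball T m y e x.
Proof. by move=> H k km; rewrite metric_sym; exact: H. Qed.

Lemma closed_dynamical_ball m x (e : R) : closed (dynamical_ball T m x e).
Proof.
rewrite (_ : dynamical_ball T m x e =
    \bigcap_(k in [set k | (k < m)%N]) [set y | mdist (iter k T y) (iter k T x) <= e]).
  apply: closed_bigI => k _; apply: closed_sublevel => y.
  apply: (@continuous_comp _ _ _ (iter k T) (fun z => mdist z (iter k T x))).
    exact: iter_continuous.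
  exact: mdist_continuous.
by apply/seteqP; split => y H k km; have := H k km; rewrite /= metric_sym.
Qed.

(** Pigeonhole: finitely many open dynamical balls of radius [e / 2] cover the space, and two points
    in the same one are never more than [e] apart before time [m]. *)
Lemma separated_size_bounded m (e : R) : 0 < e ->
  exists N, forall s, separated m e s -> (size s <= N)%N.
Proof.
move=> e0; have e20 : 0 < e / 2 by rewrite divr_gt0.
pose U x := ~` \bigcup_(k in [set k | (k < m)%N])
  [set y : X | e / 2 <= mdist (iter k T y) (iter k T x)].
have UE x y : U x y -> forall k, (k < m)%N ->
    mdist (iter k T y) (iter k T x) < e / 2.
  by move=> Uxy k km; rewrite ltNge; apply/negP => h; apply: Uxy; exists k.
have oU x : open (U x).
  apply: closed_openC; apply: closed_bigcup; first exact: finite_II.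
  move=> k _; apply: closed_superlevel => y.
  apply: (@continuous_comp _ _ _ (iter k T) (fun z => mdist z (iter k T x))).
    exact: iter_continuous.
  exact: mdist_continuous.
have cX := X_compact; rewrite compact_cover in cX.
have [|D _ Dcov] := cX X setT U (fun x _ => oU x).
  by move=> x _; exists x => // -[k _] /=; rewrite mdistxx leNgt e20.
have /choice[c cP] : forall x, exists z, z \in finmap.enum_fset D /\ U z x.
  by move=> x; have [z zD Uzx] := Dcov x I; exists z.
exists (size (finmap.enum_fset D)) => s [us sep].
rewrite -(size_map c); apply: uniq_leq_size; last first.
  by move=> _ /mapP[x _ ->]; exact: (cP x).1.
rewrite map_inj_in_uniq// => x y xs ys cxy; apply/eqP; apply: contrapT => /negP xy.
apply: (sep x y xs ys xy) => k km.
have h1 := UE _ _ (cP x).2 k km; have := UE _ _ (cP y).2 k km; rewrite -cxy => h2.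
rewrite (le_trans (metric_triangle _ (iter k T (c x)) _))//.
by move: h1 h2; rewrite (metric_sym (iter k T y)); lra.
Qed.

(** Sizes are bounded, so a largest separated subset of [D] exists; a point of [D] outside all its
    balls could be added to it. *)
Lemma exists_maximal_separated (m : nat) (e : R) (D : set X) : 0 < e ->
  exists s, [/\ separated m e s, forall x, x \in s -> D x &
    forall y, D y -> exists2 x, x \in s & dynamical_ball T m x e y].
Proof.
move=> e0; have [N HN] := separated_size_bounded m e0.
pose P n := `[< exists s, [/\ separated m e s, forall x, x \in s -> D x & size s = n] >].
have exP : exists n, P n by exists 0%N; apply/asboolP; exists [::].
have ubP n : P n -> (n <= N)%N by move=> /asboolP[s [ss _ <-]]; exact: HN.
case: (ex_maxnP exP ubP) => n /asboolP[s [ss sD sn]] nmax.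
exists s; split => // y Dy; apply: contrapT => ny.
have ys : y \notin s.
  by apply/negP => ys; apply: ny; exists y => //; apply: dynamical_ballxx; exact: ltW.
suff /nmax : P n.+1 by rewrite ltnn.
apply/asboolP; exists (y :: s); split; [|move=> x|by rewrite /= sn].
  split; first by rewrite /= ys; case: ss.
  move=> x z; rewrite !inE => /predU1P[->|xs] /predU1P[->|zs] xz.
  - by rewrite eqxx in xz.
  - by move=> /dynamical_ball_sym yz; apply: ny; exists z.
  - by move=> xy; apply: ny; exists x.
  - by case: ss => _; apply.
by rewrite inE => /predU1P[->//|]; exact: sD.
Qed.

End separated_sets.

(* For each offset [j < n], cut [0, m) into blocks of length [n] starting at [j];
   then sum over [j]. *)
Lemma block_inequality (R : realType) (a : nat -> nat -> R) (c : R) (m n : nat) :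
  (forall i l l', a i (l + l')%N <= a i l + a (i + l)%N l') ->
  (forall i l, 0 <= a i l) -> (forall i l, a i l <= l%:R * c) -> (0 < n)%N ->
  n%:R * a 0%N m <= \sum_(i < m) a i n + 2 * n%:R ^+ 2 * c.
Proof.
move=> aD a0 ac n0.
have c0 : 0 <= c by have := le_trans (a0 0%N 1%N) (ac 0%N 1%N); rewrite mul1r.
have ac' i l : (l <= n)%N -> a i l <= n%:R * c.
  by move=> ln; rewrite (le_trans (ac _ _))// ler_wpM2r// ler_nat.
(* Blocks of length [n] are stripped from the left. The sum counts every block that starts before
   [l], including a last one that may stick out, which nonnegativity allows; the incomplete end
   costs at most [n%:R * c]. *)
have step l i : a i l <= \sum_(0 <= t < l | (n %| t)%N) a (i + t)%N n + n%:R * c.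
  elim/ltn_ind: l i => l ih i; have [ln|nl] := ltnP l n.
    by rewrite (le_trans (ac' _ _ (ltnW ln)))// lerDr sumr_ge0.
  rewrite -(subnKC nl) (le_trans (aD _ _ _))//.
  have ln : (l - n < l)%N by rewrite ltn_subrL n0 (leq_trans n0).
  rewrite (big_cat_nat (leq0n n))/= ?leq_addr//.
  rewrite big_ltn_cond// dvdn0 addn0 -!addrA; apply: lerD => //.
  apply: ler_wpDl; first exact: sumr_ge0.
  rewrite (_ : \sum_(n <= t < n + (l - n) | (n %| t)%N) a (i + t)%N n =
      \sum_(0 <= t < l - n | (n %| t)%N) a (i + n + t)%N n); first exact: ih.
  rewrite -{1}[n]add0n big_addn addKn; apply: eq_big => t.
    by rewrite dvdn_addl.
  by rewrite addnA addnAC.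
have [mn|nm] := ltnP m n.
  rewrite (@le_trans _ _ (n%:R * (n%:R * c)))//.
    by apply: ler_wpM2l => //; apply: ac'; exact: ltnW.
  rewrite mulrA -expr2 ler_wpDl ?sumr_ge0// ler_wpM2r//.
  by have := sqr_ge0 (n%:R : R); lra.
(* The [j] letters before the first block and the incomplete end each cost at most [n%:R * c], which
   accounts for the factor 2. *)
have off (j : 'I_n) : a 0%N m <= \sum_(i < m | (i %% n)%N == j) a i n + 2 * n%:R * c.
  have jm : (j <= m)%N by exact: leq_trans (ltnW (ltn_ord j)) nm.
  rewrite -{1}(subnKC jm) (le_trans (aD _ _ _))// add0n.
  have h1 := ac' 0%N j (ltnW (ltn_ord j)); have h2 := step (m - j)%N j.
  suff : \sum_(0 <= t < m - j | (n %| t)%N) a (j + t)%N n <=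
      \sum_(i < m | (i %% n)%N == j) a i n by lra.
  rewrite -(big_mkord (fun i => (i %% n)%N == j) (fun i => a i n)).
  rewrite [leRHS](big_cat_nat (leq0n j) jm)/=.
  apply: ler_wpDl; first exact: sumr_ge0.
  rewrite (_ : \sum_(j <= i < m | (i %% n)%N == j) a i n =
      \sum_(0 <= t < m - j | (n %| t)%N) a (j + t)%N n)//.
  rewrite -{1}[val j]add0n big_addn; apply: eq_big => t; last by rewrite addnC.
  have jE : (j : nat) = ((0 + j) %% n)%N by rewrite add0n modn_small.
  by rewrite [X in _ == X]jE eqn_modDr mod0n.
have : \sum_(j < n) a 0%N m <=
    \sum_(j < n) (\sum_(i < m | (i %% n)%N == j) a i n + 2 * n%:R * c).
  by apply: ler_sum => j _; exact: off.
rewrite sumr_const card_ord -[_ *+ _]mulr_natl => /le_trans; apply.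
rewrite big_split/= sumr_const card_ord -[_ *+ n]mulr_natl; apply: lerD; last first.
  by rewrite le_eqVlt; apply/orP; left; apply/eqP; ring.
(* Each [i < m] has exactly one residue modulo [n], so the sums over the offsets together run once
   over all [i]. *)
rewrite [leRHS](partition_big (fun i : 'I_m => Ordinal (ltn_pmod i n0)) xpredT)//=.
Qed.

(** * Upper bound *)

Section misiurewicz.
Context {R : realType} {X : pmetricType R}.
Hypothesis X_compact : compact [set: X].
Variables (T : X -> X) (phi : X -> R).
Hypotheses (T_continuous : continuous T) (phi_continuous : continuous phi).

(** Let [sg] put mass [w i] on the [i]-th point of [s]; then [mu] is the average of its images under
    the first [m] iterates. Separation makes the [m]-word entropy of [sg] at least that of the
    weights, the block inequality breaks it into [n]-words, and concavity passes from [sg] to [mu].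
    The weights are exported because convexity and near-invariance of [mu] are read off from
    them. *)
Lemma misiurewicz_estimate (m : nat) (e : R) (s : seq X) :
  (0 < m)%N -> separated T m e s -> (0 < size s)%N ->
  exists (mu : M1 X) (w : nat -> R),
  [/\ forall i, 0 <= w i, \sum_(i < size s) w i = 1,
    forall f : X -> R, continuous f -> \int[mu]_x f x =
      \sum_(i < size s) w i * \int[empirical T m (nth point s i)]_x f x &
    forall k (p : borel X -> 'I_k) n, fin_measurable p ->
      (forall x y, p x = p y -> mdist x y <= e) -> (0 < n)%N ->
      m%:R^-1 * ln (\sum_(i < size s)
        expR (\sum_(k < m) phi (iter k T (nth point s i)))) <=
      n%:R^-1 * rv_entropy mu (itinerary T p n) + m%:R^-1 * (2 * n%:R * ln k%:R)
      + \int[mu]_x phi x].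
Proof.
move=> m0 [us sep] s0.
have m0' : 0 < m%:R :> R by rewrite ltr0n.
pose x i := nth point s i.
pose S i := \sum_(k < m) phi (iter k T (x i)).
pose g i := expR (S i).
pose Z := \sum_(i < size s) g i.
have g0 i : 0 < g i by exact: expR_gt0.
have Z0 : 0 < Z.
  by rewrite /Z (bigD1 (Ordinal s0))//= ltr_wpDr// sumr_ge0// => i _; exact: ltW.
pose w i := g i / Z.
have w0 i : 0 <= w i by rewrite divr_ge0// ltW.
have w1 : \sum_(i < size s) w i = 1 by rewrite -mulr_suml divff ?gt_eqF.
have [sg sgE] := exists_convex_comb
  (fun i => \d_(x i : borel X) : probability (borel X) R) w0 w1.
have [mu muE] := exists_convex_comb (fun i => empirical T m (x i)) w0 w1.
have int_mu (f : X -> R) : continuous f ->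
    \int[mu]_x f x = \sum_(i < size s) w i * \int[empirical T m (x i)]_x f x.
  move=> cf; apply: (@integral_convex_comb R X X_compact (size s) w
    (fun i => empirical T m (x i)) mu f) => // A _; exact: muE.
exists mu, w; split => // k p n mp pe n0.
have dist_sg (I : finType) (f : borel X -> I) v :
    dist sg f v = \sum_(i < size s) w i * (f (x i) == v)%:R.
  rewrite /dist sgE /=.
  rewrite (eq_bigr (fun i : 'I_(size s) => (w i * (f (x i) == v)%:R)%:E)).
    by rewrite sumEFin.
  move=> i _; rewrite /= diracE EFinM; congr (_ * (_ %:R)%:E)%E.
  by rewrite /=; congr nat_of_bool; apply/idP/eqP; rewrite inE.
have dist_mu (I : finType) (f : borel X -> I) v : fin_measurable f ->
    dist mu f v = \sum_(j < m) m%:R^-1 * dist sg (f \o iter j T) v.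
  move=> mf; rewrite /dist muE /=.
  rewrite (eq_bigr (fun i : 'I_(size s) =>
      (w i * (m%:R^-1 * \sum_(j < m) (f (iter j T (x i)) == v)%:R))%:E)).
    rewrite sumEFin/= -mulr_sumr.
    under [in RHS]eq_bigr do rewrite -/(dist _ _ _) dist_sg.
    rewrite exchange_big/= mulr_sumr; apply: eq_bigr => i _.
    by rewrite mulrCA mulr_sumr.
  move=> i _; rewrite empiricalE// [in RHS]EFinM; congr (_ * _)%E.
  rewrite [in RHS]EFinM; congr (_ * _)%E; rewrite -sumEFin; apply: eq_bigr => j _.
  rewrite diracE; congr (_ %:R)%:E; congr nat_of_bool.
  by apply/idP/eqP; rewrite inE.
pose a i l := rv_entropy sg (word (fun t => p \o iter (i + t) T : borel X -> 'I_k) l).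
have mword i l : fin_measurable (word (fun t => p \o iter (i + t) T : borel X -> 'I_k) l).
  by apply: fin_measurable_word => t; exact: fin_measurable_iter.
have aD i l l' : a i (l + l')%N <= a i l + a (i + l)%N l'.
  rewrite /a (le_trans (rv_entropy_word_split _ _ _ _))//.
    by move=> t; exact: fin_measurable_iter.
  by under [in X in _ + X <= _]eq_fun do rewrite addnA.
have a0 i l : 0 <= a i l by exact: rv_entropy_ge0.
have ac i l : a i l <= l%:R * ln k%:R.
  rewrite /a (le_trans (rv_entropy_word_le _ _ _))//.
    by move=> t; exact: fin_measurable_iter.
  by rewrite card_ord.
have aT i : a i n = rv_entropy sg (itinerary T p n \o iter i T).
  congr (rv_entropy _ _); apply/funext => y; apply/ffunP => t.
  by rewrite !ffunE/= addnC iterD.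
(* The distribution of the [n]-word under [mu] is the average over [j < m] of its distributions
   under [sg] shifted by [j], so concavity applies. *)
have upper : \sum_(i < m) a i n <= m%:R * rv_entropy mu (itinerary T p n).
  have -> : rv_entropy mu (itinerary T p n) = shannon (fun v =>
      \sum_(j < m) m%:R^-1 * dist sg (itinerary T p n \o iter j T) v).
    congr shannon; apply/funext => v.
    by apply: dist_mu; exact: fin_measurable_itinerary.
  rewrite -ler_pdivrMl// mulr_sumr; under eq_bigr do rewrite aT.
  apply: (@shannon_concave _ _ 'I_m (fun=> m%:R^-1)
    (fun j => dist sg (itinerary T p n \o iter j T))) => //.
  - by rewrite sumr_const card_ord -[_ *+ _]mulr_natl divff ?gt_eqF.
  - by move=> j v; exact: dist_ge0.
  - move=> j; apply: sum_dist; apply: fin_measurable_iter => //.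
    exact: fin_measurable_itinerary.
(* A partition of diameter at most [e] gives distinct [m]-words to the separated points, so no
   entropy of the weights is lost. Since [ln (w i) = S i - ln Z], that entropy equals the left-hand
   side. *)
have lower : ln Z - m%:R * \int[mu]_x phi x <= a 0%N m.
  pose h (i : 'I_(size s)) := word (fun t => p \o iter (0 + t) T : borel X -> 'I_k) m (x i).
  have hI : injective h.
    move=> i j hij; apply/val_inj/eqP; rewrite -(nth_uniq point _ _ us) ?ltn_ord//.
    apply/eqP; apply: contrapT => /eqP xij.
    apply: (sep _ _ (mem_nth _ (ltn_ord i)) (mem_nth _ (ltn_ord j)) xij) => t tm.
    by apply: pe; move/ffunP/(_ (Ordinal tm)) : hij; rewrite !ffunE.
  have := ler_shannon_injective (fun i : 'I_(size s) => w0 i) hI.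
  have -> : (fun v => \sum_(i | h i == v) w i) =
      dist sg (word (fun t => p \o iter (0 + t) T : borel X -> 'I_k) m).
    apply/funext => v; rewrite dist_sg big_mkcond/=; apply: eq_bigr => i _.
    by rewrite -/(h i); case: eqP; rewrite ?mulr1 ?mulr0.
  apply: le_trans; rewrite le_eqVlt; apply/orP; left; apply/eqP.
  rewrite /shannon int_mu// mulr_sumr.
  rewrite (eq_bigr (fun i : 'I_(size s) => w i * S i)); last first.
    by move=> i _; rewrite integral_empirical// mulrCA mulVKf ?gt_eqF.
  rewrite -[ln Z]mul1r -w1 mulr_suml -sumrB -sumrN; apply: eq_bigr => i _.
  by rewrite {2}/w ln_div ?posrE// /g expRK mulrBr opprB.
have := block_inequality m aD a0 ac n0.
have n0' : 0 < n%:R :> R by rewrite ltr0n.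
rewrite -/Z => block.
rewrite ler_pdivrMl// -(ler_pM2l n0').
set H := rv_entropy mu _; set J := \int[mu]_x phi x.
have -> : n%:R * (m%:R * (n%:R^-1 * H + m%:R^-1 * (2 * n%:R * ln k%:R) + J)) =
    m%:R * H + 2 * n%:R ^+ 2 * ln k%:R + n%:R * (m%:R * J).
  by field; rewrite !gt_eqF.
have := ler_wpM2l (ltW n0') lower; rewrite mulrBr -/J; move: block upper; rewrite -/H; lra.
Qed.

End misiurewicz.

Section limsup_liminf.
Context {R : realType}.
Implicit Types (u : nat -> \bar R) (a c : \bar R).

Lemma limn_esup_le_near u a : (\forall n \near \oo, (u n <= a)%E) ->
  (limn_esup u <= a)%E.
Proof.
move=> [N _ uN]; apply: ge_ereal_inf.
exists (ereal_sup [set u n | n in [set n | (N <= n)%N]]).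
  by exists [set n | (N <= n)%N] => //; exists N.
by apply: ge_ereal_sup => _ [n /= Nn <-]; exact: uN.
Qed.

Lemma limn_einf_ge_near u a : (\forall n \near \oo, (a <= u n)%E) ->
  (a <= limn_einf u)%E.
Proof.
move=> uN; rewrite /limn_einf leeNr; apply: limn_esup_le_near.
by apply: filterS uN => n; rewrite leeN2.
Qed.

Lemma lee_real_above c a : (forall r : R, (c < r%:E)%E -> (a <= r%:E)%E) ->
  (a <= c)%E.
Proof.
case: c => [c||] H; last 2 first.
- exact: leey.
- by rewrite leeNy_eq; case: a H => // [r|] H;
    [have := H (r - 1) (ltNyr _)|have := H 0 (ltNyr _)]; rewrite ?lee_fin//; lra.
apply/lee_addgt0Pr => e e0; rewrite -EFinD; apply: H.
by rewrite lte_fin ltrDl.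
Qed.

Lemma lee_real_below c a : (forall r : R, (r%:E < c)%E -> (r%:E <= a)%E) ->
  (c <= a)%E.
Proof.
move=> H; rewrite -leeN2; apply: lee_real_above => r.
rewrite lteNl -EFinN => /H; rewrite leeNl -EFinN//.
Qed.

End limsup_liminf.

Section finite_subadditivity.
Context {R : realType} {X : pmetricType R}.

Lemma M1_le_sum (nu : M1 X) (I : eqType) (s : seq I)
    (A : set (borel X)) (B : I -> set (borel X)) :
  measurable A -> (forall i, measurable (B i)) ->
  (forall x, A x -> exists2 i, i \in s & B i x) ->
  fine (nu A) <= \sum_(i <- s) fine (nu (B i)).
Proof.
move=> mA mB; elim: s A mA => [|i s ih] A mA AB.
  rewrite big_nil (_ : A = set0) ?measure0//.
  by apply/seteqP; split=> // x /AB[].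
have mAB : measurable (A `\` B i) by exact: measurableD.
rewrite big_cons; apply: (@le_trans _ _ (fine (nu (B i)) + fine (nu (A `\` B i)))).
  rewrite -lee_fin EFinD !fineK ?M1_fin//.
  apply: (@le_trans _ _ (nu (B i `|` (A `\` B i)))).
    apply: (@le_measure _ _ _ nu); rewrite ?inE//; first exact: measurableU.
    by move=> x Ax; have [|] := pselect (B i x); [left|right].
  exact: (@measureU2 _ _ _ nu).
rewrite lerD2l; apply: ih => // x [/AB[j]]; rewrite inE => /predU1P[->//|js Bx _].
by exists j.
Qed.

End finite_subadditivity.

Section empirical_continuity.
Context {R : realType} {X : pmetricType R}.
Hypothesis X_compact : compact [set: X].
Variable T : X -> X.
Hypothesis T_continuous : continuous T.

Lemma birkhoff_sum_continuous (f : X -> R) m : continuous f ->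
  continuous (fun x => \sum_(k < m) f (iter k T x)).
Proof.
move=> cf; elim: m => [|m ih] x.
  by under eq_fun do rewrite big_ord0; exact: cvg_cst.
under eq_fun do rewrite big_ord_recr/=.
apply: cvgD; first exact: ih.
apply: (@continuous_comp _ _ _ (iter m T) f); last exact: cf.
exact: iter_continuous.
Qed.

(** This turns conditions on empirical measures into closed, open, and hence Borel, conditions on
    points. *)
Lemma empirical_continuous m : (0 < m)%N ->
  continuous (empirical T m : X -> M1 X).
Proof.
move=> m0 x; apply: M1_cvg => f cf.
have E : (fun y => \int[empirical T m y]_z f z) =
    (fun y => m%:R^-1 * \sum_(k < m) f (iter k T y)).
  by apply/funext => y; exact: integral_empirical.
rewrite [X in _ --> X](_ : _ = (fun y => \int[empirical T m y]_z f z) x)//.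
suff : {for x, continuous (fun y => \int[empirical T m y]_z f z)} by [].
rewrite E; apply: cvgM; first exact: cvg_cst.
exact: birkhoff_sum_continuous.
Qed.

Lemma closed_empirical m (F : set (M1 X)) : (0 < m)%N -> closed F ->
  closed [set x | F (empirical T m x)].
Proof.
by move=> /empirical_continuous /continuous_closedP ce cF; exact: ce.
Qed.

Lemma open_empirical m (G : set (M1 X)) : (0 < m)%N -> open G ->
  open [set x | G (empirical T m x)].
Proof.
by move=> /empirical_continuous /continuousP ce cF; exact: ce.
Qed.

End empirical_continuity.

Section gibbs.
Context {R : realType} {X : pmetricType R}.
Hypothesis X_compact : compact [set: X].
Variables (T : X -> X) (phi : X -> R) (nu : M1 X).
Hypotheses (T_continuous : continuous T) (phi_continuous : continuous phi).
Hypothesis nu_gibbs : weak_gibbs T phi nu.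

(** Exponentiated, the Gibbs estimates can be summed over balls. A ball of measure 0 would have
    logarithm [-oo], against the lower estimate. *)
Lemma gibbs_bounds (d : R) : 0 < d -> exists2 e0 : R, 0 < e0 &
  forall e, 0 < e -> e <= e0 -> exists N, forall m, (N <= m)%N -> (0 < m)%N ->
  forall x,
    expR (\sum_(k < m) phi (iter k T x) - m%:R * d) <=
    fine (nu (dynamical_ball T m x e)) <=
    expR (\sum_(k < m) phi (iter k T x) + m%:R * d).
Proof.
move=> d0; have [e0 e00 H] := nu_gibbs d0; exists e0 => // e e1 e2.
have [N HN] := H e e1 e2; exists N => m Nm m0 x.
set S := \sum_(k < m) phi (iter k T x) => /=.
have m0' : 0 < m%:R :> R by rewrite ltr0n.
have mB : measurable (dynamical_ball T m x e : set (borel X)).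
  by apply: closed_borel; exact: closed_dynamical_ball.
have := HN m Nm x; rewrite integral_empirical// -/S.
rewrite -{1 2}(fineK (M1_fin nu mB)).
have := fine_ge0 (measure_ge0 nu (dynamical_ball T m x e)).
rewrite le_eqVlt => /predU1P[<-|v0].
  rewrite le0_lneNy//. rewrite mulrNy gtr0_sg ?invr_gt0// mul1e => /andP[+ _].
  by rewrite addNye leeNy_eq.
rewrite lne_EFin// -EFinM -EFinB !lee_fin => /andP[h1 h2].
rewrite -[fine _]lnK ?posrE// !ler_expR.
set l := ln _ in h1 h2 *.
have -> : l = m%:R * (m%:R^-1 * l - m%:R^-1 * S) + S.
  by rewrite mulrBr !mulVKf ?gt_eqF// subrK.
have h1' : - (m%:R * d) <= m%:R * (m%:R^-1 * l - m%:R^-1 * S).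
  by rewrite -mulrN ler_pM2l.
have h2' : m%:R * (m%:R^-1 * l - m%:R^-1 * S) <= m%:R * d by rewrite ler_pM2l.
by apply/andP; split; move: h1' h2'; lra.
Qed.

End gibbs.

Section upper_local.
Context {R : realType} {X : pmetricType R}.
Hypothesis X_compact : compact [set: X].
Variables (T : X -> X) (phi : X -> R) (nu : M1 X).
Hypotheses (T_continuous : continuous T) (phi_continuous : continuous phi).
Hypothesis nu_gibbs : weak_gibbs T phi nu.
Implicit Types (mu : M1 X).

Lemma continuity_set_bigcap mu (A : nat -> set X) n :
  (forall i, continuity_set mu (A i)) ->
  continuity_set mu [set x | forall i, (i < n)%N -> A i x].
Proof.
move=> cA; elim: n => [|n ih].
  rewrite (_ : [set _ | _] = setT); first exact: continuity_setT.
  by apply/seteqP; split.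
rewrite (_ : [set _ | _] = [set x | forall i, (i < n)%N -> A i x] `&` A n).
  exact: continuity_setI.
apply/seteqP; split=> x /=.
  by move=> H; split=> [i ilt|]; apply: H => //; exact: ltnW.
move=> [H1 H2] i; rewrite ltnS leq_eqVlt => /predU1P[->|ilt]; [exact: H2|exact: H1].
Qed.

(** A fibre is a finite intersection of preimages of atoms, and invariance keeps the boundaries of
    these preimages null. Indexing by [nat] through [inord] needs a positive length, whence the
    separate empty word. *)
Lemma continuity_set_itinerary mu k (p : borel X -> 'I_k) n w :
  invariant_measures T mu ->
  (forall i, continuity_set mu (p @^-1` [set i])) ->
  continuity_set mu (itinerary T p n @^-1` [set w]).
Proof.
move=> iT cp; case: n w => [|n] w.
  rewrite (_ : _ @^-1` _ = setT); first exact: continuity_setT.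
  by apply/seteqP; split => // x _; apply/ffunP => -[].
rewrite (_ : _ @^-1` _ =
    [set x | forall i, (i < n.+1)%N -> (iter i T @^-1` (p @^-1` [set w (inord i)])) x]).
  apply: continuity_set_bigcap => i; elim: i (w _) => [|i ih] v; first exact: cp.
  have -> : iter i.+1 T @^-1` (p @^-1` [set v]) = T @^-1` (iter i T @^-1` (p @^-1` [set v])).
    by apply/seteqP; split => x; rewrite /preimage/= -iterSr.
  by apply: (@continuity_set_preimage _ _ mu T) => //; exact: ih.
apply/seteqP; split => [x /= <- i ilt|x H].
  by rewrite /preimage/= ffunE inordK.
apply/ffunP => i; rewrite ffunE; have := H i (ltn_ord i).
by rewrite /preimage/= inord_val.
Qed.

(** Convexity, tested on integrals because this is the form in which the barycentre is given by
    [misiurewicz_estimate]. *)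
Let barycenter_stable (U : set (M1 X)) : Prop :=
  forall n (w : nat -> R) (rho : nat -> M1 X) mu,
    (forall i, 0 <= w i) -> \sum_(i < n) w i = 1 ->
    (forall i, (i < n)%N -> U (rho i)) ->
    (forall f : X -> R, continuous f ->
      \int[mu]_x f x = \sum_(i < n) w i * \int[rho i]_x f x) -> U mu.

(** The difference of the two Birkhoff sums telescopes to its two end terms. *)
Let empirical_almost_invariant (f : X -> R) M m x : continuous f ->
  (forall y, `|f y| <= M) -> (0 < m)%N ->
  `|\int[empirical T m x]_y f (T y) - \int[empirical T m x]_y f y| <=
    m%:R^-1 * (2 * M).
Proof.
move=> cf fM m0; have cfT : continuous (f \o T).
  by move=> y; apply: continuous_comp; [exact: T_continuous|exact: cf].
rewrite (integral_empirical _ _ _ cfT)// integral_empirical// -mulrBr.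
rewrite normrM ger0_norm ?invr_ge0//; apply: ler_wpM2l; first by rewrite invr_ge0.
rewrite -sumrB (_ : \sum_(k < m) _ = f (iter m T x) - f x).
  by rewrite (le_trans (ler_normB _ _))// mulr_natl mulr2n lerD.
elim: m {m0} => [|m ih]; first by rewrite big_ord0 subrr.
by rewrite big_ord_recr/= ih addrC addrA subrK.
Qed.

(** The scale [e] comes from the Gibbs bound alone and is common to all [j]. The measures are only
    nearly invariant, with defect of order [1 / m], so everything the passage to the limit needs is
    recorded here at finite [m]. *)
Let approximate (U : set (M1 X)) (a d : R) : 0 < d ->
  closed U -> barycenter_stable U ->
  (forall N, exists2 m, (N <= m)%N &
    expR (m%:R * a) < fine (nu [set x | U (empirical T m x)])) ->
  exists2 e, 0 < e & forall j, exists m mu,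
  [/\ (j <= m)%N && (0 < m)%N, U mu,
    forall (f : X -> R) M, continuous f -> (forall y, `|f y| <= M) ->
      `|\int[mu]_y f (T y) - \int[mu]_y f y| <= m%:R^-1 * (2 * M) &
    forall k (p : borel X -> 'I_k) n, fin_measurable p ->
      (forall x y, p x = p y -> mdist x y <= e) -> (0 < n)%N ->
      a - d <= n%:R^-1 * rv_entropy mu (itinerary T p n) +
        m%:R^-1 * (2 * n%:R * ln k%:R) + \int[mu]_x phi x].
Proof.
move=> d0 cU bU freq.
have [e e0 He] := gibbs_bounds X_compact T_continuous phi_continuous nu_gibbs d0.
exists e => // j; have [N HN] := He e e0 (lexx _).
have [m Nm ma] := freq (maxn j N).+1.
have jm : (j <= m)%N by rewrite (leq_trans _ Nm)// ltnW// ltnS leq_maxl.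
have NNm : (N <= m)%N by rewrite (leq_trans _ Nm)// ltnW// ltnS leq_maxr.
have m0 : (0 < m)%N by exact: leq_trans Nm.
have m0' : 0 < m%:R :> R by rewrite ltr0n.
pose D := [set x | U (empirical T m x)].
have [s [ss sD Dcov]] := exists_maximal_separated X_compact T_continuous m D e0.
pose S x := \sum_(k < m) phi (iter k T x).
pose Z := \sum_(i < size s) expR (S (nth point s i)).
have ZE : Z = \sum_(x <- s) expR (S x) by rewrite (big_nth point) big_mkord.
have DZ : fine (nu D) <= Z * expR (m%:R * d).
  rewrite ZE mulr_suml.
  apply: (@le_trans _ _ (\sum_(x <- s) fine (nu (dynamical_ball T m x e)))).
    apply: M1_le_sum => //.
    - by apply: closed_borel; exact: closed_empirical.
    - by move=> x; apply: closed_borel; exact: closed_dynamical_ball.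
  by apply: ler_sum => x _; rewrite -expRD; case/andP: (HN m NNm m0 x).
have ZD : expR (m%:R * a) < Z * expR (m%:R * d) by exact: lt_le_trans DZ.
have Z0 : 0 < Z.
  by rewrite -(pmulr_lgt0 _ (expR_gt0 (m%:R * d))) (lt_trans _ ZD)// expR_gt0.
have s0 : (0 < size s)%N.
  by rewrite lt0n; apply/eqP => s0; move: Z0; rewrite /Z s0 big_ord0 ltxx.
have aZ : a - d <= m%:R^-1 * ln Z.
  rewrite ler_pdivlMl// mulrBr lerBlDr -ler_expR expRD lnK ?posrE//.
  exact: ltW.
have [mu [w [w0 w1 muE H]]] := misiurewicz_estimate X_compact T_continuous
  phi_continuous m0 ss s0.
exists m, mu; split; first by rewrite jm.
- apply: (bU (size s) w (fun i => empirical T m (nth point s i))) => //.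
  by move=> i si; apply: sD; exact: mem_nth.
- move=> f M cf fM; have cfT : continuous (f \o T).
    by move=> y; apply: continuous_comp; [exact: T_continuous|exact: cf].
  rewrite (muE _ cfT) muE// -sumrB (le_trans (ler_norm_sum _ _ _))//.
  set C := m%:R^-1 * (2 * M).
  have -> : C = \sum_(i < size s) w i * C by rewrite -mulr_suml w1 mul1r.
  apply: ler_sum => i _.
  rewrite -mulrBr normrM (ger0_norm (w0 i)); apply: ler_wpM2l => //.
  exact: empirical_almost_invariant.
- move=> k p n mp pe n0; apply: (le_trans aZ); exact: H.
Qed.

(** As [e] does not depend on [j], a partition finer than [e] whose boundaries are null for the
    limit point [mu] can be chosen once [mu] is known. For each fixed [n] its [n]-word entropies
    pass to the limit, while the errors of order [1 / m] vanish. *)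
Lemma upper_local (U : set (M1 X)) (a d : R) : 0 < d ->
  closed U -> barycenter_stable U ->
  (forall N, exists2 m, (N <= m)%N &
    expR (m%:R * a) < fine (nu [set x | U (empirical T m x)])) ->
  exists mu, [/\ U mu, invariant_measures T mu &
    ((a - d)%:E <= entropy T mu + (\int[mu]_x phi x)%:E)%E].
Proof.
(* Four losses of [d / 4]: in the approximation, in the [n]-word entropy, in the boundary term of
   the block inequality and in the integral of [phi]. *)
move=> d0 cU bU freq; have d40 : 0 < d / 4 by rewrite divr_gt0.
have [e e0 /choice[m /choice[rho Hrho]]] := approximate d40 cU bU freq.
have jm j : (j <= m j)%N by case: (Hrho j) => /andP[].
have m0 j : (0 < m j)%N by case: (Hrho j) => /andP[].
have cM : compact [set: M1 X] by exact: M1_compact.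
have [mu [_ mucl]] := cM (rho @ \oo) _ filterT.
(* A cluster point suffices: finitely many neighbourhood conditions hold together at some [j] beyond
   any given bound. *)
have near_rho V : nbhs mu V -> forall N, exists2 j, (N <= j)%N & V (rho j).
  move=> Vmu N; have [|y [[j /= Nj <-] Vy]] := mucl (rho @` [set j | (N <= j)%N]) V _ Vmu.
    by exists N => // j Nj; exists j.
  by exists j.
have large (c : R) t : 0 < t -> exists N, forall j, (N <= j)%N -> (m j)%:R^-1 * c <= t.
  move=> t0; exists (Num.bound (`|c| / t)) => j Nj.
  have mj0 : 0 < (m j)%:R :> R by rewrite ltr0n.
  rewrite ler_pdivrMl// -ler_pdivrMr// (@le_trans _ _ (`|c| / t))//.
    by rewrite ler_pM2r ?invr_gt0// ler_norm.
  rewrite (le_trans (ltW (archi_boundP _)))//; first by rewrite divr_ge0// ltW.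
  by rewrite ler_nat (leq_trans Nj).
have Umu : U mu.
  apply: cU => V Vmu; have [j _ Vj] := near_rho V Vmu 0%N.
  by exists (rho j); split => //; case: (Hrho j).
have imu : invariant_measures T mu.
  apply: invariant_of_integrals => // f cf.
  have cfT : continuous (fun x => f (T x)).
    by move=> y; apply: continuous_comp; [exact: T_continuous|exact: cf].
  have [M M0 fM] := compact_continuous_bounded X_compact cf.
  apply/eqP; rewrite -subr_eq0 -normr_le0; apply/ler_addgt0Pr => t t0.
  rewrite add0r; have t20 : 0 < t / 3 by rewrite divr_gt0.
  have [N HN] := large (2 * M) _ t20.
  have := @M1_integral_continuous R X _ cf mu.
  move=> /cvgrPdist_lt/(_ _ t20) c1.
  have := @M1_integral_continuous R X _ cfT mu.
  move=> /cvgrPdist_lt/(_ _ t20) c2.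
  have [j Nj [/= h1 h2]] := near_rho _ (filterI c1 c2) N.
  have [_ _ /(_ f M cf fM) h3 _] := Hrho j; have h4 := HN j Nj.
  move: h1 h2 h3 h4; rewrite ltr_norml => /andP[? ?].
  rewrite ltr_norml => /andP[? ?].
  by rewrite !ler_norml => /andP[? ?] ?; apply/andP; split; lra.
exists mu; split => //.
rewrite -leeBlDr// -EFinB.
have [k [p [cp pe]]] := exists_small_partition X_compact mu e0.
have mp : fin_measurable p by move=> i; case: (cp i).
apply: (@ge_entropy _ _ _ T_continuous _ _ p) => // n n0.
have n0' : 0 < n%:R :> R by rewrite ltr0n.
have nd0 : 0 < n%:R * (d / 4) by rewrite mulr_gt0.
have c1 := near_rv_entropy X_compact
  (fun w => @continuity_set_itinerary mu k p n w imu cp) nd0.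
have := @M1_integral_continuous R X _ phi_continuous mu.
move=> /cvgrPdist_lt/(_ _ d40) c2.
have [N HN] := large (2 * n%:R * ln k%:R) _ d40.
have [j Nj [/= h1 h2]] := near_rho _ (filterI c1 c2) N.
have [_ _ _ /(_ k p n mp pe n0) h3] := Hrho j; have h4 := HN j Nj.
have h1' : n%:R^-1 * rv_entropy (rho j) (itinerary T p n) <=
    n%:R^-1 * rv_entropy mu (itinerary T p n) + d / 4.
  rewrite ler_pdivrMl// mulrDr mulVKf ?gt_eqF//; exact: ltW.
by move: h2 h3 h4 h1'; rewrite ltr_norml => /andP[? ?]; lra.
Qed.

End upper_local.

(** * Local rates and the covering of a closed set *)

Section upper_bound.
Context {R : realType} {X : pmetricType R}.
Hypothesis X_compact : compact [set: X].
Variables (T : X -> X) (phi : X -> R) (nu : M1 X).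
Hypotheses (T_continuous : continuous T) (phi_continuous : continuous phi).
Hypothesis nu_gibbs : weak_gibbs T phi nu.
Implicit Types (mu : M1 X).

Lemma integral_of_invariant mu (f : X -> R) : invariant_measures T mu ->
  continuous f -> \int[mu]_x f (T x) = \int[mu]_x f x.
Proof.
move=> iT cf.
have cfT : continuous (f \o T).
  by move=> y; apply: continuous_comp; [exact: T_continuous|exact: cf].
pose T' : {mfun borel X >-> borel X} := HB.pack (T : borel X -> borel X)
  (isMeasurableFun.Build _ _ _ _ _ (continuous_borel_map T_continuous)).
have E := @integral_distribution _ _ _ _ _ mu T' (EFin \o f).
rewrite /Rintegral; congr fine; rewrite -[LHS]E.
- by apply: eq_measure_integral => A mA _; exact: iT.
- by apply/measurable_EFinP; exact: continuous_borel_fun.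
- exact: (continuous_integrable X_compact mu cfT).
Qed.

(** Finitely many continuous affine functionals with weak inequalities give a neighbourhood that is
    closed and convex. *)
Definition M1_cball mu (s : seq (X -> R)) (r : R) : set (M1 X) :=
  [set m : M1 X | forall f : X -> R, f \in s ->
    `|\int[m]_x f x - \int[mu]_x f x| <= r].

Lemma closed_M1_cball mu s r : (forall f, f \in s -> continuous f) ->
  closed (M1_cball mu s r).
Proof.
move=> cs; rewrite (_ : M1_cball mu s r = \bigcap_(f in [set f | f \in s])
    [set m : M1 X | `|\int[m]_x f x - \int[mu]_x f x| <= r])//.
apply: closed_bigI => f fs; apply: closed_sublevel => m.
apply: (@continuous_comp _ _ _ (fun m : M1 X => \int[m]_x f x - \int[mu]_x f x) Num.norm).
  apply: (@continuousB _ _ _ (fun m : M1 X => \int[m]_x f x) (fun=> \int[mu]_x f x)).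
    exact: (@M1_integral_continuous R X f (cs f fs) m).
  exact: cst_continuous.
exact: norm_continuous.
Qed.

Lemma nbhs_M1_cball mu s r : (forall f, f \in s -> continuous f) -> 0 < r ->
  nbhs mu (M1_cball mu s r).
Proof.
elim: s => [|f s ih] cs r0; first by apply: filterE => m g.
have H1 := ih (fun g gs => cs g (mem_behead (gs : g \in behead (f :: s)))) r0.
have := @M1_integral_continuous R X f (cs f (mem_head _ _)) mu.
move=> /cvgrPdist_le/(_ _ r0) H2.
apply: filterS (filterI H1 H2) => m [h1 h2] g; rewrite inE => /predU1P[->|/h1//].
by rewrite distrC.
Qed.

Lemma M1_cball_convex mu s r n (w : nat -> R) (rho : nat -> M1 X) (m : M1 X) :
  (forall f, f \in s -> continuous f) ->
  (forall i, 0 <= w i) -> \sum_(i < n) w i = 1 ->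
  (forall i, (i < n)%N -> M1_cball mu s r (rho i)) ->
  (forall f : X -> R, continuous f ->
    \int[m]_x f x = \sum_(i < n) w i * \int[rho i]_x f x) ->
  M1_cball mu s r m.
Proof.
move=> cs w0 w1 rhoU mE f fs; rewrite mE; last exact: cs.
have E (c : R) : c = \sum_(i < n) w i * c by rewrite -mulr_suml w1 mul1r.
rewrite [\int[mu]_x f x]E -sumrB (le_trans (ler_norm_sum _ _ _))// [leRHS]E.
apply: ler_sum => i _; rewrite -mulrBr normrM (ger0_norm (w0 i)).
by apply: ler_wpM2l => //; exact: rhoU.
Qed.

Hypothesis entropy_usc : upper_semicontinuous_on (invariant_measures T) (entropy T).

(** At an invariant [mu] this combines upper semicontinuity of the entropy with continuity of the
    integral of [phi]. At any other [mu], some [f] has different integrals before and after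
    composition with [T], and a small ball tested on both functions contains no invariant measure at
    all. *)
Let free_energy_gap mu (a : R) :
  (invariant_measures T mu -> (entropy T mu + (\int[mu]_x phi x)%:E < a%:E)%E) ->
  exists s r d, [/\ forall f, f \in s -> continuous f, 0 < r, 0 < d &
    forall m, M1_cball mu s r m -> invariant_measures T m ->
      (entropy T m + (\int[m]_x phi x)%:E < (a - d)%:E)%E].
Proof.
set I := \int[mu]_x phi x => mua.
have [iT|niT] := pselect (invariant_measures T mu).
  have [d d0 hd] : exists2 d, 0 < d & (entropy T mu < (a - I - 3 * d)%:E)%E.
    have := mua iT; case: (entropy T mu) => [h||] //.
      rewrite -EFinD lte_fin => hIa; exists ((a - I - h) / 4); first lra.
      by rewrite lte_fin; lra.
    by exists 1 => //; exact: ltNyr.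
  have /nbhs_M1_basic[s [r [r0 cs sr]]] := entropy_usc iT hd.
  exists (phi :: s), (Num.min (r / 2) d), d; split => //.
  - by move=> f; rewrite inE => /predU1P[->//|/cs].
  - by rewrite lt_min d0 divr_gt0.
  move=> m mU im.
  have : (entropy T m < (a - I - 3 * d)%:E)%E.
    apply: sr => // f fs; have := mU f; rewrite inE fs orbT => /(_ isT).
    rewrite le_min => /andP[+ _]; move=> /le_lt_trans; apply.
    by rewrite ltr_pdivrMr// ltr_pMr// ltr1n.
  have := mU phi (mem_head _ _); rewrite le_min -/I => /andP[_].
  rewrite ler_norml => /andP[_ h].
  case: (entropy T m) => [e||]//.
    by rewrite !lte_fin; lra.
  by move=> _; rewrite addNye ltNyr.
have [f [cf fT]] : exists f : X -> R, continuous f /\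
    \int[mu]_x f (T x) != \int[mu]_x f x.
  apply: contrapT => H; apply: niT; apply: invariant_of_integrals => // f cf.
  by apply/eqP; apply: contrapT => /negP fT; apply: H; exists f.
have cfT : continuous (fun x => f (T x)).
  by move=> y; apply: continuous_comp; [exact: T_continuous|exact: cf].
pose g := `|\int[mu]_x f (T x) - \int[mu]_x f x|.
have g0 : 0 < g by rewrite normr_gt0 subr_eq0.
exists [:: (fun x => f (T x)); f], (g / 3), 1; split => //.
- by move=> h; rewrite !inE => /orP[|] /eqP ->.
- by rewrite divr_gt0.
move=> m mU im; exfalso.
have := mU (fun x => f (T x)) (mem_head _ _); have := mU f.
rewrite !inE eqxx orbT => /(_ isT); rewrite (integral_of_invariant im cf).
have : g <= `|\int[m]_x f x - \int[mu]_x f (T x)| + `|\int[m]_x f x - \int[mu]_x f x|.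
  rewrite addrC /g; have -> : \int[mu]_x f (T x) - \int[mu]_x f x =
      (\int[m]_x f x - \int[mu]_x f x) - (\int[m]_x f x - \int[mu]_x f (T x)).
    by ring.
  exact: ler_normB.
by move: g0; lra.
Qed.

(** Otherwise the reverse inequality holds for arbitrarily large [m], and [upper_local] yields an
    invariant measure in the ball with free energy at least [a - d], which [free_energy_gap]
    forbids. *)
Let local_rate mu (a : R) :
  (invariant_measures T mu -> (entropy T mu + (\int[mu]_x phi x)%:E < a%:E)%E) ->
  exists U : set (M1 X), [/\ nbhs mu U, closed U &
    exists N, forall m, (N <= m)%N ->
      fine (nu [set x | U (empirical T m x)]) <= expR (m%:R * a)].
Proof.
move=> /free_energy_gap[s [r [d [cs r0 d0 H]]]].
exists (M1_cball mu s r); split; [exact: nbhs_M1_cball|exact: closed_M1_cball|].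
apply: contrapT => nN.
have [||N|m [mU im /le_lt_trans/(_ (H _ mU im))]] := @upper_local R X X_compact
  T phi nu T_continuous phi_continuous nu_gibbs (M1_cball mu s r) a d d0.
- exact: closed_M1_cball.
- by move=> n w rho m w0 w1 rhoU mE; exact: (M1_cball_convex cs w0 w1 rhoU mE).
- apply: contrapT => H'; apply: nN; exists N => m Nm; rewrite leNgt.
  by apply/negP => ma; apply: H'; exists m.
by rewrite ltxx.
Qed.

Lemma ldp_upper (F : set (M1 X)) : closed F ->
  (limn_esup (fun m => (m%:R^-1)%:E * lne (nu [set x | F (empirical T m x)]))
    <= ereal_sup [set entropy T rho + (\int[rho]_x phi x)%:E
                 | rho in F `&` invariant_measures T])%E.
Proof.
move=> cF; apply: lee_real_above => a ca.
(* The room between [a'] and [a] will absorb the number of covering sets. *)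
have [a' [ca' a'a]] : exists a' : R,
    (ereal_sup [set entropy T rho + (\int[rho]_x phi x)%:E
                 | rho in F `&` invariant_measures T] < a'%:E)%E /\ a' < a.
  move: ca; case: (ereal_sup _) => [c||]//.
    by rewrite lte_fin => ca; exists ((c + a) / 2); rewrite lte_fin; lra.
  by move=> _; exists (a - 1); rewrite ltNyr; split => //; lra.
have rate rho : F rho -> exists U : set (M1 X), [/\ nbhs rho U, closed U &
    exists N, forall m, (N <= m)%N ->
      fine (nu [set x | U (empirical T m x)]) <= expR (m%:R * a')].
  move=> Frho; apply: local_rate => irho; apply: le_lt_trans ca'.
  by apply: ereal_sup_ubound; exists rho.
have /choice[U HU] : forall rho, exists U : set (M1 X), F rho ->
    [/\ nbhs rho U, closed U & exists N, forall m, (N <= m)%N ->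
      fine (nu [set x | U (empirical T m x)]) <= expR (m%:R * a')].
  move=> rho; have [Frho|] := pselect (F rho); last by exists setT.
  by have [U ?] := rate rho Frho; exists U.
pose M1p : ptopologicalType := HB.pack (M1 X)
  (isPointed.Build (M1 X) (\d_(point : borel X) : probability (borel X) R)).
have cptF : @compact M1p F.
  by apply: (@subclosed_compact _ _ [set: M1 X]) => //; exact: M1_compact.
rewrite compact_cover in cptF.
have [||D DF Dcov] := cptF (M1 X) F (fun rho => (U rho)^°).
- by move=> rho _; exact: open_interior.
- by move=> rho Frho; exists rho => //; case: (HU rho Frho).
pose s := finmap.enum_fset D.
have sF rho : rho \in s -> F rho by move=> /DF; rewrite inE.
have /choice[N HN] : forall rho, exists N, rho \in s -> forall m, (N <= m)%N ->
    fine (nu [set x | U rho (empirical T m x)]) <= expR (m%:R * a').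
  move=> rho; have [/sF/HU[_ _ [N ?]]|] := boolP (rho \in s); last by exists 0%N.
  by exists N.
pose N0 := (\max_(rho <- s) N rho)%N.
(* From [K] on, [ln (size s).+1%:R <= m%:R * (a - a')]; the successor also ensures [0 < m]. *)
pose K := (Num.bound (ln (size s).+1%:R / (a - a'))).+1.
apply: limn_esup_le_near; exists (maxn N0 K) => // m /=.
rewrite geq_max => /andP[N0m Km].
have m0 : (0 < m)%N by exact: leq_trans Km.
have m0' : 0 < m%:R :> R by rewrite ltr0n.
have mF : measurable ([set x | F (empirical T m x)] : set (borel X)).
  by apply: closed_borel; exact: closed_empirical.
have vle : fine (nu [set x | F (empirical T m x)]) <= expR (m%:R * a).
  (* [M1_le_sum] wants measurability at every index, whereas [U rho] is known to be closed only for
     [rho] in [s]. *)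
  pose U' rho := if rho \in s then U rho else set0.
  have cU' rho : closed (U' rho).
    rewrite /U'; case: ifPn => [/sF/HU[]//|_]; exact: closed0.
  apply: (@le_trans _ _ (\sum_(rho <- s) fine (nu [set x | U' rho (empirical T m x)]))).
    apply: M1_le_sum => //.
      by move=> rho; apply: closed_borel; exact: closed_empirical.
    move=> x Fx; have [rho /= rhoD Urho] := Dcov _ Fx.
    by exists rho => //; rewrite /U' rhoD; exact: interior_subset.
  apply: (@le_trans _ _ (\sum_(rho <- s) expR (m%:R * a'))).
    rewrite big_seq [leRHS]big_seq; apply: ler_sum => rho rhos.
    rewrite /U' rhos; apply: HN => //; apply: leq_trans N0m.
    exact: leq_bigmax_seq.
  rewrite big_const_seq count_predT iter_addr_0 -[_ *+ size s]mulr_natl.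
  apply: (@le_trans _ _ ((size s).+1%:R * expR (m%:R * a'))).
    by rewrite ler_pM2r ?expR_gt0// ler_nat.
  rewrite -[(size s).+1%:R]lnK ?posrE ?ltr0n// -expRD ler_expR -lerBrDr -mulrBr.
  rewrite -ler_pdivrMr ?subr_gt0// (le_trans (ltW (archi_boundP _)))//.
    by rewrite divr_ge0 ?ln_ge0 ?ler1n// subr_ge0 ltW.
  by rewrite ler_nat ltnW.
rewrite -(fineK (M1_fin nu mF)).
have := fine_ge0 (measure_ge0 nu [set x | F (empirical T m x)]).
rewrite le_eqVlt => /predU1P[<-|v0].
  by rewrite le0_lneNy// mulrNy gtr0_sg ?invr_gt0// mul1e leNye.
rewrite lne_EFin// -EFinM lee_fin ler_pdivrMl// -ler_expR lnK ?posrE//.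
Qed.

End upper_bound.

(** * Ergodic theorem in probability *)

Section ergodic_theorem.
Context {R : realType} {X : pmetricType R}.
Hypothesis X_compact : compact [set: X].
Variable T : X -> X.
Hypothesis T_continuous : continuous T.
Implicit Types (mu : M1 X) (g : X -> R).

(** This is [max(0, S_1, ..., S_n)] for the Birkhoff sums [S_k] of [g], in the recursive form that
    Garsia's argument exploits. *)
Fixpoint running_max g (n : nat) (x : X) : R :=
  if n is k.+1 then Num.max 0 (g x + running_max g k (T x)) else 0.

Lemma running_max_continuous g n : continuous g -> continuous (running_max g n).
Proof.
move=> cg; elim: n => [|n ih] x /=; first exact: cvg_cst.
apply: (@continuous_max _ _ (fun=> 0) (fun x => g x + running_max g n (T x))).
  exact: cvg_cst.
apply: cvgD; first exact: cg.
by apply: (@continuous_comp _ _ _ T (running_max g n)); [exact: T_continuous|exact: ih].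
Qed.

Lemma running_max_ge0 g n x : 0 <= running_max g n x.
Proof. by case: n => [|n] //=; rewrite le_max lexx. Qed.

Lemma running_max_homo g m n x : (m <= n)%N -> running_max g m x <= running_max g n x.
Proof.
have step k y : running_max g k y <= running_max g k.+1 y.
  elim: k y => [|k ih] y; first exact: running_max_ge0.
  by rewrite /= ge_max !le_max lexx/= lerD2l ih orbT.
move=> /subnK <-; elim: (n - m)%N => // k ih.
by rewrite addSn (le_trans ih).
Qed.

Lemma birkhoff_sum_le_running_max g n x :
  \sum_(k < n) g (iter k T x) <= running_max g n x.
Proof.
elim: n x => [|n ih] x; first by rewrite big_ord0.
rewrite big_ord_recl/= le_max; apply/orP; right; rewrite lerD2l.
rewrite (eq_bigr (fun i : 'I_n => g (iter i T (T x)))); first exact: ih.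
by move=> i _; rewrite -iterS iterSr.
Qed.

(* Garsia's argument: where [running_max g n] is positive it is at most
   [g + running_max g n \o T]; integrate and use invariance. *)
Lemma maximal_ergodic mu g : invariant_measures T mu -> continuous g ->
  mu (\bigcup_n [set x | 0 < running_max g n x]) = 1%E -> 0 <= \int[mu]_x g x.
Proof.
move=> iT cg mu1.
have [C C0 gC] := compact_continuous_bounded X_compact cg.
pose E n := [set x | 0 < running_max g n x] : set (borel X).
have cM n : continuous (running_max g n) by exact: running_max_continuous.
have mE n : measurable (E n) by apply: open_borel; exact: open_superlevel.
have cMT n : continuous (fun x => running_max g n (T x)).
  move=> x; apply: (@continuous_comp _ _ _ T (running_max g n)).
    exact: T_continuous.
  exact: cM.
have key n : - C * (1 - fine (mu (E n))) <= \int[mu]_x g x.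
  have -> : 1 - fine (mu (E n)) = fine (mu (~` E n)).
    have -> : mu (~` E n) = (1 - mu (E n))%E by exact: (@probability_setC _ _ _ mu).
    by rewrite fineB// M1_fin.
  have cgM : continuous (fun x => g x - running_max g n x).
    by move=> x; apply: cvgB; [exact: cg|exact: cM].
  (* Invariance permits the added difference. The new integrand is nonnegative on [E n], and at
     least [- C] elsewhere, where [running_max g n] vanishes. *)
  have -> : \int[mu]_x g x =
      \int[mu]_x (g x - running_max g n x + running_max g n (T x)).
    rewrite cintD// cintB// (integral_of_invariant X_compact T_continuous iT)//.
    by rewrite subrK.
  apply: measure_le_cint => //.
  - by move=> x; apply: cvgD; [exact: cgM|exact: cMT].
  - exact: measurableC.
  move=> x; rewrite indicE; have [Ex|nEx] := pselect (E n x).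
    rewrite memNset; last by move=> /(_ Ex).
    rewrite mulr0 addrAC subr_ge0.
    case: n Ex {cgM} => [|n]; first by rewrite /E/= ltxx.
    rewrite {1}/E/= lt_max ltxx/= => Ex.
    apply: (@le_trans _ _ (g x + running_max g n (T x))).
      by rewrite /= ge_max lexx (ltW Ex).
    by rewrite lerD2l; exact: running_max_homo (leqnSn n).
  rewrite mem_set// mulr1.
  have -> : running_max g n x = 0.
    by apply/eqP; rewrite eq_le running_max_ge0 andbT leNgt; apply/negP.
  rewrite subr0; have := gC x; rewrite ler_norml => /andP[? _].
  by have := running_max_ge0 g n (T x); lra.
have : fine \o (mu \o E) @ \oo --> (1 : R).
  apply: fine_cvg; rewrite -mu1.
  apply: (@nondecreasing_cvg_mu _ _ _ mu) => //; first exact: bigcupT_measurable.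
  move=> m n mn; apply/subsetPset => x /= /lt_le_trans; apply.
  exact: running_max_homo.
move=> /cvgrPdist_lt H; apply/ler_addgt0Pr => e e0.
have eC : 0 < e / C by rewrite divr_gt0.
have [N _ /(_ N (leqnn N)) HN] := H _ eC.
have := key N; move: HN; rewrite /= ltr_norml => /andP[_].
rewrite ltr_pdivlMr// mulrC mulNr; lra.
Qed.

(** The function [g] has negative mean, so by the maximal inequality its sums cannot be unbounded
    above almost everywhere; by ergodicity they are bounded above almost everywhere. Off a small set
    they stay below some [K], whereas an excess of [eta] in the average of [f] makes them exceed
    [n * (eta / 2)]. *)
Lemma birkhoff_upper_in_probability mu (f : X -> R) (eta e : R) :
  ergodic T mu -> continuous f -> 0 < eta -> 0 < e ->
  exists N, forall n, (N <= n)%N -> fine (mu [set x |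
    n%:R * (\int[mu]_x f x + eta) < \sum_(k < n) f (iter k T x)]) < e.
Proof.
move=> [iT erg] cf eta0 e0.
pose c := \int[mu]_x f x + eta / 2.
pose g x := f x - c.
have cg : continuous g by move=> x; apply: cvgB; [exact: cf|exact: cvg_cst].
have [C C0 gC] := compact_continuous_bounded X_compact cg.
pose S n x := \sum_(k < n) g (iter k T x).
have cS n : continuous (S n) by exact: birkhoff_sum_continuous.
have Srec n x : S n.+1 x = g x + S n (T x).
  rewrite /S big_ord_recl/=; congr (_ + _); apply: eq_bigr => i _.
  by rewrite -iterS iterSr.
pose B (K : nat) := \bigcup_n [set x | K%:R < S n x] : set (borel X).
have mB K : measurable (B K).
  by apply: bigcupT_measurable => n; apply: open_borel; exact: open_superlevel.
(* [A] is the set where the sums [S n] are unbounded; it is strictly invariant,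
   as the definition of [ergodic] requires. *)
pose A := \bigcap_K B K.
have mA : measurable A by exact: bigcapT_measurable.
(* Passing between [x] and [T x] changes a sum by one value of [g], at most [C] in size, so the
   level is raised by a bound of [C] beforehand. *)
have TA : T @^-1` A = A.
  apply/seteqP; split => x Ax K _.
    have [n _ /= h] := Ax (K + Num.bound C)%N I; exists n.+1 => //=.
    rewrite Srec; have := gC x; rewrite ler_norml => /andP[gx _].
    have := archi_boundP (ltW C0); move: h; rewrite natrD; lra.
  have [[|n] _ /=] := Ax (K + Num.bound C)%N I.
    by rewrite /S big_ord0 ltNge ler0n.
  rewrite Srec natrD => h; exists n => //=.
  have := gC x; rewrite ler_norml => /andP[_ gx].
  by have := archi_boundP (ltW C0); move: h; lra.
have muA : mu A = 0%E.
  case: (erg A mA TA) => // muA1; exfalso.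
  have : 0 <= \int[mu]_x g x.
    apply: maximal_ergodic => //; apply/eqP; rewrite eq_le; apply/andP; split.
      apply: (@probability_le1 _ _ _ mu); apply: bigcupT_measurable => n.
      by apply: open_borel; apply: open_superlevel; exact: running_max_continuous.
    rewrite -muA1; apply: (@le_measure _ _ _ mu); rewrite ?inE//.
      apply: bigcupT_measurable => n; apply: open_borel; apply: open_superlevel.
      exact: running_max_continuous.
    move=> x Ax; have [n _ /= h] := Ax 0%N I; exists n => //=.
    by rewrite (lt_le_trans h)// birkhoff_sum_le_running_max.
  have cc : continuous (fun _ : X => c) by move=> x; exact: cvg_cst.
  by rewrite (cintB X_compact mu cf cc) cint_cst /c; lra.
have : fine \o (mu \o B) @ \oo --> (0 : R).
  apply: fine_cvg; have -> : (0 : R)%:E = mu A by rewrite muA.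
  apply: (@nonincreasing_cvg_mu _ _ _ mu) => //.
    by rewrite -ge0_fin_numE// M1_fin.
  move=> m n mn; apply/subsetPset => x [i _ /= h]; exists i => //=.
  by rewrite (le_lt_trans _ h)// ler_nat.
move=> /cvgrPdist_lt/(_ _ e0)[K _ /(_ K (leqnn K))].
rewrite /= sub0r normrN ger0_norm ?fine_ge0// => BK.
exists (Num.bound (K%:R / (eta / 2))) => n Kn; apply: le_lt_trans BK.
apply: le_M1 => //.
  by apply: open_borel; apply: open_superlevel; exact: birkhoff_sum_continuous.
move=> x /= h; exists n => //=.
rewrite /S sumrB sumr_const card_ord -[_ *+ n]mulr_natl.
have : K%:R <= n%:R * (eta / 2).
  rewrite -ler_pdivrMr ?divr_gt0// (le_trans (ltW (archi_boundP _)))//.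
    by rewrite divr_ge0// divr_ge0// ltW.
  by rewrite ler_nat.
by move: h; rewrite /c !mulrDr; lra.
Qed.

Lemma birkhoff_in_probability mu (f : X -> R) (eta e : R) :
  ergodic T mu -> continuous f -> 0 < eta -> 0 < e ->
  exists N, forall n, (N <= n)%N -> (0 < n)%N ->
    fine (mu [set x | eta <
      `|n%:R^-1 * \sum_(k < n) f (iter k T x) - \int[mu]_x f x|]) < e.
Proof.
move=> erg cf eta0 e0; have e20 : 0 < e / 2 by rewrite divr_gt0.
have [N1 H1] := birkhoff_upper_in_probability erg cf eta0 e20.
have cNf : continuous (fun x => - f x) by move=> x; apply: cvgN; exact: cf.
have [N2 H2] := birkhoff_upper_in_probability erg cNf eta0 e20.
exists (maxn N1 N2) => n; rewrite geq_max => /andP[n1 n2] n0.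
have n0' : 0 < n%:R :> R by rewrite ltr0n.
have {}H1 := H1 n n1; have {}H2 := H2 n n2.
have mS (g : X -> R) r : continuous g ->
    measurable ([set x | r < \sum_(k < n) g (iter k T x)] : set (borel X)).
  by move=> cg; apply: open_borel; apply: open_superlevel; exact: birkhoff_sum_continuous.
apply: (@le_lt_trans _ _ (\sum_(i <- [:: true; false]) fine (mu (if i then
    [set x | n%:R * (\int[mu]_x f x + eta) < \sum_(k < n) f (iter k T x)] else
    [set x | n%:R * (\int[mu]_x (- f x) + eta) < \sum_(k < n) (- f (iter k T x))])))).
  apply: (@M1_le_sum _ _ mu _ [:: true; false] _ (fun i => if i then _ else _)).
  - apply: open_borel; apply: open_superlevel => x.
    apply: (@continuous_comp _ _ _ (fun x => n%:R^-1 * \sum_(k < n) f (iter k T x)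
      - \int[mu]_x f x) Num.norm); last exact: norm_continuous.
    apply: cvgB; last exact: cvg_cst.
    by apply: cvgM; [exact: cvg_cst|exact: birkhoff_sum_continuous].
  - by case; [exact: (mS f _ cf)|exact: (mS _ _ cNf)].
  have -> : \int[mu]_x (- f x) = - \int[mu]_x f x.
    under eq_Rintegral do rewrite -mulN1r.
    by rewrite cintZ// mulN1r.
  move=> x /= h; set s := \sum_(k < n) _ in h.
  have [lt0|ge0] := ltP (n%:R^-1 * s - \int[mu]_x f x) 0.
    exists false => //=; rewrite ltr0_norm// in h.
    rewrite sumrN -/s.
    by rewrite -ltr_pdivlMl//; lra.
  exists true => //=; rewrite ger0_norm// in h.
  by rewrite -/s -ltr_pdivlMl//; lra.
by rewrite big_cons big_seq1; move: H1 H2; lra.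
Qed.

End ergodic_theorem.

(** * Lower bound *)

Section regularity.
Context {R : realType} {X : pmetricType R}.
Hypothesis X_compact : compact [set: X].
Implicit Types (mu : M1 X).

(** Approximation from both sides makes the condition symmetric under complements, so that the
    regular sets form a sigma-algebra. *)
Let regular mu (A : set (borel X)) : Prop := forall e, 0 < e ->
  exists F U, [/\ closed (F : set X), open (U : set X), F `<=` A, A `<=` U &
    fine (mu (U `\` F)) < e].

(** Off [F] the function [g] is below [e / 2], so [\int (g - e / 2) <= mu F], while [\int g] is
    within [e / 2] of [mu U]. *)
Let regular_open mu U : open (U : set X) -> regular mu U.
Proof.
move=> oU e e0; have e20 : 0 < e / 2 by rewrite divr_gt0.
have [g [cg g01 gU]] := open_approx X_compact mu oU e20.
pose F := [set x | e / 2 <= g x].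
have cF : closed F by exact: closed_superlevel.
have mF := closed_borel cF; have mU := open_borel oU.
have FU : F `<=` U.
  move=> x /= gx; apply: contrapT => nUx; have := g01 x.
  rewrite indicE memNset//= => /andP[_ /(le_trans gx)].
  by rewrite leNgt e20.
exists F, U; split => //.
have cc : continuous (fun _ : X => e / 2) by move=> x; exact: cvg_cst.
have : \int[mu]_x (g x - e / 2) <= 1 * fine (mu F).
  apply: cint_le_measure => //; first by move=> x; apply: cvgB; [exact: cg|exact: cvg_cst].
  move=> x; rewrite mul1r indicE; have := g01 x => /andP[_].
  have [Fx|nFx] := pselect (F x).
    rewrite mem_set// => gx; have : \1_U x <= 1 :> R by rewrite indicE lern1 leq_b1.
    by rewrite mulr1n; move: gx e20; lra.
  by rewrite memNset// => _; move: nFx => /negP; rewrite -ltNge /=; lra.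
rewrite cintB// cint_cst mul1r => H.
have -> : mu (U `\` F) = (mu U - mu F)%E.
  have -> : mu (U `\` F) = (mu U - mu (U `&` F))%E.
    by apply: (@measureD _ _ _ mu) => //; rewrite -ge0_fin_numE// M1_fin.
  by rewrite (_ : U `&` F = F)//; apply/setIidPr.
by rewrite fineB ?M1_fin//; move: gU H; lra.
Qed.

Let regularC mu A : regular mu A -> regular mu (~` A).
Proof.
move=> rA e /rA[F [U [cF oU FA AU FU]]].
exists (~` U), (~` F); split; [exact: open_closedC|exact: closed_openC| | |].
- exact: subsetC.
- exact: subsetC.
- by rewrite setDE setCK setIC -setDE.
Qed.

(** Geometrically decreasing errors make the two unions differ by at most [e / 4]. An infinite union
    of closed sets need not be closed, so only a finite part is kept, at a loss below [e / 2]. *)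
Let regular_bigcup mu (A : nat -> set (borel X)) :
  (forall n, regular mu (A n)) -> regular mu (\bigcup_n A n).
Proof.
move=> rA e e0; have e40 : 0 < e / 4 by rewrite divr_gt0.
have /choice[FU HFU] : forall n, exists FU : set X * set X,
    [/\ closed FU.1, open FU.2, FU.1 `<=` A n, A n `<=` FU.2 &
    fine (mu (FU.2 `\` FU.1)) < e / 4 / (2 ^ n.+1)%:R].
  move=> n; have [|F [U H]] := rA n (e / 4 / (2 ^ n.+1)%:R); last by exists (F, U).
  by rewrite divr_gt0// ltr0n expn_gt0.
pose F n : set (borel X) := (FU n).1; pose U n : set (borel X) := (FU n).2.
have cF n : closed (F n : set X) by case: (HFU n).
have oU n : open (U n : set X) by case: (HFU n).
have mF n : measurable (F n) by exact: closed_borel.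
have mU n : measurable (U n) by exact: open_borel.
pose FN N := \big[setU/set0]_(n < N) F n.
have cFN N : closed (FN N : set X).
  rewrite /FN -bigcup_mkord; apply: closed_bigcup => //; exact: finite_II.
have mFN N : measurable (FN N) by exact: closed_borel.
have FNE : \bigcup_n FN n = \bigcup_n F n.
  apply/seteqP; split => x.
    by move=> [n _]; rewrite /FN -bigcup_mkord => -[i _ Fi]; exists i.
  move=> [n _ Fn]; exists n.+1 => //; rewrite /FN -bigcup_mkord.
  by exists n => //=.
have mFF : measurable (\bigcup_n F n) by exact: bigcupT_measurable.
have mUU : measurable (\bigcup_n U n) by exact: bigcupT_measurable.
have lim_FN : fine \o (mu \o FN) @ \oo --> fine (mu (\bigcup_n F n)).
  apply: fine_cvg; rewrite fineK ?M1_fin// -FNE.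
  apply: (@nondecreasing_cvg_mu _ _ _ mu) => //; first by rewrite FNE.
  by move=> m n mn; apply/subsetPset; exact: subset_bigsetU.
have e20 : 0 < e / 2 by rewrite divr_gt0.
move/cvgrPdist_lt : lim_FN => /(_ _ e20)[N _ /(_ N (leqnn N)) HN].
exists (FN N), (\bigcup_n U n); split => //.
- exact: bigcup_open.
- rewrite /FN -bigcup_mkord => x [n _ Fx]; exists n => //.
  by case: (HFU n) => _ _ + _ _; apply.
- by move=> x [n _ Ax]; exists n => //; case: (HFU n) => _ _ _ + _; apply.
have h1 : fine (mu (\bigcup_n U n `\` \bigcup_n F n)) <= e / 4.
  rewrite -lee_fin fineK ?M1_fin//; last exact: measurableD.
  apply: (@le_trans _ _ (\sum_(n <oo) mu (U n `\` F n))%E).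
    apply: (@measure_sigma_subadditive _ _ _ mu) => //.
    - by move=> n; exact: measurableD.
    - exact: measurableD.
    - by move=> x [[n _ Un] nF]; exists n => //; split => // Fn; apply: nF; exists n.
  apply: (@le_trans _ _ (\sum_(n <oo) (e / 4 / (2 ^ n.+1)%:R)%:E)%E).
    apply: lee_nneseries => // n _; rewrite -[mu _]fineK ?lee_fin.
      by case: (HFU n) => _ _ _ _ /ltW.
    by rewrite M1_fin//; exact: measurableD.
  exact: epsilon_trick0 (ltW e40).
have h2 : fine (mu (\bigcup_n F n `\` FN N)) < e / 2.
  have FNF : FN N `<=` \bigcup_n F n.
    by rewrite /FN -bigcup_mkord => x [n _ Fx]; exists n.
  have -> : mu (\bigcup_n F n `\` FN N) = (mu (\bigcup_n F n) - mu (FN N))%E.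
    have -> : mu (\bigcup_n F n `\` FN N) =
        (mu (\bigcup_n F n) - mu (\bigcup_n F n `&` FN N))%E.
      by apply: (@measureD _ _ _ mu) => //; rewrite -ge0_fin_numE// M1_fin.
    by rewrite (_ : _ `&` _ = FN N)//; apply/setIidPr.
  rewrite fineB ?M1_fin//; move: HN => /=; rewrite ltr_norml => /andP[_]; lra.
have mD1 : measurable (\bigcup_n U n `\` \bigcup_n F n) by exact: measurableD.
have mD2 : measurable (\bigcup_n F n `\` FN N) by exact: measurableD.
have := @M1_le_sum _ _ mu bool [:: true; false] (\bigcup_n U n `\` FN N)
  (fun b => if b then \bigcup_n U n `\` \bigcup_n F n else \bigcup_n F n `\` FN N).
rewrite big_cons big_seq1 => H; apply: (le_lt_trans (H _ _ _)).
- exact: measurableD.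
- by case.
- move=> x [Ux nFx]; have [Fx|nF] := pselect ((\bigcup_n F n) x).
    by exists false.
  by exists true.
by move: h1 h2; lra.
Qed.

Lemma inner_regular mu (A : set (borel X)) (e : R) : measurable A -> 0 < e ->
  exists F, [/\ closed (F : set X), F `<=` A & fine (mu (A `\` F)) < e].
Proof.
move=> mA e0; have : regular mu A.
  have H : sigma_algebra setT (regular mu).
    split.
    - move=> d d0; exists set0, set0; split => //; [exact: closed0|exact: open0|].
      by rewrite setD0 measure0.
    - by move=> B; rewrite setTD; exact: regularC.
    - exact: regular_bigcup.
  by move: A mA; apply: smallest_sub => // U oU; exact: regular_open.
move=> /(_ e e0)[F [U [cF oU FA AU FUe]]]; exists F; split => //.
apply: le_lt_trans FUe; apply: le_M1.
- by apply: measurableD => //; exact: closed_borel.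
- by apply: measurableD; [exact: open_borel|exact: closed_borel].
- by move=> x [/AU].
Qed.

(** The distance to [B] is positive on [A], hence bounded below there by compactness. Stated near
    [0^'+], finitely many such requirements can be met by one [e]. *)
Lemma closed_disjoint_far (A B : set X) : closed A -> closed B ->
  A `&` B = set0 ->
  \forall e \near 0^'+, forall x y, A x -> B y -> e < mdist x y.
Proof.
move=> cA cB AB; have [B0|/set0P B0] := eqVneq B set0.
  by apply: nearW => e x y _; rewrite B0.
pose U n := ~` A `|` [set x | n.+1%:R^-1 < dist_to B x].
have [||x|n Un] := @compact_increasing_cover X U X_compact.
- move=> n; apply: openU; first exact: closed_openC.
  by apply: open_superlevel; exact: dist_to_continuous.
- move=> m n mn x [nAx|/= h]; [by left|right => /=].
  by apply: le_lt_trans h; rewrite lef_pV2 ?posrE ?ltr0n// ler_nat ltnS.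
- have [Ax|nAx] := pselect (A x); last by exists 0%N; left.
  have nBx : (~` B) x by move=> Bx; have : (A `&` B) x by []; rewrite AB.
  have d0 : 0 < dist_to B x.
    have /nbhs_ballP[e e0 eB] : nbhs x (~` B).
      by apply: open_nbhs_nbhs; split => //; exact: closed_openC.
    apply: (lt_le_trans e0); apply: le_dist_to => // b Bb.
    rewrite leNgt; apply/negP => xb; apply: (eB b) => //.
    by rewrite ballEmdist.
  exists (Num.bound (dist_to B x)^-1); right => /=.
  rewrite invf_plt ?posrE// -natr1 (lt_trans (archi_boundP _)) ?ltrDl//.
  by rewrite invr_ge0 ltW.
near=> e => x y Ax By; have := Un x; case=> // /= h.
apply: lt_le_trans (dist_to_le _ By); apply: lt_trans h.
near: e; apply: nbhs_right_lt; by rewrite invr_gt0.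
Unshelve. all: by end_near. Qed.

Lemma continuous_uniformly (f : X -> R) (r : R) : continuous f -> 0 < r ->
  \forall e \near 0^'+, forall x y, mdist x y <= e -> `|f x - f y| <= r.
Proof.
move=> cf r0; pose U n := [set x : X | forall y z, mdist x y < n.+1%:R^-1 ->
  mdist x z < n.+1%:R^-1 -> `|f y - f z| <= r]^°.
have [||x|n Un] := @compact_increasing_cover X U X_compact.
- by move=> n; exact: open_interior.
- move=> m n mn; apply: interiorS => x H y z xy xz.
  have nm : n.+1%:R^-1 <= m.+1%:R^-1 :> R.
    by rewrite lef_pV2 ?posrE ?ltr0n// ler_nat ltnS.
  by apply: H; [exact: lt_le_trans xy _|exact: lt_le_trans xz _].
- have r20 : 0 < r / 2 by rewrite divr_gt0.
  have /cvgrPdist_lt/(_ _ r20) := cf x.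
  move=> /nbhs_ballP[e /= e0]; rewrite ballEmdist => He.
  have [n ne] : exists n, n.+1%:R^-1 < e / 2.
    exists (Num.bound (e / 2)^-1).
    rewrite invf_plt ?posrE ?divr_gt0// (lt_trans (archi_boundP _)) ?ltr_nat//.
    by rewrite invr_ge0 ltW// divr_gt0.
  exists n; apply/nbhs_ballP; exists (e / 2); first by rewrite /= divr_gt0.
  move=> w; rewrite ballEmdist /= => xw y z wy wz.
  have near_x v : mdist w v < n.+1%:R^-1 -> `|f x - f v| < r / 2.
    move=> wv; apply: He => /=; rewrite (le_lt_trans (metric_triangle _ w _))//.
    by rewrite [ltRHS]splitr ltrD// (lt_trans wv).
  have := near_x y wy; have := near_x z wz.
  rewrite !ltr_norml ler_norml => /andP[? ?] /andP[? ?]; apply/andP; split; lra.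
near=> e => x y xy.
have /= := interior_subset (Un x); apply; first by rewrite mdistxx invr_gt0.
apply: (le_lt_trans xy); near: e; apply: nbhs_right_lt; by rewrite invr_gt0.
Unshelve. all: by end_near. Qed.

End regularity.

(** * Entropy and coverings of typical points by dynamical balls *)

Section typical_itineraries.
Context {R : realType} {X : pmetricType R}.
Hypothesis X_compact : compact [set: X].
Variable T : X -> X.
Hypothesis T_continuous : continuous T.
Implicit Types (mu rho : M1 X).

(** Two points of [K] within [e] of the same orbit point are within [2 * e] of each other, hence
    share an atom. A guess at time [i] fails only if [x] is outside [G] or its [i]-th iterate is
    outside [K]; the two probabilities, the second one by invariance, add up to at most [2 * c], and
    [shannon_fano] bounds the entropy of each error. *)
Lemma entropy_le_ln_cover rho k (p : borel X -> 'I_k) (K G : set (borel X))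
    (e c t : R) m (s : seq X) :
  invariant_measures T rho -> fin_measurable p -> measurable K -> measurable G ->
  (forall x y, K x -> K y -> mdist x y <= 2 * e -> p x = p y) ->
  (forall x, G x -> exists2 y, y \in s & dynamical_ball T m y e x) ->
  fine (rho (~` K)) <= c -> fine (rho (~` G)) <= c -> 0 < t < 1 ->
  rv_entropy rho (itinerary T p m) <=
    ln (size s).+1%:R + m%:R * (- ln (1 - t) + 2 * c * ln (k%:R / t)).
Proof.
move=> iT mp mK mG Kp Gs rK rG t01.
have k0 : (0 < k)%N by exact: leq_trans (ltn_ord (p point)).
pose a (y : X) (x : X) := `[< dynamical_ball T m y e x >].
(* The index of the first ball containing [x]; the value [size s] stands for points outside all
   balls. *)
pose c0 x : 'I_(size s).+1 := inord (find (a^~ x) s).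
have mc0 : fin_measurable (c0 : borel X -> _).
  move=> i; rewrite (_ : _ @^-1` _ = [set x | find (a^~ x) s = i]).
    apply: (@find_preimage_ind _ _ (@measurable _ (borel X))) => //.
    - by move=> A; exact: measurableC.
    - by move=> A B; exact: measurableI.
    move=> y; rewrite (_ : [set _ | _] = dynamical_ball T m y e).
      by apply: closed_borel; exact: closed_dynamical_ball.
    by apply/seteqP; split => x /=; rewrite /a => /asboolP.
  apply/seteqP; split => y /=.
    by move=> <-; rewrite inordK// ltnS find_size.
  by move=> yi; apply/val_inj; rewrite /= inordK ?yi// ltnS -ltnS; exact: ltn_ord.
(* The guess is the common atom of the points of [K] near the centre's orbit at time [i], and
   arbitrary if there are none. *)
have /choice[gs gsP] : forall (iy : nat * 'I_(size s).+1), exists j : 'I_k,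
    forall x, K x -> mdist (iter iy.1 T (nth point s iy.2)) x <= e -> p x = j.
  move=> [i y] /=; set z := iter i T _.
  have [[x [Kx zx]]|nx] := pselect (exists x, K x /\ mdist z x <= e).
    exists (p x) => x' Kx' zx'; apply: Kp => //.
    rewrite (le_trans (metric_triangle _ z _))// (metric_sym _ z).
    by move: zx zx'; lra.
  by exists (p point) => x Kx zx; exfalso; apply: nx; exists x.
(* [er i x] is [None] when the itinerary at time [i] is the one guessed from the
   ball containing [x]; the itinerary is a function of [c0] and the [er i]. *)
pose er i (x : borel X) : option 'I_k :=
  if p (iter i T x) == gs (i, c0 x) then None else Some (p (iter i T x)).
have mer i : fin_measurable (er i).
  rewrite (_ : er i = (fun v : 'I_k * 'I_(size s).+1 =>
      if v.1 == gs (i, v.2) then None else Some v.1) \o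
      (fun x => ((p \o iter i T : borel X -> 'I_k) x, c0 x)))//.
  by apply: fin_measurable_comp; apply: fin_measurable_pair => //; exact: fin_measurable_iter.
have ent_er i : (i < m)%N -> rv_entropy rho (er i) <= - ln (1 - t) + 2 * c * ln (k%:R / t).
  move=> im; apply: (@shannon_fano _ _ _ None) => //.
  - by move=> ?; exact: dist_ge0.
  - exact: sum_dist.
  - rewrite /dist; pose N := er i @^-1` [set None].
    have mN : measurable N by exact: mer.
    have -> : 1 - fine (rho N) = fine (rho (~` N)).
      have -> : rho (~` N) = (1 - rho N)%E by exact: (@probability_setC _ _ _ rho).
      by rewrite fineB// M1_fin.
    have mTK : measurable (iter i T @^-1` (~` K) : set (borel X)).
      apply: measurable_preimage_continuous; first exact: iter_continuous.
      exact: measurableC.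
    have := @M1_le_sum _ _ rho bool [:: true; false] (~` N)
      (fun b => if b then ~` G else iter i T @^-1` (~` K)).
    rewrite big_cons big_seq1 invariant_iter//; last exact: measurableC.
    move=> H; apply: (le_trans (H _ _ _)).
    + exact: measurableC.
    + by case => //; exact: measurableC.
    + move=> x nNx; have [Gx|nGx] := pselect (G x); last by exists true.
      exists false => // Kx; apply: nNx; rewrite /N/= /er.
      have [y ys yx] := Gs x Gx.
      have hs : has (a^~ x) s by apply/hasP; exists y => //; exact/asboolP.
      have /asboolP := nth_find point hs; move=> /(_ i im) h.
      rewrite (gsP (i, c0 x) (iter i T x)) ?eqxx//=.
      by rewrite inordK// ltnS find_size.
    by move: rK rG; lra.
  - by rewrite card_option card_ord.
have mword : fin_measurable (word er m) by exact: fin_measurable_word.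
pose h (v : 'I_(size s).+1 * {ffun 'I_m -> option 'I_k}) : {ffun 'I_m -> 'I_k} :=
  [ffun i : 'I_m => odflt (gs (val i, v.1)) (v.2 i)].
have -> : itinerary T p m = h \o (fun x => (c0 x, word er m x)).
  apply/funext => x; apply/ffunP => i; rewrite !ffunE/= /er.
  by case: eqP => [->|].
rewrite (le_trans (ler_rv_entropy_comp _ _ _))//; first exact: fin_measurable_pair.
rewrite (le_trans (rv_entropy_pair _ _ _))//; apply: lerD.
  by rewrite (le_trans (rv_entropy_le_ln_card _ _))// card_ord.
rewrite (le_trans (rv_entropy_word _ _ _))//.
rewrite mulr_natl -[X in _ *+ X](card_ord m) -sumr_const.
by apply: ler_sum => i _; exact: ent_er.
Qed.

Lemma M1_sum_le mu (I : eqType) (s : seq I) (A : set (borel X))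
    (B : I -> set (borel X)) : uniq s -> measurable A ->
  (forall i, measurable (B i)) -> (forall i, i \in s -> B i `<=` A) ->
  (forall i j, i \in s -> j \in s -> i != j -> B i `&` B j = set0) ->
  \sum_(i <- s) fine (mu (B i)) <= fine (mu A).
Proof.
elim: s A => [|i s ih] A /=; first by rewrite big_nil fine_ge0.
move=> /andP[nis us] mA mB BA Bd; rewrite big_cons.
have mAB : measurable (A `\` B i) by exact: measurableD.
have -> : fine (mu A) = fine (mu (B i)) + fine (mu (A `\` B i)).
  have -> : mu (A `\` B i) = (mu A - mu (B i))%E.
    have -> : mu (A `\` B i) = (mu A - mu (A `&` B i))%E.
      by apply: (@measureD _ _ _ mu) => //; rewrite -ge0_fin_numE// M1_fin.
    by rewrite (_ : A `&` B i = B i)//; apply/setIidPr; apply: BA; exact: mem_head.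
  by rewrite fineB ?M1_fin// addrC subrK.
rewrite lerD2l; apply: ih => //.
- move=> j js x Bjx; split; first by apply: (BA j); rewrite ?inE ?js ?orbT.
  move=> Bix; have ij : i != j by apply: contraNneq nis => ->.
  have := Bd i j (mem_head _ _); rewrite inE js orbT => /(_ isT ij).
  by move=> E; have : set0 x by rewrite -E.
- by move=> j l js ls; apply: Bd; rewrite inE ?js ?ls orbT.
Qed.

(** Lusin's idea: each atom is replaced by a closed subset at a loss below [c / k]. Disjoint closed
    sets of a compact space are a positive distance apart, so nearby points of the union lie in the
    same atom. *)
Lemma exists_compact_core rho k (p : borel X -> 'I_k) (c : R) :
  fin_measurable p -> 0 < c ->
  exists (K : set X) (e : R), [/\ closed K, 0 < e, fine (rho (~` K)) <= c &
    forall x y, K x -> K y -> mdist x y <= e -> p x = p y].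
Proof.
move=> mp c0; have k0 : (0 < k)%N by exact: leq_trans (ltn_ord (p point)).
have ck0 : 0 < c / k%:R by rewrite divr_gt0// ltr0n.
have /choice[F HF] := fun j => inner_regular X_compact rho (mp j) ck0.
have cF j : closed (F j : set X) by case: (HF j).
have Fp j x : F j x -> p x = j by case: (HF j) => _ + _; apply.
have mF j : measurable (F j : set (borel X)) by exact: closed_borel.
pose K : set (borel X) := \bigcup_j F j.
have far i j : i != j ->
    \forall e \near 0^'+, forall x y, F i x -> F j y -> e < mdist x y.
  move=> ij; apply: closed_disjoint_far => //.
  apply/seteqP; split=> // x [/Fp pi /Fp pj]; move: ij.
  by rewrite -pi -pj eqxx.
have [e e0 He] : exists2 e : R, 0 < e & forall i j, i != j ->
    forall x y, F i x -> F j y -> e < mdist x y.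
  have H : \forall e \near (0 : R)^'+, forall ij : 'I_k * 'I_k, ij.1 != ij.2 ->
      forall x y, F ij.1 x -> F ij.2 y -> e < mdist x y.
    apply: filter_forall => -[i j] /=.
    have [->|ij] := eqVneq i j; first exact: nearW.
    by apply: filterS (far _ _ ij) => e H _.
  have [e [H1 H2]] := filter_ex (filterI (nbhs_right_gt (0 : R)) H).
  by exists e => // i j; exact: (H2 (i, j)).
exists K, e; split => //.
- by apply: closed_bigcup => //; exact: finite_finset.
- apply: (@le_trans _ _ (\sum_(j <- enum 'I_k) fine (rho (p @^-1` [set j] `\` F j)))).
    apply: M1_le_sum.
    + by apply: measurableC; apply: fin_bigcup_measurable => //; exact: finite_finset.
    + by move=> j; apply: measurableD.
    + move=> x nKx; exists (p x); first by rewrite mem_enum.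
      by split => // Fx; apply: nKx; exists (p x).
  apply: (@le_trans _ _ (\sum_(j <- enum 'I_k) c / k%:R)).
    by apply: ler_sum => j _; case: (HF j) => _ _ /ltW.
  rewrite big_const_seq count_predT -cardE card_ord iter_addr_0 -[_ *+ k]mulr_natl.
  by rewrite mulrC divfK// pnatr_eq0 -lt0n.
move=> x y [i _ Fx] [j _ Fy] xy; rewrite (Fp _ _ Fx) (Fp _ _ Fy).
apply/eqP; apply: contraTT xy => ij; rewrite -ltNge.
exact: (He _ _ ij).
Qed.

Lemma near_forall_seq (s : seq (X -> R)) (P : (X -> R) -> set R)
    (F : set_system R) : Filter F -> (forall f, f \in s -> F (P f)) ->
  F [set e | forall f, f \in s -> P f e].
Proof.
move=> FF; elim: s => [|f s ih] H; first by apply: filterE => e g.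
have H1 := ih (fun g gs => H g (mem_behead (gs : g \in behead (f :: s)))).
apply: filterS (filterI H1 (H f (mem_head _ _))) => e [h1 h2] g.
by rewrite inE => /predU1P[->|/h1].
Qed.

Lemma ergodic_typical_set rho (s : seq (X -> R)) (r e : R) :
  ergodic T rho -> (forall f, f \in s -> continuous f) -> 0 < r -> 0 < e ->
  exists N, forall m, (N <= m)%N -> (0 < m)%N ->
  fine (rho (~` [set x | forall f, f \in s ->
    `|m%:R^-1 * \sum_(k < m) f (iter k T x) - \int[rho]_x f x| <= r])) <= e.
Proof.
(* A union bound over the test functions; the successor keeps the divisor positive when [s] is
   empty. *)
move=> erg cs r0 e0; pose n := (size s).+1.
have n0 : 0 < n%:R :> R by rewrite ltr0n.
have en0 : 0 < e / n%:R by rewrite divr_gt0.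
have /choice[N HN] : forall f : X -> R, exists N, f \in s ->
    forall m, (N <= m)%N -> (0 < m)%N ->
    fine (rho [set x | r <
      `|m%:R^-1 * \sum_(k < m) f (iter k T x) - \int[rho]_x f x|]) < e / n%:R.
  move=> f; have [fs|] := boolP (f \in s); last by exists 0%N.
  have [N HN] := birkhoff_in_probability X_compact T_continuous erg (cs f fs) r0 en0.
  by exists N.
exists (\max_(f <- s) N f)%N => m Nm m0.
have cb (f : X -> R) : f \in s -> continuous (fun x =>
    `|m%:R^-1 * \sum_(k < m) f (iter k T x) - \int[rho]_x f x|).
  move=> fs x; apply: (@continuous_comp _ _ _ (fun x =>
    m%:R^-1 * \sum_(k < m) f (iter k T x) - \int[rho]_x f x) Num.norm);
    last exact: norm_continuous.
  apply: cvgB; last exact: cvg_cst.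
  apply: cvgM; first exact: cvg_cst.
  by apply: birkhoff_sum_continuous => //; exact: cs.
pose B (f : X -> R) : set (borel X) := if f \in s then [set x | r <
  `|m%:R^-1 * \sum_(k < m) f (iter k T x) - \int[rho]_x f x|] else set0.
have oB f : open (B f : set X).
  rewrite /B; case: ifPn => [fs|_]; last exact: open0.
  by apply: open_superlevel; exact: cb.
apply: (@le_trans _ _ (\sum_(f <- s) fine (rho (B f)))).
  apply: M1_le_sum.
  - apply: measurableC; apply: closed_borel.
    rewrite (_ : [set _ | _] = \bigcap_(f in [set f | f \in s]) ~` (B f)).
      by apply: closed_bigI => f fs; exact: open_closedC.
    apply/seteqP; split => x H f fs; have := H f fs; rewrite /B fs/=.
      by move=> h; apply/negP; rewrite -leNgt.
    by move=> /negP; rewrite -leNgt.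
  - by move=> f; exact: open_borel.
  - move=> x nx; apply: contrapT => H; apply: nx => f fs /=.
    by rewrite leNgt; apply/negP => h; apply: H; exists f => //; rewrite /B fs.
apply: (@le_trans _ _ (\sum_(f <- s) e / n%:R)).
  rewrite big_seq [leRHS]big_seq; apply: ler_sum => f fs.
  rewrite /B fs ltW//; apply: HN => //; apply: leq_trans Nm.
  exact: leq_bigmax_seq.
rewrite big_const_seq count_predT iter_addr_0 -[_ *+ size s]mulr_natl.
rewrite mulrA ler_pdivrMr// mulrC ler_pM2l// ler_nat.
exact: leqnSn.
Qed.

End typical_itineraries.

(** * From ergodic measures to the lower bound *)

Section lower_bound.
Context {R : realType} {X : pmetricType R}.
Hypothesis X_compact : compact [set: X].
Variables (T : X -> X) (phi : X -> R) (nu : M1 X).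
Hypotheses (T_continuous : continuous T) (phi_continuous : continuous phi).
Hypothesis nu_gibbs : weak_gibbs T phi nu.
Implicit Types (mu rho : M1 X).

Lemma ldp_lower_ergodic rho (G : set (M1 X)) (h eta : R) :
  ergodic T rho -> open G -> G rho -> (h%:E < entropy T rho)%E -> 0 < eta ->
  \forall m \near \oo, ((h + \int[rho]_x phi x - eta)%:E <=
    (m%:R^-1)%:E * lne (nu [set x | G (empirical T m x)]))%E.
Proof.
move=> erg oG Grho hrho eta0; have iT := erg.1.
(* Five losses of [q]: two terms of the coding bound, the factor 2 hidden in [(size Y).+1], the
   Gibbs error, and the deviation of the averages of [phi]. *)
pose q := eta / 5; have q0 : 0 < q by rewrite divr_gt0.
have [k [p [mp hp]]] := lt_entropy T_continuous iT hrho.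
have k0 : (0 < k)%N by exact: leq_trans (ltn_ord (p point)).
pose t := 1 - expR (- q).
have t01 : 0 < t < 1.
  have : expR (- q) < 1 by rewrite -expR0 ltr_expR oppr_lt0.
  by have := expR_gt0 (- q); rewrite /t; lra.
have lnt : - ln (1 - t) = q by rewrite /t opprB addrC subrK expRK opprK.
pose l := ln (k%:R / t).
have l0 : 0 <= l.
  case/andP: t01 => t0 t1; apply: ln_ge0; rewrite ler_pdivlMr// mul1r.
  by rewrite (le_trans (ltW t1))// ler1n.
(* The second bound keeps the Fano term [2 * c * l] below [q]; the first keeps [c] below 1, so that
   typical points exist. *)
pose c := Num.min 2^-1 (q / (2 * (l + 1))).
have l10 : 0 < 2 * (l + 1) by rewrite mulr_gt0// ltr_wpDl.
have c0 : 0 < c by rewrite lt_min invr_gt0 ltr0n divr_gt0.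
have c1 : c < 1 by rewrite gt_min invf_lt1// ltr1n.
have cl : 2 * c * l <= q.
  apply: (@le_trans _ _ (c * (2 * (l + 1)))).
    by rewrite mulrC mulrA [leRHS]mulrC ler_pM2r//; lra.
  by rewrite -ler_pdivlMr// ge_min lexx orbT.
have [K [e1 [cK e10 rK Kp]]] := exists_compact_core X_compact rho mp c0.
have mK : measurable (K : set (borel X)) by exact: closed_borel.
have /nbhs_M1_basic[s [r [r0 cs sG]]] : nbhs rho G by exact: open_nbhs_nbhs.
(* [phi] joins the functions that test membership in [G], because the Gibbs bound involves its
   Birkhoff sums. *)
pose s' := phi :: s.
have cs' f : f \in s' -> continuous f by rewrite inE => /predU1P[->//|/cs].
(* A typical centre is off by at most [r1], and moving within its ball adds [r1 / 2]: at most three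
   quarters of [r] in total. *)
pose r1 := Num.min r q / 2.
have r10 : 0 < r1 by rewrite divr_gt0// lt_min r0 q0.
have r1r : r1 <= r / 2 by rewrite ler_pM2r ?invr_gt0// ge_min lexx.
have r1q : r1 <= q / 2 by rewrite ler_pM2r ?invr_gt0// ge_min lexx orbT.
have r120 : 0 < r1 / 2 by rewrite divr_gt0.
have [e2 e20 He2] := gibbs_bounds X_compact T_continuous phi_continuous nu_gibbs q0.
(* The covering balls have radius [2 * e], and the coding bound doubles this once more; hence
   [2 * (2 * e) <= e1]. *)
have [e [e0 ee1 ee2 unif]] : exists e, [/\ 0 < e, 2 * (2 * e) <= e1, e <= e2 &
    forall f, f \in s' -> forall x y, mdist x y <= e -> `|f x - f y| <= r1 / 2].
  have e40 : 0 < e1 / 4 by rewrite divr_gt0.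
  have H := @near_forall_seq R X s' (fun f => [set e : R | forall x y : X,
    mdist x y <= e -> `|f x - f y| <= r1 / 2]) _ (at_right_proper_filter (0 : R))
    (fun f fs => continuous_uniformly X_compact (cs' f fs) r120).
  have [e [[[H1 H2] H3] H4]] := filter_ex (filterI (filterI (filterI
    (nbhs_right_gt (0 : R)) (nbhs_right_le e40)) (nbhs_right_le e20)) H).
  by exists e; split => //; move: H2 => /=; lra.
have [N1 HN1] := He2 e e0 ee2.
have [N2 HN2] := ergodic_typical_set X_compact T_continuous erg cs' r10 c0.
pose N3 := (Num.bound (ln 2 / q)).+1.
exists (maxn N1 (maxn N2 N3)) => // m /=; rewrite !geq_max => /and3P[mN1 mN2 mN3].
have m0 : (0 < m)%N by exact: leq_trans mN3.
have m0' : 0 < m%:R :> R by rewrite ltr0n.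
pose Gam := [set x | forall f, f \in s' ->
  `|m%:R^-1 * \sum_(k < m) f (iter k T x) - \int[rho]_x f x| <= r1].
have rGam : fine (rho (~` Gam)) <= c by exact: HN2.
have mGam : measurable (Gam : set (borel X)).
  apply: closed_borel.
  rewrite (_ : Gam = \bigcap_(f in [set f | f \in s']) [set x |
    `|m%:R^-1 * \sum_(k < m) f (iter k T x) - \int[rho]_x f x| <= r1])//.
  apply: closed_bigI => f fs; apply: closed_sublevel => x.
  apply: (@continuous_comp _ _ _ (fun x =>
    m%:R^-1 * \sum_(k < m) f (iter k T x) - \int[rho]_x f x) Num.norm);
    last exact: norm_continuous.
  apply: cvgB; last exact: cvg_cst.
  apply: cvgM; first exact: cvg_cst.
  by apply: birkhoff_sum_continuous => //; exact: cs'.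
have e220 : 0 < 2 * e by rewrite mulr_gt0.
have [Y [[uY sepY] YGam Ycov]] :=
  exists_maximal_separated X_compact T_continuous m Gam e220.
have Y0 : (0 < size Y)%N.
  rewrite lt0n; apply/eqP => /size0nil Y0.
  have GE : ~` Gam = setT.
    apply/seteqP; split => // x _ /Ycov[y]; by rewrite Y0.
  by move: rGam; rewrite GE M1_setT/= leNgt c1.
have Kp2 x y : K x -> K y -> mdist x y <= 2 * (2 * e) -> p x = p y.
  by move=> Kx Ky xy; apply: Kp => //; exact: le_trans ee1.
have := entropy_le_ln_cover T_continuous iT mp mK mGam Kp2 Ycov rK rGam t01.
rewrite lnt -/l => HY.
have lnY : m%:R * (h - 2 * q) <= ln (size Y).+1%:R.
  have := hp m m0; rewrite ltr_pdivlMl// => hm.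
  have : m%:R * (q + 2 * c * l) <= m%:R * (2 * q) by rewrite ler_pM2l//; lra.
  by move: hm HY; rewrite mulrBr; lra.
have lnY' : ln (size Y).+1%:R <= ln (size Y)%:R + ln 2 :> R.
  rewrite -lnM ?posrE ?ltr0n// ler_ln ?posrE ?ltr0n// ?mulr_gt0 ?ltr0n//.
  by rewrite -natrM ler_nat muln2 -addnn -addn1 leq_add2l.
have ln2m : ln 2 <= m%:R * q.
  rewrite -ler_pdivrMr// (le_trans (ltW (archi_boundP _)))//.
    by apply: divr_ge0; [rewrite ln_ge0// ler1n|exact: ltW].
  by rewrite ler_nat ltnW.
pose D := [set x | G (empirical T m x)].
have mD : measurable (D : set (borel X)).
  by apply: open_borel; exact: open_empirical.
have BD y : y \in Y -> dynamical_ball T m y e `<=` D.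
  move=> yY x yx; apply: sG => f fs; have fs' : f \in s' by rewrite inE fs orbT.
  rewrite integral_empirical//; last exact: cs.
  have h1 := YGam y yY f fs'.
  have h2 : `|m%:R^-1 * \sum_(k < m) f (iter k T y) -
      m%:R^-1 * \sum_(k < m) f (iter k T x)| <= r1 / 2.
    rewrite -mulrBr normrM ger0_norm ?invr_ge0// ler_pdivrMl// -sumrB.
    rewrite (le_trans (ler_norm_sum _ _ _))//.
    rewrite mulr_natl -[X in _ *+ X](card_ord m) -sumr_const.
    by apply: ler_sum => i _; apply: unif => //; exact: yx.
  move: h1 h2; rewrite !ler_norml ltr_norml => /andP[? ?] /andP[? ?].
  by apply/andP; split; lra.
pose J := \int[rho]_x phi x.
have sumle : (size Y)%:R * expR (m%:R * (J - 2 * q)) <= fine (nu D).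
  apply: (@le_trans _ _ (\sum_(y <- Y) fine (nu (dynamical_ball T m y e)))).
    rewrite mulr_natl -iter_addr_0 -[X in iter X](count_predT Y) -big_const_seq.
    rewrite big_seq [leRHS]big_seq; apply: ler_sum => y yY.
    case/andP: (HN1 m mN1 m0 y) => + _; apply: le_trans; rewrite ler_expR.
    have := YGam y yY phi (mem_head _ _); rewrite -/J ler_norml => /andP[h1 _].
    have : m%:R * (J - q) <= \sum_(k < m) phi (iter k T y).
      by rewrite -ler_pdivlMl//; move: h1 r1q q0; lra.
    by rewrite !mulrBr; lra.
  apply: M1_sum_le => //.
  - by move=> y; apply: closed_borel; exact: closed_dynamical_ball.
  - move=> x y xY yY xy; apply/seteqP; split => // z [xz yz].
    apply: (sepY x y xY yY xy) => i im.
    rewrite (le_trans (metric_triangle _ (iter i T z) _))//.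
    have := xz i im; have := yz i im; rewrite (metric_sym (iter i T y)); lra.
have Y0' : 0 < (size Y)%:R :> R by rewrite ltr0n.
have D0 : 0 < fine (nu D).
  by apply: lt_le_trans sumle; rewrite mulr_gt0// expR_gt0.
rewrite -(fineK (M1_fin nu mD)) lne_EFin// -EFinM lee_fin ler_pdivlMl//.
have : ln ((size Y)%:R * expR (m%:R * (J - 2 * q))) <= ln (fine (nu D)).
  by rewrite ler_ln ?posrE// mulr_gt0// expR_gt0.
rewrite lnM ?posrE ?expR_gt0// expRK => H.
rewrite (_ : m%:R * _ = m%:R * (h - 2 * q) + m%:R * (J - 2 * q) - m%:R * q).
  by move: H lnY lnY' ln2m; lra.
by rewrite /q -/J; field.
Qed.

Hypothesis dense : entropy_dense T.

Lemma ldp_lower (G : set (M1 X)) : open G ->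
  (ereal_sup [set entropy T rho + (\int[rho]_x phi x)%:E
             | rho in G `&` invariant_measures T] <=
   limn_einf (fun m => (m%:R^-1)%:E * lne (nu [set x | G (empirical T m x)])))%E.
Proof.
move=> oG; apply: ge_ereal_sup => _ [rho [Grho irho] <-].
apply: lee_real_below => a; set J := \int[rho]_x phi x => aJ.
(* Three losses of [d] follow: for a strict entropy inequality at [rho'], for the integral of [phi],
   and for [eta]. The entropy may be infinite, in which case [h] is taken large. *)
have [h [d [hrho d0 ahd]]] : exists h d : R, [/\ (h%:E < entropy T rho)%E, 0 < d &
    a <= h + J - 4 * d].
  move: aJ; case: (entropy T rho) => [x||] //.
    rewrite -EFinD lte_fin => aJ; exists (x - (x + J - a) / 5), ((x + J - a) / 5).
    by rewrite lte_fin; split; lra.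
  by move=> _; exists (a - J + 4), 1; rewrite ltry; split => //; lra.
have nJ : nbhs rho (G `&` [set m : M1 X | `|J - \int[m]_x phi x| < d]).
  apply: filterI; first exact: open_nbhs_nbhs.
  by have /cvgrPdist_lt/(_ d d0) := @M1_integral_continuous R X _ phi_continuous rho.
have [rho' [erg [Grho' /= Jrho'] hrho']] := dense irho nJ hrho.
have hrho'd : ((h - d)%:E < entropy T rho')%E.
  by apply: lt_le_trans hrho'; rewrite lte_fin; lra.
apply: limn_einf_ge_near; have := ldp_lower_ergodic erg oG Grho' hrho'd d0.
apply: filterS => m; apply: le_trans; rewrite lee_fin.
by move: Jrho'; rewrite ltr_norml => /andP[? ?]; lra.
Qed.

End lower_bound.

Theorem theorem2 (R : realType) (X : pmetricType R) (T : X -> X)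
  (phi : X -> R) (nu : M1 X)
  (X_compact : compact [set: X])
  (T_continuous : continuous T)
  (T_onto : forall y : X, exists x : X, T x = y)
  (phi_continuous : continuous phi)
  (nu_gibbs : weak_gibbs T phi nu) :
  (upper_semicontinuous_on (invariant_measures T) (entropy T) ->
    forall F : set (M1 X), closed F ->
      (limn_esup (fun m => (m%:R^-1)%:E * lne (nu [set x | F (empirical T m x)]))
        <= ereal_sup [set entropy T rho + (\int[rho]_x phi x)%:E
                     | rho in F `&` invariant_measures T])%E)
  /\
  (entropy_dense T ->
    forall G : set (M1 X), open G ->
      (limn_einf (fun m => (m%:R^-1)%:E * lne (nu [set x | G (empirical T m x)]))
        >= ereal_sup [set entropy T rho + (\int[rho]_x phi x)%:E
                     | rho in G `&` invariant_measures T])%E).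
Proof. by split=> [usc F|dense G]; [exact: ldp_upper|exact: ldp_lower]. Qed.
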